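(* Let $M$ be a smooth manifold, $H$ a real closed 3-form on $M$, and let $L_1,L_2\subset T_{\mathbb C}\oplus T_{\mathbb C}^*$ be complex Dirac structures for $H$. Then $(L_1,L_2)$ defines a generalized Kähler structure (i.e. $L_1,L_2$ are the $+i$-eigenbundles of a pair $(\mathbb J_1,\mathbb J_2)$ forming a generalized Kähler structure) if and only if all of the following conditions hold: (i) $\pi_{T_{\mathbb C}}(L_1)+\pi_{T_{\mathbb C}}(\overline{L_1})=T_{\mathbb C}$ and $\pi_{T_{\mathbb C}}(L_2)+\pi_{T_{\mathbb C}}(\overline{L_2})=T_{\mathbb C}$. (ii) The real Dirac structures $\Gamma_{\pi_1}=\tfrac{1}{2i}(L_1-\overline{L_1})$ and $\Gamma_{\pi_2}=\tfrac1{2i}(L_2-\overline{L_2})$ define real Poisson structures, i.e. $\Gamma_{\pi_1}\cap T=\Gamma_{\pi_2}\cap T=0$. (iii) The complex Dirac structures $L_{\sigma_+}=\tfrac1{2i}(L_1-L_2)$ and $L_{\sigma_-}=\tfrac1{2i}(L_1-\overline{L_2})$ define holomorphic Poisson structures $(I_+,\sigma_+)$ and $(I_-,\sigma_-)$ respectively, i.e. $T_{\mathbb C}=(L_{\sigma_+}\cap T_{\mathbb C})\oplus(\overline{L_{\sigma_+}}\cap T_{\mathbb C})$ and $T_{\mathbb C}=(L_{\sigma_-}\cap T_{\mathbb C})\oplus(\overline{L_{\sigma_-}}\cap T_{\mathbb C})$. (iv) For all nonzero $u\in L_1\cap L_2$ we have $\langle u,\overline u\rangle>0$.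
   Context: $T=TM$, $T_{\mathbb C}=TM\otimes\mathbb C$, $T^*_{\mathbb C}=T^*M\otimes\mathbb C$; $\pi_{T_{\mathbb C}}:T_{\mathbb C}\oplus T_{\mathbb C}^*\to T_{\mathbb C}$ is the projection. Inner product $\langle X+\xi,Y+\eta\rangle=\tfrac12(\xi(Y)+\eta(X))$, extended complex-bilinearly. $H$-twisted Courant bracket: $[X+\xi,Y+\eta]_H=\mathcal L_X(Y+\eta)-i_Yd\xi+i_Yi_XH$. A (real, resp. complex) Dirac structure for $H$ is a maximal isotropic subbundle of $T\oplus T^*$ (resp. $T_{\mathbb C}\oplus T_{\mathbb C}^*$) whose sections are closed under $[\cdot,\cdot]_H$. Operations (fibrewise): $L+L'=\{X+\alpha+\beta : X+\alpha\in L,\ X+\beta\in L'\}$; for a nonzero scalar $\lambda$, $\lambda L=\{X+\lambda\alpha : X+\alpha\in L\}$; $L-L'=L+(-1)L'$. If $\pi(L)+\pi(L')=T$ (or $T_{\mathbb C}$), $L+L'$ is a Dirac structure for the sum of the 3-forms; $\lambda L$ is Dirac for $\lambda H$. The structures $\tfrac1{2i}(L_j-\overline{L_j})$ are invariant under complex conjugation and are regarded as real Dirac structures for the zero 3-form. A Poisson structure $\pi$ is encoded by its graph $\Gamma_\pi=\{\pi\xi+\xi:\xi\in T^*\}$. A holomorphic Poisson structure $(I,\sigma)$ (complex structure $I$, holomorphic Poisson bivector $\sigma$) is encoded by the complex Dirac structure $L_\sigma=\{X+\sigma\zeta+\zeta : X\in T_{0,1},\ \zeta\in T^*_{1,0}\}$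 (for zero 3-form). A generalized complex structure is an orthogonal complex structure $\mathbb J$ on $T\oplus T^*$ whose $+i$-eigenbundle is a complex Dirac structure for $H$; equivalently, a complex Dirac structure $L$ with $L\cap\overline L=0$. A generalized Kähler structure is a pair $(\mathbb J_1,\mathbb J_2)$ of commuting generalized complex structures (for the same $H$) such that $\mathbb G=-\mathbb J_1\mathbb J_2$ satisfies $\langle\mathbb Gu,u\rangle>0$ for all nonzero $u\in T\oplus T^*$. *)

(* Defs.v *)
From HB Require Import structures.
From mathcomp Require Import all_boot all_order all_algebra.
From mathcomp Require Import complex.
From mathcomp Require Import all_classical all_reals all_analysis.

Set Implicit Arguments.
Unset Strict Implicit.
Unset Printing Implicit Defensive.

Import Order.TTheory GRing.Theory Num.Theory.
Import numFieldNormedType.Exports.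

Local Open Scope classical_set_scope.
Local Open Scope ring_scope.

(* Smooth functions on open subsets of R^n *)

Definition pd {R : realType} {n : nat} (i : 'I_n) (f : 'rV[R]_n -> R)
    (x : 'rV[R]_n) : R := 'D_(delta_mx 0 i) f x.

(* C^oo on an open set U: all iterated partial derivatives exist and are
   Frechet differentiable (hence continuous) at every point of U. *)
Definition smooth_on {R : realType} {n : nat} (U : set 'rV[R]_n)
    (f : 'rV[R]_n -> R) : Prop :=
  forall (s : seq 'I_n) (x : 'rV[R]_n), U x ->
    differentiable (foldr pd f s) x.

Definition mx_smooth_on {R : realType} {n m k : nat} (U : set 'rV[R]_n)
    (F : 'rV[R]_n -> 'M[R]_(m, k)) : Prop :=
  forall i j, smooth_on U (fun x => F x i j).

Definition cmx_smooth_on {R : realType} {n m k : nat} (U : set 'rV[R]_n)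
    (F : 'rV[R]_n -> 'M[R[i]]_(m, k)) : Prop :=
  forall i j, smooth_on U (fun x => complex.Re (F x i j)) /\
              smooth_on U (fun x => complex.Im (F x i j)).

Definition cpd {R : realType} {n : nat} (i : 'I_n) (f : 'rV[R]_n -> R[i])
    (x : 'rV[R]_n) : R[i] :=
  (pd i (fun y => complex.Re (f y)) x +i* pd i (fun y => complex.Im (f y)) x)%C.

(* Smooth manifolds.  [coord c] and [param c] are only meaningful on the
   chart domain and on its image; the atlas need not be maximal. *)

Record smoothManifold (R : realType) (n : nat) := SmoothManifold {
  space :> topologicalType;
  space_hausdorff : hausdorff_space space;
  space_second_countable : @second_countable space;
  charts : Type;
  dom : charts -> set space;
  coord : charts -> space -> 'rV[R]_n;
  param : charts -> 'rV[R]_n -> space;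
  dom_cover : forall p : space, exists c, dom c p;
  dom_open : forall c, open (dom c);
  range_open : forall c, open (coord c @` dom c);
  coordK : forall c p, dom c p -> param c (coord c p) = p;
  coord_continuous : forall c p, dom c p -> {for p, continuous (coord c)};
  param_continuous : forall c x, (coord c @` dom c) x ->
    {for x, continuous (param c)};
  transition_smooth : forall c d,
    mx_smooth_on (coord c @` (dom c `&` dom d))
      (fun x => coord d (param c x))
}.

Definition chart_range {R : realType} {n : nat} {M : smoothManifold R n}
    (c : charts M) : set 'rV[R]_n := coord c @` dom c.

Definition chart_open {R : realType} {n : nat} {M : smoothManifold R n}
    (c : charts M) (V : set 'rV[R]_n) : Prop :=
  open V /\ V `<=` chart_range c.

(* Geometric objects on M are given by their local representatives in every
   chart, as functions of the coordinates, subject to the transformation laws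
   stated below.  Only the values on [chart_range c] are meaningful. *)
Definition chartwise {R : realType} {n : nat} (M : smoothManifold R n)
    (T : Type) : Type := charts M -> 'rV[R]_n -> T.

(* Entry (i, j) is d y^j / d x^i with x = coord c and y = coord d, so that the
   components of a tangent vector, as a row, transform by X |-> X *m jac. *)
Definition jac {R : realType} {n : nat} {M : smoothManifold R n}
    (c d : charts M) (p : M) : 'M[R]_n :=
  \matrix_(i, j) pd i (fun x => coord d (param c x) 0 j) (coord c p).

(* An element X + xi of T (+) T* is the row vector [row_mx X xi]. *)
Definition transition {R : realType} {n : nat} {M : smoothManifold R n}
    (c d : charts M) (p : M) : 'M[R]_(n + n) :=
  block_mx (jac c d p) 0 0 (invmx (jac c d p))^T.

Definition toC {R : realType} {m k : nat} (A : 'M[R]_(m, k)) : 'M[R[i]]_(m, k) :=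
  map_mx (real_complex R) A.

Definition conj_mx {R : realType} {m k : nat} (A : 'M[R[i]]_(m, k)) :
  'M[R[i]]_(m, k) := map_mx conjc A.

Definition conj_set {R : realType} {m : nat} (S : set 'rV[R[i]]_m) :
  set 'rV[R[i]]_m := [set u | S (conj_mx u)].

Definition real_set {R : realType} {m : nat} (S : set 'rV[R[i]]_m) :
  set 'rV[R]_m := [set u | S (toC u)].

(* Linear algebra in a fibre of T (+) T* or of its complexification *)

Definition pairing {K : fieldType} {n : nat} (u v : 'rV[K]_(n + n)) : K :=
  2^-1 * ((rsubmx u *m (lsubmx v)^T) 0 0 + (rsubmx v *m (lsubmx u)^T) 0 0).

Definition is_subspace {K : fieldType} {m : nat} (S : set 'rV[K]_m) : Prop :=
  S 0 /\ forall (a : K) u v, S u -> S v -> S (a *: u + v).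

Definition isotropic {K : fieldType} {n : nat} (S : set 'rV[K]_(n + n)) : Prop :=
  forall u v, S u -> S v -> pairing u v = 0.

Definition maximal_isotropic {K : fieldType} {n : nat}
    (S : set 'rV[K]_(n + n)) : Prop :=
  [/\ is_subspace S, isotropic S &
      forall W, is_subspace W -> isotropic W -> S `<=` W -> W `<=` S].

Definition projT {K : fieldType} {n : nat} (S : set 'rV[K]_(n + n)) :
  set 'rV[K]_n := [set X | exists alpha, S (row_mx X alpha)].

Definition capT {K : fieldType} {n : nat} (S : set 'rV[K]_(n + n)) :
  set 'rV[K]_n := [set X | S (row_mx X 0)].

Definition dadd {K : fieldType} {n : nat} (L L' : set 'rV[K]_(n + n)) :
    set 'rV[K]_(n + n) :=
  [set u | exists X alpha beta, [/\ L (row_mx X alpha), L' (row_mx X beta) &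
                                  u = row_mx X (alpha + beta)]].

Definition dscale {K : fieldType} {n : nat} (a : K) (L : set 'rV[K]_(n + n)) :
    set 'rV[K]_(n + n) :=
  [set u | exists X alpha, L (row_mx X alpha) /\ u = row_mx X (a *: alpha)].

Definition dsub {K : fieldType} {n : nat} (L L' : set 'rV[K]_(n + n)) :
    set 'rV[K]_(n + n) := dadd L (dscale (-1) L').

Definition half_diff {R : realType} {n : nat} (L L' : set 'rV[R[i]]_(n + n)) :
    set 'rV[R[i]]_(n + n) := dscale (2 * 'i%C)^-1 (dsub L L').

Definition sum_full {K : fieldType} {m : nat} (A B : set 'rV[K]_m) : Prop :=
  forall Z, exists X Y, [/\ A X, B Y & Z = X + Y].

Definition direct_sum_full {K : fieldType} {m : nat} (A B : set 'rV[K]_m) :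
    Prop :=
  forall Z, exists! XY : 'rV[K]_m * 'rV[K]_m,
    [/\ A XY.1, B XY.2 & Z = XY.1 + XY.2].

(* Brackets, in coordinates *)

Definition lie_bracket {R : realType} {n : nat} (X Y : 'rV[R]_n -> 'rV[R[i]]_n)
    (x : 'rV[R]_n) : 'rV[R[i]]_n :=
  \row_k \sum_j (X x 0 j * cpd j (fun y => Y y 0 k) x
                 - Y x 0 j * cpd j (fun y => X y 0 k) x).

Definition lie_form {R : realType} {n : nat} (X eta : 'rV[R]_n -> 'rV[R[i]]_n)
    (x : 'rV[R]_n) : 'rV[R[i]]_n :=
  \row_k \sum_j (X x 0 j * cpd j (fun y => eta y 0 k) x
                 + eta x 0 j * cpd k (fun y => X y 0 j) x).

Definition contract_d {R : realType} {n : nat} (Y xi : 'rV[R]_n -> 'rV[R[i]]_n)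
    (x : 'rV[R]_n) : 'rV[R[i]]_n :=
  \row_k \sum_j Y x 0 j * (cpd j (fun y => xi y 0 k) x
                           - cpd k (fun y => xi y 0 j) x).

(* [X + xi, Y + eta]_H = L_X (Y + eta) - i_Y d xi + i_Y i_X H, where
   (i_Y i_X H)_k = H_ijk X^i Y^j. *)
Definition courant {R : realType} {n : nat}
    (H : 'rV[R]_n -> 'I_n -> 'I_n -> 'I_n -> R)
    (s t : 'rV[R]_n -> 'rV[R[i]]_(n + n)) (x : 'rV[R]_n) : 'rV[R[i]]_(n + n) :=
  let X := fun y => lsubmx (s y) in let xi := fun y => rsubmx (s y) in
  let Y := fun y => lsubmx (t y) in let eta := fun y => rsubmx (t y) in
  row_mx (lie_bracket X Y x)
    (lie_form X eta x - contract_d Y xi x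
     + \row_k \sum_i \sum_j (H x i j k)%:C%C * X x 0 i * Y x 0 j).

(* Real closed 3-forms *)

Definition closed_3form {R : realType} {n : nat} {M : smoothManifold R n}
    (H : chartwise M ('I_n -> 'I_n -> 'I_n -> R)) : Prop :=
  [/\ forall c i j k, smooth_on (chart_range c) (fun x => H c x i j k),
      forall c x, chart_range c x -> forall i j k,
        H c x j i k = - H c x i j k /\ H c x i k j = - H c x i j k,
      forall c d p, dom c p -> dom d p -> forall i j k,
        H c (coord c p) i j k =
        \sum_a \sum_b \sum_e jac c d p i a * jac c d p j b * jac c d p k e
                             * H d (coord d p) a b e
    & forall c x, chart_range c x -> forall i j k l,
        pd i (fun y => H c y j k l) x - pd j (fun y => H c y i k l) x
        + pd k (fun y => H c y i j l) x - pd l (fun y => H c y i j k) x = 0].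

(* Subbundles of T_C (+) T_C^* and complex Dirac structures *)

Definition cbundle {R : realType} {n : nat} (M : smoothManifold R n) : Type :=
  chartwise M (set 'rV[R[i]]_(n + n)).

Definition local_section {R : realType} {n m : nat}
    (D : 'rV[R]_n -> set 'rV[R[i]]_m) (V : set 'rV[R]_n)
    (s : 'rV[R]_n -> 'rV[R[i]]_m) : Prop :=
  cmx_smooth_on V s /\ forall x, V x -> D x (s x).

Definition subbundle {R : realType} {n : nat} {M : smoothManifold R n}
    (L : cbundle M) : Prop :=
  (forall c d p, dom c p -> dom d p -> forall u,
     L c (coord c p) u <-> L d (coord d p) (u *m toC (transition c d p))) /\
  (* smooth local frames: the rows of F *)
  (forall c x0, chart_range c x0 -> exists V k (F : 'rV[R]_n -> 'M[R[i]]_(k, n + n)),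
     [/\ chart_open c V, V x0, cmx_smooth_on V F &
         forall x, V x -> row_free (F x) /\
           forall u, L c x u <-> (u <= F x)%MS]).

Definition complex_dirac {R : realType} {n : nat} {M : smoothManifold R n}
    (H : chartwise M ('I_n -> 'I_n -> 'I_n -> R)) (L : cbundle M) : Prop :=
  [/\ subbundle L,
      forall c x, chart_range c x -> maximal_isotropic (L c x)
    & forall c V s t, chart_open c V ->
        local_section (L c) V s -> local_section (L c) V t ->
        forall x, V x -> L c x (courant (H c) s t x)].

(* Generalized complex and generalized Kaehler structures.  An endomorphism J
   acts on row vectors by u |-> u *m J. *)

Definition eigenbundle {R : realType} {n : nat} {M : smoothManifold R n}
    (J : chartwise M 'M[R]_(n + n)) : cbundle M :=
  fun c x => [set u | u *m toC (J c x) = 'i%C *: u].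

Definition generalized_complex {R : realType} {n : nat} {M : smoothManifold R n}
    (H : chartwise M ('I_n -> 'I_n -> 'I_n -> R))
    (J : chartwise M 'M[R]_(n + n)) : Prop :=
  [/\ (forall c, mx_smooth_on (chart_range c) (J c)) /\
      (forall c d p, dom c p -> dom d p ->
        J c (coord c p) *m transition c d p
        = transition c d p *m J d (coord d p)),
      forall c x, chart_range c x -> J c x *m J c x = - 1%:M,
      forall c x, chart_range c x -> forall u v,
        pairing (u *m J c x) (v *m J c x) = pairing u v
    & complex_dirac H (eigenbundle J)].

Definition generalized_kahler {R : realType} {n : nat} {M : smoothManifold R n}
    (H : chartwise M ('I_n -> 'I_n -> 'I_n -> R))
    (J1 J2 : chartwise M 'M[R]_(n + n)) : Prop :=
  [/\ generalized_complex H J1,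
      generalized_complex H J2
    & forall c x, chart_range c x ->
        J1 c x *m J2 c x = J2 c x *m J1 c x /\
        forall u, u != 0 -> 0 < pairing (u *m - (J1 c x *m J2 c x)) u].

Definition eq_bundle {R : realType} {n : nat} {M : smoothManifold R n}
    (L L' : cbundle M) : Prop :=
  forall c x, chart_range c x -> L c x = L' c x.

Definition defines_generalized_kahler {R : realType} {n : nat}
    {M : smoothManifold R n} (H : chartwise M ('I_n -> 'I_n -> 'I_n -> R))
    (L1 L2 : cbundle M) : Prop :=
  exists J1 J2, [/\ generalized_kahler H J1 J2,
                    eq_bundle L1 (eigenbundle J1) &
                    eq_bundle L2 (eigenbundle J2)].

(* Bivectors: pi xi is [xi *m pi], i.e. (pi xi)^j = xi_i pi^ij. *)

Definition jacobi {K : fieldType} {T : Type} {n : nat}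
    (D : 'I_n -> (T -> K) -> T -> K) (P : T -> 'M[K]_n) (x : T) : Prop :=
  forall i j k, \sum_l (P x i l * D l (fun y => P y j k) x
                        + P x j l * D l (fun y => P y k i) x
                        + P x k l * D l (fun y => P y i j) x) = 0.

Definition poisson {R : realType} {n : nat} {M : smoothManifold R n}
    (P : chartwise M 'M[R]_n) : Prop :=
  [/\ forall c, mx_smooth_on (chart_range c) (P c),
      forall c d p, dom c p -> dom d p ->
        P d (coord d p) = (jac c d p)^T *m P c (coord c p) *m jac c d p,
      forall c x, chart_range c x -> (P c x)^T = - P c x
    & forall c x, chart_range c x -> jacobi pd (P c) x].

Definition graph {K : fieldType} {n : nat} (P : 'M[K]_n) :
    set 'rV[K]_(n + n) :=
  [set u | exists xi, u = row_mx (xi *m P) xi].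

Definition defines_poisson {R : realType} {n : nat} {M : smoothManifold R n}
    (G : chartwise M (set 'rV[R]_(n + n))) : Prop :=
  exists2 P : chartwise M 'M[R]_n,
    poisson P & forall c x, chart_range c x -> G c x = graph (P c x).

(* Holomorphic Poisson structures.  I acts on T by X |-> X *m I, hence on
   T* by zeta |-> zeta o I = zeta *m I^T. *)

Definition T10 {R : realType} {n : nat} (I : 'M[R]_n) : set 'rV[R[i]]_n :=
  [set X | X *m toC I = 'i%C *: X].

Definition T01 {R : realType} {n : nat} (I : 'M[R]_n) : set 'rV[R[i]]_n :=
  [set X | X *m toC I = - 'i%C *: X].

Definition dualT10 {R : realType} {n : nat} (I : 'M[R]_n) : set 'rV[R[i]]_n :=
  [set zeta | zeta *m (toC I)^T = 'i%C *: zeta].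

(* Integrability is involutivity of T_{0,1}; by Newlander-Nirenberg this is
   the same as having holomorphic charts. *)
Definition complex_structure {R : realType} {n : nat} {M : smoothManifold R n}
    (I : chartwise M 'M[R]_n) : Prop :=
  [/\ forall c, mx_smooth_on (chart_range c) (I c),
      forall c d p, dom c p -> dom d p ->
        I c (coord c p) *m jac c d p = jac c d p *m I d (coord d p),
      forall c x, chart_range c x -> I c x *m I c x = - 1%:M
    & forall c V X Y, chart_open c V ->
        local_section (fun x => T01 (I c x)) V X ->
        local_section (fun x => T01 (I c x)) V Y ->
        forall x, V x -> T01 (I c x) (lie_bracket X Y x)].

Definition lie_bivector {R : realType} {n : nat} (Z : 'rV[R]_n -> 'rV[R[i]]_n)
    (S : 'rV[R]_n -> 'M[R[i]]_n) (x : 'rV[R]_n) : 'M[R[i]]_n :=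
  \matrix_(i, j) \sum_k (Z x 0 k * cpd k (fun y => S y i j) x
                         - S x k j * cpd k (fun y => Z y 0 i) x
                         - S x i k * cpd k (fun y => Z y 0 j) x).

(* The bivector sigma is a section of the second exterior power of T_{1,0}.
   It is holomorphic when dbar sigma = 0, where dbar_Z sigma is the
   (2,0)-part of L_Z sigma for Z of type (0,1). *)
Definition holomorphic_poisson {R : realType} {n : nat} {M : smoothManifold R n}
    (I : chartwise M 'M[R]_n) (S : chartwise M 'M[R[i]]_n) : Prop :=
  [/\ complex_structure I,
      (forall c, cmx_smooth_on (chart_range c) (S c)) /\
      (forall c d p, dom c p -> dom d p ->
        S d (coord d p)
        = (toC (jac c d p))^T *m S c (coord c p) *m toC (jac c d p)),
      forall c x, chart_range c x -> (S c x)^T = - S c x /\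
        forall zeta, T10 (I c x) (zeta *m S c x),
      forall c V Z, chart_open c V ->
        local_section (fun x => T01 (I c x)) V Z ->
        forall x, V x -> forall zeta eta,
          dualT10 (I c x) zeta -> dualT10 (I c x) eta ->
          zeta *m lie_bivector Z (S c) x *m eta^T = 0
    & forall c x, chart_range c x -> jacobi cpd (S c) x].

Definition L_sigma {R : realType} {n : nat} (I : 'M[R]_n) (S : 'M[R[i]]_n) :
    set 'rV[R[i]]_(n + n) :=
  [set u | exists X zeta, [/\ T01 I X, dualT10 I zeta &
                              u = row_mx (X + zeta *m S) zeta]].

Definition defines_holomorphic_poisson {R : realType} {n : nat}
    {M : smoothManifold R n} (L : cbundle M) : Prop :=
  exists I S, holomorphic_poisson I S /\
    forall c x, chart_range c x -> L c x = L_sigma (I c x) (S c x).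

(* Main.v *)
Require Import Defs.
From HB Require Import structures.
From mathcomp Require Import all_boot all_order all_algebra.
From mathcomp Require Import complex ring.
From mathcomp Require Import all_classical all_reals all_analysis.

(** Fibrewise, (i) and (ii) force a maximal isotropic L to be a complement of its
    conjugate, hence the i-eigenspace of a unique real orthogonal J, whose matrix
    is a smooth function of a local frame.  With A = L1 :&: L2 and
    B = L1 :&: conj L2, condition (iii) says that A + conj A and B + conj B project
    onto T_C; they are orthogonal, and by (iv) they meet in 0, so they span
    everything and are the eigenspaces of G = - J1 J2 for 1 and -1.  Hence J1 and
    J2 commute, and G is positive: an element w of the second space and the
    element v of the first with the same projection differ by a covector, so that
    <w, conj w> = - <v, conj v>.

    Conversely, half the difference of L and its conjugate is the graph of the
    block P : T* -> T of J, and half the difference of L1 and L2 is L_sigma, where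
    I is - J1 transported to T along the eigenbundle of G for 1 and sigma is the
    (2,0)-part of P1.  Both half differences are involutive for the untwisted
    bracket, since the twist by H cancels; this gives the Jacobi identities and the
    holomorphy of sigma. *)

Set Implicit Arguments.
Unset Strict Implicit.
Unset Printing Implicit Defensive.

Import Order.TTheory GRing.Theory Num.Theory.
Import numFieldNormedType.Exports.
Local Open Scope classical_set_scope.
Local Open Scope ring_scope.

(** For the real bivectors the Jacobi identity is tested on constant covectors. These are closed
    forms, so the bracket of two sections of the half difference with constant covector parts is
    exactly a Hamiltonian bracket. For [sigma] this breaks down: where the complex structure varies,
    a constant covector does not stay of type (1,0). It is replaced by its pointwise projection, and
    the error terms contain the derivative of the projection to T10. That derivative maps T10 to
    T01, so it pairs to zero with what occurs.

    For (iii), positivity of [G] enters through the invertibility of its block from covectors to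
    vectors, an inverse metric. Invertibility survives the change of [J2] to [- J2], whose
    i-eigenbundle is the conjugate of L2; one statement about commuting pairs therefore yields both
    holomorphic Poisson structures.

    Vectors are rows and operators act on the right, so a composite is read from left to right. *)

Lemma near_eq_differentiable (R : numFieldType) (V W : normedModType R)
    (f g : V -> W) (x : V) :
  (\forall y \near x, f y = g y) -> differentiable f x -> differentiable g x.
Proof.
move=> fg df.
have -> : g = f + (g - f) by apply/funext => y /=; rewrite !fctE addrC subrK.
apply: differentiableD => //.
(* [h] vanishes near [x], so the zero map satisfies the little-o expansion and is its
   differential. *)
pose h : V -> W := g - f.
have H : h \o shift x = cst (h x) + (\0 : V -> W) +o_ 0 id.
  apply/eqaddoP => e e0; rewrite /h.
  have := fg; rewrite (near_shift 0 x) subr0; apply: filterS => y /= hy.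
  rewrite !fctE /= hy subrr (nbhs_singleton fg) subrr addr0 subr0 normr0.
  by rewrite mulr_ge0 // ltW.
apply/diff_locallyP; have dh : 'd h x = \0 :> (V -> W).
  by apply: diff_unique => //; exact: cst_continuous.
by rewrite dh; split=> //; exact: cst_continuous.
Qed.

(** * Calculus of smooth real functions on open sets *)

Section SmoothFunctions.
Context {R : realType} {n : nat}.
Implicit Types (U V : set 'rV[R]_n) (f g : 'rV[R]_n -> R) (x : 'rV[R]_n).

Lemma pd_near i f g x : (\forall y \near x, f y = g y) -> pd i f x = pd i g x.
Proof. exact: near_eq_derive. Qed.

Lemma pd_open i U f g x : open U -> {in U, f =1 g} -> U x ->
  pd i f x = pd i g x.
Proof.
move=> oU fg Ux; apply: pd_near; have : nbhs x U by exact: open_nbhs_nbhs.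
by apply: filterS => y Uy; apply: fg; rewrite inE.
Qed.

Lemma pd_cst i (a : R) x : pd i (fun=> a) x = 0.
Proof. exact: derive_cst. Qed.

Lemma pdD i f g x : differentiable f x -> differentiable g x ->
  pd i (fun y => f y + g y) x = pd i f x + pd i g x.
Proof. by move=> df dg; rewrite /pd -deriveD //; exact: diff_derivable. Qed.

Lemma pdN i f x : differentiable f x -> pd i (fun y => - f y) x = - pd i f x.
Proof. by move=> df; rewrite /pd -deriveN //; exact: diff_derivable. Qed.

Lemma pdM i f g x : differentiable f x -> differentiable g x ->
  pd i (fun y => f y * g y) x = pd i f x * g x + f x * pd i g x.
Proof.
move=> df dg; have -> : (fun y => f y * g y) = f * g by [].
rewrite /pd deriveM; try exact: diff_derivable.
by rewrite addrC; congr (_ + _); exact: mulrC.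
Qed.

Lemma pdV i f x : differentiable f x -> f x != 0 ->
  pd i (fun y => (f y)^-1) x = - (pd i f x * ((f x)^-1 * (f x)^-1)).
Proof.
move=> df f0; rewrite /pd deriveV //; last exact: diff_derivable.
rewrite scaleNr expr2 invfM.
by congr (- _); exact: mulrC.
Qed.

(** Fixing the order makes induction possible: the product and quotient rules express a derivative
    through functions of one order less, while [smooth_on] quantifies over all orders at once. *)
Fixpoint Ck (k : nat) U f : Prop :=
  (forall x, U x -> differentiable f x) /\
  (if k is k'.+1 then forall i, Ck k' U (pd i f) else True).

Lemma Ck_differentiable k U f x : Ck k U f -> U x -> differentiable f x.
Proof. by case: k => [|k] /= [+ _]; apply. Qed.

Lemma CkW k U f : Ck k.+1 U f -> Ck k U f.
Proof.
elim: k f => [|k IH] f [df pf]; first by split.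
by split=> // i; exact: IH.
Qed.

Lemma smooth_on_differentiable U f x : smooth_on U f -> U x ->
  differentiable f x.
Proof. by move=> sf Ux; exact: (sf [::]). Qed.

Lemma smooth_on_pd i U f : smooth_on U f -> smooth_on U (pd i f).
Proof. by move=> sf s x Ux; have := sf (rcons s i) x Ux; rewrite foldr_rcons. Qed.

Lemma smooth_onP U f : smooth_on U f <-> forall k, Ck k U f.
Proof.
split=> [sf k|Cf s].
  elim: k f sf => [|k IH] f sf; split=> //;
    solve [by move=> x; exact: smooth_on_differentiable
          |by move=> i; exact/IH/smooth_on_pd].
(* [foldr] applies the last index of the list first, so the list is peeled from its end and that
   derivative is absorbed into [f]. *)
elim/last_ind: s f Cf => [|s i IH] f Cf x Ux; first exact: Ck_differentiable (Cf 0%N) Ux.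
by rewrite foldr_rcons; apply: IH => // k; exact: (Cf k.+1).2.
Qed.

Section Open.
Variable U : set 'rV[R]_n.
Hypothesis oU : open U.

Lemma Ck_eq k f g : {in U, f =1 g} -> Ck k U f -> Ck k U g.
Proof.
elim: k f g => [|k IH] f g fg [df pf]; split=> //.
- move=> x Ux; apply: near_eq_differentiable (df x Ux).
  have : nbhs x U by exact: open_nbhs_nbhs.
  by apply: filterS => y Uy; apply: fg; rewrite inE.
- move=> x Ux; apply: near_eq_differentiable (df x Ux).
  have : nbhs x U by exact: open_nbhs_nbhs.
  by apply: filterS => y Uy; apply: fg; rewrite inE.
- move=> i; apply: IH (pf i) => x; rewrite inE => Ux.
  exact: pd_open oU fg Ux.
Qed.

Lemma Ck_cst k a : Ck k U (fun=> a).
Proof.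
elim: k a => [|k IH] a; split=> //; try by move=> x _; exact: differentiable_cst.
by move=> i; apply: Ck_eq (IH 0) => x _; rewrite pd_cst.
Qed.

Lemma CkD k f g : Ck k U f -> Ck k U g -> Ck k U (fun x => f x + g x).
Proof.
elim: k f g => [|k IH] f g [df pf] [dg pg]; split=> //;
  try by move=> x Ux; apply: differentiableD; [exact: df|exact: dg].
move=> i; apply: Ck_eq (IH _ _ (pf i) (pg i)) => x; rewrite inE => Ux.
by rewrite pdD //; [exact: df|exact: dg].
Qed.

Lemma CkN k f : Ck k U f -> Ck k U (fun x => - f x).
Proof.
elim: k f => [|k IH] f [df pf]; split=> //;
  try by move=> x Ux; apply: differentiableN; exact: df.
move=> i; apply: Ck_eq (IH _ (pf i)) => x; rewrite inE => Ux.
by rewrite pdN //; exact: df.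
Qed.

Lemma CkM k f g : Ck k U f -> Ck k U g -> Ck k U (fun x => f x * g x).
Proof.
elim: k f g => [|k IH] f g Cf Cg; have [df pf] := Cf; have [dg pg] := Cg; split=> //;
  try by move=> x Ux; apply: differentiableM; [exact: df|exact: dg].
move=> i; apply: (@Ck_eq _ (fun x => pd i f x * g x + f x * pd i g x)).
  by move=> x; rewrite inE => Ux; rewrite pdM //; [exact: df|exact: dg].
apply: CkD; apply: IH;
  [exact: pf|exact: (CkW Cg)|exact: (CkW Cf)|exact: pg].
Qed.

Lemma CkV k f : (forall x, U x -> f x != 0) -> Ck k U f ->
  Ck k U (fun x => (f x)^-1).
Proof.
move=> f0; elim: k => [|k IH] Cf; have [df pf] := Cf; split=> //;
  try by move=> x Ux; apply: differentiableV; [exact: df|exact: f0].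
move=> i; apply: (@Ck_eq _ (fun x => - (pd i f x * ((f x)^-1 * (f x)^-1)))).
  by move=> x; rewrite inE => Ux; rewrite pdV //; [exact: df|exact: f0].
(* The derivative of 1/f contains 1/f again, needed at one order less only. *)
have Ci := IH (CkW Cf); apply: CkN; apply: CkM; [exact: pf|exact: CkM].
Qed.

Lemma smooth_on_eq f g : {in U, f =1 g} -> smooth_on U f -> smooth_on U g.
Proof.
by move=> fg /smooth_onP sf; apply/smooth_onP => k; exact: (Ck_eq fg (sf k)).
Qed.

Lemma smooth_on_cst a : smooth_on U (fun=> a).
Proof. by apply/smooth_onP => k; exact: Ck_cst. Qed.

Lemma smooth_onD f g : smooth_on U f -> smooth_on U g ->
  smooth_on U (fun x => f x + g x).
Proof. by move=> /smooth_onP sf /smooth_onP sg; apply/smooth_onP => k; exact: CkD. Qed.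

Lemma smooth_onN f : smooth_on U f -> smooth_on U (fun x => - f x).
Proof. by move=> /smooth_onP sf; apply/smooth_onP => k; exact: CkN. Qed.

Lemma smooth_onM f g : smooth_on U f -> smooth_on U g ->
  smooth_on U (fun x => f x * g x).
Proof. by move=> /smooth_onP sf /smooth_onP sg; apply/smooth_onP => k; exact: CkM. Qed.

Lemma smooth_onV f : (forall x, U x -> f x != 0) -> smooth_on U f ->
  smooth_on U (fun x => (f x)^-1).
Proof. by move=> f0 /smooth_onP sf; apply/smooth_onP => k; exact: CkV. Qed.

Lemma smooth_on_sum (I : Type) (r : seq I) (P : pred I) (F : I -> 'rV[R]_n -> R) :
  (forall i, P i -> smooth_on U (F i)) ->
  smooth_on U (fun x => \sum_(i <- r | P i) F i x).
Proof.
move=> sF; elim: r => [|i r IH].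
  by under eq_fun do rewrite big_nil; exact: smooth_on_cst.
under eq_fun do rewrite big_cons; case: (boolP (P i)) => // Pi.
by apply: smooth_onD => //; exact: sF.
Qed.

Lemma smooth_on_prod (I : Type) (r : seq I) (P : pred I) (F : I -> 'rV[R]_n -> R) :
  (forall i, P i -> smooth_on U (F i)) ->
  smooth_on U (fun x => \prod_(i <- r | P i) F i x).
Proof.
move=> sF; elim: r => [|i r IH].
  by under eq_fun do rewrite big_nil; exact: smooth_on_cst.
under eq_fun do rewrite big_cons; case: (boolP (P i)) => // Pi.
by apply: smooth_onM => //; exact: sF.
Qed.

End Open.

Lemma smooth_on_sub U V f : V `<=` U -> smooth_on U f -> smooth_on V f.
Proof. by move=> VU sf s x /VU; exact: sf. Qed.

Lemma smooth_on_local U f :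
  (forall x, U x -> exists2 V : set 'rV[R]_n, V x & smooth_on V f) -> smooth_on U f.
Proof. by move=> loc s x /loc[V Vx]; exact. Qed.

End SmoothFunctions.

(** * Smooth real and complex matrix functions *)

Section SmoothMatrices.
Context {R : realType} {n : nat}.
Variable U : set 'rV[R]_n.
Hypothesis oU : open U.

Lemma mx_smooth_on_cst m p (A : 'M[R]_(m, p)) : mx_smooth_on U (fun=> A).
Proof. by move=> i j; exact: smooth_on_cst. Qed.

Lemma mx_smooth_onD m p (F G : 'rV[R]_n -> 'M[R]_(m, p)) :
  mx_smooth_on U F -> mx_smooth_on U G -> mx_smooth_on U (fun x => F x + G x).
Proof.
by move=> sF sG i j; under eq_fun do rewrite mxE; exact: smooth_onD.
Qed.

Lemma mx_smooth_onN m p (F : 'rV[R]_n -> 'M[R]_(m, p)) :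
  mx_smooth_on U F -> mx_smooth_on U (fun x => - F x).
Proof. by move=> sF i j; under eq_fun do rewrite mxE; exact: smooth_onN. Qed.

Lemma mx_smooth_onM m p q (F : 'rV[R]_n -> 'M[R]_(m, p)) (G : _ -> 'M[R]_(p, q)) :
  mx_smooth_on U F -> mx_smooth_on U G -> mx_smooth_on U (fun x => F x *m G x).
Proof.
move=> sF sG i j; under eq_fun do rewrite mxE; apply: smooth_on_sum => // k _.
exact: smooth_onM.
Qed.

Lemma mx_smooth_on_col m1 m2 p (F : 'rV[R]_n -> 'M[R]_(m1, p)) (G : _ -> 'M[R]_(m2, p)) :
  mx_smooth_on U F -> mx_smooth_on U G -> mx_smooth_on U (fun x => col_mx (F x) (G x)).
Proof.
move=> sF sG i j; case: (split_ordP i) => k ->.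
  by under eq_fun do rewrite col_mxEu; exact: sF.
by under eq_fun do rewrite col_mxEd; exact: sG.
Qed.

Lemma smooth_on_det m (F : 'rV[R]_n -> 'M[R]_m) :
  mx_smooth_on U F -> smooth_on U (fun x => \det (F x)).
Proof.
move=> sF; rewrite /determinant; apply: smooth_on_sum => // s _.
by apply: smooth_onM => //; [exact: smooth_on_cst|exact: smooth_on_prod].
Qed.

Lemma mx_smooth_on_inv m (F : 'rV[R]_n -> 'M[R]_m) :
  (forall x, U x -> F x \in unitmx) -> mx_smooth_on U F ->
  mx_smooth_on U (fun x => invmx (F x)).
Proof.
move=> uF sF i j.
(* Cramer's rule: the entries of the inverse are polynomials in the entries of [F], divided by the
   determinant. *)
apply: (smooth_on_eq oU (f := fun x => (\det (F x))^-1 * \adj (F x) i j)).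
  by move=> x; rewrite inE => Ux; rewrite /invmx uF // [in RHS]mxE.
apply: smooth_onM => //.
  apply: smooth_onV => //; last exact: smooth_on_det.
  by move=> x /uF; rewrite unitmxE unitfE.
under eq_fun do rewrite mxE /cofactor; apply: smooth_onM => //.
  exact: smooth_on_cst.
by apply: smooth_on_det => k l; under eq_fun do rewrite !mxE; exact: sF.
Qed.

Definition csmooth_on (f : 'rV[R]_n -> R[i]) : Prop :=
  smooth_on U (fun x => complex.Re (f x)) /\ smooth_on U (fun x => complex.Im (f x)).

Implicit Types f g : 'rV[R]_n -> R[i].

Lemma ReD (a b : R[i]) : complex.Re (a + b) = complex.Re a + complex.Re b.
Proof. by case: a b => [? ?] []. Qed.

Lemma ImD (a b : R[i]) : complex.Im (a + b) = complex.Im a + complex.Im b.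
Proof. by case: a b => [? ?] []. Qed.

Lemma ReN (a : R[i]) : complex.Re (- a) = - complex.Re a.
Proof. by case: a. Qed.

Lemma ImN (a : R[i]) : complex.Im (- a) = - complex.Im a.
Proof. by case: a. Qed.

Lemma ReM (a b : R[i]) : complex.Re (a * b) =
  complex.Re a * complex.Re b + - (complex.Im a * complex.Im b).
Proof. by case: a b => [? ?] []. Qed.

Lemma ImM (a b : R[i]) : complex.Im (a * b) =
  complex.Re a * complex.Im b + complex.Im a * complex.Re b.
Proof. by case: a b => [? ?] []. Qed.

Lemma csmooth_on_eq f g : {in U, f =1 g} -> csmooth_on f -> csmooth_on g.
Proof.
move=> fg [rf jf]; split.
  by apply: (smooth_on_eq oU) rf => x Ux; rewrite fg.
by apply: (smooth_on_eq oU) jf => x Ux; rewrite fg.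
Qed.

Lemma csmooth_on_cst a : csmooth_on (fun=> a).
Proof. by split; exact: smooth_on_cst. Qed.

Lemma csmooth_onD f g : csmooth_on f -> csmooth_on g -> csmooth_on (fun x => f x + g x).
Proof.
move=> [rf jf] [rg jg]; split; [under eq_fun do rewrite ReD|under eq_fun do rewrite ImD];
  exact: smooth_onD.
Qed.

Lemma csmooth_onN f : csmooth_on f -> csmooth_on (fun x => - f x).
Proof.
move=> [rf jf]; split; [under eq_fun do rewrite ReN|under eq_fun do rewrite ImN];
  exact: smooth_onN.
Qed.

Lemma csmooth_onM f g : csmooth_on f -> csmooth_on g -> csmooth_on (fun x => f x * g x).
Proof.
move=> [rf jf] [rg jg]; split; [under eq_fun do rewrite ReM|under eq_fun do rewrite ImM];
  apply: smooth_onD => //; try apply: smooth_onN => //; exact: smooth_onM.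
Qed.

Lemma csmooth_on_sum (I : Type) (r : seq I) (F : I -> 'rV[R]_n -> R[i]) :
  (forall i, csmooth_on (F i)) -> csmooth_on (fun x => \sum_(i <- r) F i x).
Proof.
move=> sF; elim: r => [|i r IH].
  by under eq_fun do rewrite big_nil; exact: csmooth_on_cst.
by under eq_fun do rewrite big_cons; exact: csmooth_onD.
Qed.

Lemma csmooth_on_real (f : 'rV[R]_n -> R) : smooth_on U f ->
  csmooth_on (fun x => (f x)%:C%C).
Proof. by move=> sf; split => //=; exact: smooth_on_cst. Qed.

Lemma csmooth_on_conj f : csmooth_on f -> csmooth_on (fun x => (f x)^*%C).
Proof.
have E a : complex.Re (a^*%C) = complex.Re a :> R by case: a.
have F a : complex.Im (a^*%C) = - complex.Im a :> R by case: a.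
move=> [rf jf]; split; [under eq_fun do rewrite E|under eq_fun do rewrite F] => //.
exact: smooth_onN.
Qed.

Lemma cmx_smooth_on_cst m p (A : 'M[R[i]]_(m, p)) : cmx_smooth_on U (fun=> A).
Proof. by move=> i j; exact: csmooth_on_cst. Qed.

Lemma cmx_smooth_on_eq m p (F G : 'rV[R]_n -> 'M[R[i]]_(m, p)) :
  {in U, F =1 G} -> cmx_smooth_on U F -> cmx_smooth_on U G.
Proof.
move=> FG sF i j; apply: csmooth_on_eq (sF i j) => x Ux.
by rewrite FG.
Qed.

Lemma cmx_smooth_onD m p (F G : 'rV[R]_n -> 'M[R[i]]_(m, p)) :
  cmx_smooth_on U F -> cmx_smooth_on U G -> cmx_smooth_on U (fun x => F x + G x).
Proof.
move=> sF sG i j; apply: csmooth_on_eq (csmooth_onD (sF i j) (sG i j)) => x _.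
by rewrite mxE.
Qed.

Lemma cmx_smooth_onN m p (F : 'rV[R]_n -> 'M[R[i]]_(m, p)) :
  cmx_smooth_on U F -> cmx_smooth_on U (fun x => - F x).
Proof.
move=> sF i j; apply: csmooth_on_eq (csmooth_onN (sF i j)) => x _.
by rewrite mxE.
Qed.

Lemma cmx_smooth_onM m p q (F : 'rV[R]_n -> 'M[R[i]]_(m, p)) (G : _ -> 'M[R[i]]_(p, q)) :
  cmx_smooth_on U F -> cmx_smooth_on U G -> cmx_smooth_on U (fun x => F x *m G x).
Proof.
move=> sF sG i j; apply: (@csmooth_on_eq (fun x => \sum_k F x i k * G x k j)).
  by move=> x _; rewrite mxE.
by apply: csmooth_on_sum => k; apply: csmooth_onM; [exact: sF|exact: sG].
Qed.

Lemma cmx_smooth_onZ m p a (F : 'rV[R]_n -> 'M[R[i]]_(m, p)) :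
  cmx_smooth_on U F -> cmx_smooth_on U (fun x => a *: F x).
Proof.
move=> sF i j; apply: csmooth_on_eq (csmooth_onM (csmooth_on_cst a) (sF i j)) => x _.
by rewrite mxE.
Qed.

Lemma cmx_smooth_on_tr m p (F : 'rV[R]_n -> 'M[R[i]]_(m, p)) :
  cmx_smooth_on U F -> cmx_smooth_on U (fun x => (F x)^T).
Proof.
move=> sF i j; apply: csmooth_on_eq (sF j i) => x _.
by rewrite mxE.
Qed.

Lemma cmx_smooth_on_lsub m p1 p2 (F : 'rV[R]_n -> 'M[R[i]]_(m, p1 + p2)) :
  cmx_smooth_on U F -> cmx_smooth_on U (fun x => lsubmx (F x)).
Proof.
by move=> sF i j; apply: csmooth_on_eq (sF i (lshift p2 j)) => x _; rewrite mxE.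
Qed.

Lemma cmx_smooth_on_rsub m p1 p2 (F : 'rV[R]_n -> 'M[R[i]]_(m, p1 + p2)) :
  cmx_smooth_on U F -> cmx_smooth_on U (fun x => rsubmx (F x)).
Proof.
by move=> sF i j; apply: csmooth_on_eq (sF i (rshift p1 j)) => x _; rewrite mxE.
Qed.

Lemma cmx_smooth_on_toC m p (F : 'rV[R]_n -> 'M[R]_(m, p)) :
  mx_smooth_on U F -> cmx_smooth_on U (fun x => toC (F x)).
Proof.
move=> sF i j; apply: csmooth_on_eq (csmooth_on_real (sF i j)) => x _.
by rewrite mxE.
Qed.

Lemma cmx_smooth_on_conj m p (F : 'rV[R]_n -> 'M[R[i]]_(m, p)) :
  cmx_smooth_on U F -> cmx_smooth_on U (fun x => conj_mx (F x)).
Proof.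
move=> sF i j; apply: csmooth_on_eq (csmooth_on_conj (sF i j)) => x _.
by rewrite mxE.
Qed.

End SmoothMatrices.

Lemma mx_smooth_on_subset (R : realType) n (U V : set 'rV[R]_n) m p (F : _ -> 'M[R]_(m, p)) :
  V `<=` U -> mx_smooth_on U F -> mx_smooth_on V F.
Proof. by move=> VU sF i j; exact: smooth_on_sub VU _. Qed.

(** * Derivatives along complex directions; the brackets in matrix form *)

Section Derivatives.
Context {R : realType} {n : nat}.
Variable U : set 'rV[R]_n.
Hypothesis oU : open U.
Variable x : 'rV[R]_n.
Hypothesis Ux : U x.
Implicit Types (f g : 'rV[R]_n -> R[i]) (k : 'I_n) (v : 'rV[R[i]]_n).

Lemma cpd_eq k f g : {in U, f =1 g} -> cpd k f x = cpd k g x.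
Proof.
move=> fg; rewrite /cpd; congr (_ +i* _)%C;
  by apply: (pd_open _ oU) => // y Uy; rewrite fg.
Qed.

Lemma cpd_cst k a : cpd k (fun=> a) x = 0.
Proof. by rewrite /cpd !pd_cst. Qed.

Lemma cpdD k f g : csmooth_on U f -> csmooth_on U g ->
  cpd k (fun y => f y + g y) x = cpd k f x + cpd k g x.
Proof.
move=> [rf jf] [rg jg]; rewrite /cpd.
have -> : (fun y => complex.Re (f y + g y)) = (fun y => complex.Re (f y) + complex.Re (g y)).
  by apply/funext => y; rewrite ReD.
have -> : (fun y => complex.Im (f y + g y)) = (fun y => complex.Im (f y) + complex.Im (g y)).
  by apply/funext => y; rewrite ImD.
by rewrite !pdD //; apply: smooth_on_differentiable Ux.
Qed.

Lemma cpdN k f : csmooth_on U f -> cpd k (fun y => - f y) x = - cpd k f x.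
Proof.
move=> [rf jf]; rewrite /cpd.
have -> : (fun y => complex.Re (- f y)) = (fun y => - complex.Re (f y)).
  by apply/funext => y; rewrite ReN.
have -> : (fun y => complex.Im (- f y)) = (fun y => - complex.Im (f y)).
  by apply/funext => y; rewrite ImN.
by rewrite !pdN //; apply: smooth_on_differentiable Ux.
Qed.

Lemma cpdM k f g : csmooth_on U f -> csmooth_on U g ->
  cpd k (fun y => f y * g y) x = cpd k f x * g x + f x * cpd k g x.
Proof.
move=> [rf jf] [rg jg]; rewrite /cpd.
have d h : smooth_on U h -> differentiable h x by move/smooth_on_differentiable; apply.
have -> : (fun y => complex.Re (f y * g y)) = (fun y => complex.Re (f y) * complex.Re (g y) + - (complex.Im (f y) * complex.Im (g y))).
  by apply/funext => y; rewrite ReM.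
have -> : (fun y => complex.Im (f y * g y)) = (fun y => complex.Re (f y) * complex.Im (g y) + complex.Im (f y) * complex.Re (g y)).
  by apply/funext => y; rewrite ImM.
have M p q : smooth_on U p -> smooth_on U q -> differentiable (fun y => p y * q y) x.
  by move=> sp sq; apply: d; exact: smooth_onM.
rewrite !pdD ?pdN ?pdM; try solve [exact: d|exact: M|apply: d; apply: smooth_onN => //; exact: smooth_onM].
case: (f x) (g x) => [a b] [c e] /=.
apply/eqP; rewrite eq_complex /=; apply/andP; split; apply/eqP; ring.
Qed.

Lemma cpd_sum k (I : Type) (r : seq I) (F : I -> 'rV[R]_n -> R[i]) :
  (forall i, csmooth_on U (F i)) ->
  cpd k (fun y => \sum_(i <- r) F i y) x = \sum_(i <- r) cpd k (F i) x.
Proof.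
move=> sF; elim: r => [|i r IH].
  by under eq_fun do rewrite big_nil; rewrite big_nil cpd_cst.
under eq_fun do rewrite big_cons.
by rewrite big_cons cpdD ?IH //; exact: csmooth_on_sum.
Qed.

Lemma cpd_real k (f : 'rV[R]_n -> R) : cpd k (fun y => (f y)%:C%C) x = (pd k f x)%:C%C.
Proof. by rewrite /cpd /= pd_cst. Qed.

Lemma cpd_conj k f : csmooth_on U f ->
  cpd k (fun y => (f y)^*%C) x = (cpd k f x)^*%C.
Proof.
have E (a : R[i]) : complex.Re (a^*%C) = complex.Re a by case: a.
have F (a : R[i]) : complex.Im (a^*%C) = - complex.Im a by case: a.
move=> [rf jf]; rewrite /cpd.
have -> : (fun y => complex.Re (f y)^*%C) = (fun y => complex.Re (f y)).
  by apply/funext => y; rewrite E.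
have -> : (fun y => complex.Im (f y)^*%C) = (fun y => - complex.Im (f y)).
  by apply/funext => y; rewrite F.
by rewrite pdN //; apply: smooth_on_differentiable Ux.
Qed.

(** The directional derivative, extended complex-linearly in [v] so that complex vector fields can
    act. It obeys the Leibniz rule for matrix products, which reduces bracket computations to matrix
    algebra. *)
Definition dmx {m p} v (F : 'rV[R]_n -> 'M[R[i]]_(m, p)) y : 'M[R[i]]_(m, p) :=
  \matrix_(i, j) \sum_k v 0 k * cpd k (fun z => F z i j) y.

Definition jacmx {p} (X : 'rV[R]_n -> 'rV[R[i]]_p) y : 'M[R[i]]_(n, p) :=
  \matrix_(k, j) cpd k (fun z => X z 0 j) y.

Lemma mul_jacmx p v (X : 'rV[R]_n -> 'rV[R[i]]_p) y : v *m jacmx X y = dmx v X y.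
Proof.
by apply/rowP => j; rewrite !mxE; apply: eq_bigr => k _; rewrite !mxE.
Qed.

Lemma dmx_eq m p v (F G : 'rV[R]_n -> 'M[R[i]]_(m, p)) : {in U, F =1 G} ->
  dmx v F x = dmx v G x.
Proof.
move=> FG; apply/matrixP => i j; rewrite !mxE; apply: eq_bigr => k _.
by congr (_ * _); apply: cpd_eq => y Uy; rewrite FG.
Qed.

Lemma dmx_cst m p v (A : 'M[R[i]]_(m, p)) : dmx v (fun=> A) x = 0.
Proof.
by apply/matrixP => i j; rewrite !mxE big1 // => k _; rewrite cpd_cst mulr0.
Qed.

Lemma dmxM m p q v (F : 'rV[R]_n -> 'M[R[i]]_(m, p)) (G : _ -> 'M[R[i]]_(p, q)) :
  cmx_smooth_on U F -> cmx_smooth_on U G ->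
  dmx v (fun y => F y *m G y) x = dmx v F x *m G x + F x *m dmx v G x.
Proof.
move=> sF sG; apply/matrixP => i j; rewrite !mxE -big_split /=.
under eq_bigr => k _.
  under eq_fun do rewrite mxE.
  rewrite cpd_sum; last by move=> l; exact: csmooth_onM.
  under eq_bigr => l _ do [rewrite cpdM; [|exact: sF|exact: sG]].
  rewrite mulr_sumr; over.
rewrite exchange_big /=; apply: eq_bigr => l _; rewrite !mxE mulr_suml mulr_sumr -big_split /=.
apply: eq_bigr => k _.
by rewrite mulrDr mulrA; congr (_ + _); exact: mulrCA.
Qed.

Lemma dmx_tr m p v (F : 'rV[R]_n -> 'M[R[i]]_(m, p)) :
  dmx v (fun y => (F y)^T) x = (dmx v F x)^T.
Proof.
apply/matrixP => i j; rewrite !mxE; apply: eq_bigr => k _.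
by congr (_ * _); apply: cpd_eq => y _; rewrite mxE.
Qed.

Lemma dmx_conj m p v (F : 'rV[R]_n -> 'M[R[i]]_(m, p)) : cmx_smooth_on U F ->
  dmx (conj_mx v) (fun y => conj_mx (F y)) x = conj_mx (dmx v F x).
Proof.
move=> sF; apply/matrixP => i j; rewrite !mxE rmorph_sum; apply: eq_bigr => k _.
rewrite rmorphM /=; congr (_ * _); first by rewrite ?mxE.
rewrite -[RHS]/((cpd k (fun z => F z i j) x)^*%C) -cpd_conj; last exact: sF.
by apply: cpd_eq => y _; rewrite mxE.
Qed.

Lemma dmxN m p v (F : 'rV[R]_n -> 'M[R[i]]_(m, p)) : cmx_smooth_on U F ->
  dmx v (fun y => - F y) x = - dmx v F x.
Proof.
move=> sF; apply/matrixP => i j; rewrite !mxE -sumrN; apply: eq_bigr => k _.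
rewrite -mulrN -cpdN; last exact: sF.
by congr (_ * _); apply: cpd_eq => y _; rewrite mxE.
Qed.

Lemma lie_bracketE (X Y : 'rV[R]_n -> 'rV[R[i]]_n) :
  lie_bracket X Y x = X x *m jacmx Y x - Y x *m jacmx X x.
Proof.
by apply/rowP => k; rewrite !mxE -sumrB; apply: eq_bigr => j _; rewrite !mxE.
Qed.

Lemma lie_formE (X e : 'rV[R]_n -> 'rV[R[i]]_n) :
  lie_form X e x = X x *m jacmx e x + e x *m (jacmx X x)^T.
Proof.
apply/rowP => k; rewrite !mxE -big_split /=.
by apply: eq_bigr => j _; rewrite !mxE.
Qed.

Lemma contract_dE (Y z : 'rV[R]_n -> 'rV[R[i]]_n) :
  contract_d Y z x = Y x *m jacmx z x - Y x *m (jacmx z x)^T.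
Proof.
by apply/rowP => k; rewrite !mxE -sumrB; apply: eq_bigr => j _; rewrite !mxE mulrBr.
Qed.

End Derivatives.

(** * Real and imaginary parts of complex matrices *)

Section ComplexMatrices.
Context {R : realType}.

Lemma sqr_im : 'i%C * 'i%C = -1 :> R[i].
Proof. by have := sqr_i R; rewrite expr2. Qed.

Lemma conj_im : conjc ('i%C : R[i]) = - 'i%C.
Proof. by apply/eqP; rewrite eq_complex /= oppr0 !eqxx. Qed.

Lemma im_neq0 : ('i%C : R[i]) != 0.
Proof. by rewrite eq_complex /= oner_eq0 andbF. Qed.

Lemma toCM m p q (A : 'M[R]_(m, p)) (B : 'M[R]_(p, q)) : toC (A *m B) = toC A *m toC B.
Proof. exact: map_mxM. Qed.

Lemma toCD m p (A B : 'M[R]_(m, p)) : toC (A + B) = toC A + toC B.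
Proof. exact: map_mxD. Qed.

Lemma toCN m p (A : 'M[R]_(m, p)) : toC (- A) = - toC A.
Proof. exact: map_mxN. Qed.

Lemma toC1 m : toC (1%:M : 'M[R]_m) = 1%:M.
Proof. exact: map_mx1. Qed.

Lemma toC0 m p : toC (0 : 'M[R]_(m, p)) = 0.
Proof. exact: map_mx0. Qed.

Lemma toC_tr m p (A : 'M[R]_(m, p)) : toC A^T = (toC A)^T.
Proof. by rewrite /toC map_trmx. Qed.

Lemma toC_inj m p : injective (@toC R m p).
Proof. by move=> A B /matrixP E; apply/matrixP => i j; have := E i j; rewrite !mxE => -[]. Qed.

Lemma toC_row m p q (A : 'M[R]_(m, p)) (B : 'M[R]_(m, q)) :
  toC (row_mx A B) = row_mx (toC A) (toC B).
Proof. exact: map_row_mx. Qed.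

Lemma toC_col m p q (A : 'M[R]_(p, m)) (B : 'M[R]_(q, m)) :
  toC (col_mx A B) = col_mx (toC A) (toC B).
Proof. exact: map_col_mx. Qed.

Lemma toC_unit m (A : 'M[R]_m) : (toC A \in unitmx) = (A \in unitmx).
Proof. by rewrite /toC map_unitmx. Qed.

Lemma conj_mxM m p q (A : 'M[R[i]]_(m, p)) (B : 'M[R[i]]_(p, q)) :
  conj_mx (A *m B) = conj_mx A *m conj_mx B.
Proof. exact: map_mxM. Qed.

Lemma conj_mxD m p (A B : 'M[R[i]]_(m, p)) : conj_mx (A + B) = conj_mx A + conj_mx B.
Proof. exact: map_mxD. Qed.

Lemma conj_mxN m p (A : 'M[R[i]]_(m, p)) : conj_mx (- A) = - conj_mx A.
Proof. exact: map_mxN. Qed.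

Lemma conj_mxZ m p a (A : 'M[R[i]]_(m, p)) : conj_mx (a *: A) = a^*%C *: conj_mx A.
Proof. exact: map_mxZ. Qed.

Lemma conj_mx0 m p : conj_mx (0 : 'M[R[i]]_(m, p)) = 0.
Proof. exact: map_mx0. Qed.

Lemma conj_mx_tr m p (A : 'M[R[i]]_(m, p)) : conj_mx A^T = (conj_mx A)^T.
Proof. by rewrite /conj_mx map_trmx. Qed.

Lemma conj_mx_row m p q (A : 'M[R[i]]_(m, p)) (B : 'M[R[i]]_(m, q)) :
  conj_mx (row_mx A B) = row_mx (conj_mx A) (conj_mx B).
Proof. exact: map_row_mx. Qed.

Lemma conj_mxK m p : involutive (@conj_mx R m p).
Proof. by move=> A; apply/matrixP => i j; rewrite !mxE conjcK. Qed.

Lemma conj_toC m p (A : 'M[R]_(m, p)) : conj_mx (toC A) = toC A.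
Proof. by apply/matrixP => i j; rewrite !mxE conjc_real. Qed.

Lemma conj_mx_eq0 m p (A : 'M[R[i]]_(m, p)) : conj_mx A = 0 -> A = 0.
Proof. by move=> A0; rewrite -[A]conj_mxK A0 conj_mx0. Qed.

Definition Remx m p (A : 'M[R[i]]_(m, p)) : 'M[R]_(m, p) := map_mx (@complex.Re R) A.
Definition Immx m p (A : 'M[R[i]]_(m, p)) : 'M[R]_(m, p) := map_mx (@complex.Im R) A.

Lemma Remx_Immx m p (A : 'M[R[i]]_(m, p)) : A = toC (Remx A) + 'i%C *: toC (Immx A).
Proof. by apply/matrixP => i j; rewrite !mxE -complexE. Qed.

Lemma RemxE m p (A B : 'M[R]_(m, p)) : Remx (toC A + 'i%C *: toC B) = A.
Proof. by apply/matrixP => i j; rewrite !mxE /=; ring. Qed.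

Lemma ImmxE m p (A B : 'M[R]_(m, p)) : Immx (toC A + 'i%C *: toC B) = B.
Proof. by apply/matrixP => i j; rewrite !mxE /=; ring. Qed.

Lemma toC_im_inj m p (A B A' B' : 'M[R]_(m, p)) :
  toC A + 'i%C *: toC B = toC A' + 'i%C *: toC B' -> A = A' /\ B = B'.
Proof. by move=> E; split; [rewrite -(RemxE A B) E RemxE|rewrite -(ImmxE A B) E ImmxE]. Qed.

Lemma conj_Remx_Immx m p (A : 'M[R[i]]_(m, p)) :
  conj_mx A = toC (Remx A) - 'i%C *: toC (Immx A).
Proof.
by rewrite {1}[A]Remx_Immx conj_mxD conj_mxZ !conj_toC conj_im scaleNr.
Qed.

Lemma conj_mx_fixed m p (A : 'M[R[i]]_(m, p)) : conj_mx A = A -> A = toC (Remx A).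
Proof.
move=> cA; rewrite {1}[A]Remx_Immx; suff -> : Immx A = 0 by rewrite toC0 scaler0 addr0.
apply/matrixP => i j; have := congr1 (fun B : 'M[R[i]]_(m, p) => complex.Im (B i j)) cA.
rewrite !mxE; case: (A i j) => a b /= bN; apply/eqP.
by have := mulrn_eq0 b 2; rewrite /= => <-; rewrite mulr2n -{1}bN addNr.
Qed.

End ComplexMatrices.

(** * The pairing and maximal isotropic subspaces *)

Section Pairing.
Variables (K : fieldType) (n : nat).
Implicit Types u v w : 'rV[K]_(n + n).

(** The Gram matrix of twice the pairing; the factor 1/2 stays outside. *)
Definition pairing_mx : 'M[K]_(n + n) := block_mx 0 1%:M 1%:M 0.

Definition incT : 'M[K]_(n, n + n) := row_mx 1%:M 0.
Definition incT' : 'M[K]_(n, n + n) := row_mx 0 1%:M.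
Definition prT : 'M[K]_(n + n, n) := col_mx 1%:M 0.

Lemma pairingE u v : pairing u v = 2^-1 * (u *m pairing_mx *m v^T) 0 0.
Proof.
rewrite /pairing /pairing_mx; congr (_ * _).
rewrite -{3}(hsubmxK u) -{3}(hsubmxK v) mul_row_block !mulmx0 !mulmx1 add0r addr0.
rewrite tr_row_mx mul_row_col [RHS]mxE; congr (_ + _).
by rewrite -[in RHS](trmxK (lsubmx u *m _)) trmx_mul trmxK [RHS]mxE.
Qed.

Lemma mul_rsub_incT' m (A : 'M[K]_(m, n)) : A *m incT' = row_mx 0 A.
Proof. by rewrite mul_mx_row mulmx0 mulmx1. Qed.

Lemma mul_lsub_incT m (A : 'M[K]_(m, n)) : A *m incT = row_mx A 0.
Proof. by rewrite mul_mx_row mulmx0 mulmx1. Qed.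

Lemma mul_prT m (A : 'M[K]_(m, n + n)) : A *m prT = lsubmx A.
Proof. by rewrite -{1}(hsubmxK A) mul_row_col mulmx0 mulmx1 addr0. Qed.

Lemma pairing0l v : pairing 0 v = 0.
Proof. by rewrite pairingE !mul0mx mxE mulr0. Qed.

Lemma pairingDl u v w : pairing (u + v) w = pairing u w + pairing v w.
Proof. by rewrite !pairingE !mulmxDl mxE mulrDr. Qed.

Lemma pairingZl a u v : pairing (a *: u) v = a * pairing u v.
Proof. by rewrite !pairingE -!scalemxAl mxE mulrCA. Qed.

Lemma pairingC u v : pairing u v = pairing v u.
Proof. by rewrite /pairing addrC. Qed.

Lemma pairingDr u v w : pairing w (u + v) = pairing w u + pairing w v.
Proof. by rewrite ![pairing w _]pairingC pairingDl. Qed.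

Lemma pairingZr a u v : pairing v (a *: u) = a * pairing v u.
Proof. by rewrite ![pairing v _]pairingC pairingZl. Qed.

Lemma pairingNl u v : pairing (- u) v = - pairing u v.
Proof. by rewrite -scaleN1r pairingZl mulN1r. Qed.

Lemma pairingNr u v : pairing v (- u) = - pairing v u.
Proof. by rewrite -scaleN1r pairingZr mulN1r. Qed.

Lemma pairing_row (X xi Y eta : 'rV[K]_n) :
  pairing (row_mx X xi) (row_mx Y eta) = 2^-1 * ((xi *m Y^T) 0 0 + (eta *m X^T) 0 0).
Proof. by rewrite /pairing !row_mxKl !row_mxKr. Qed.

End Pairing.
Arguments pairing_mx {K n}.
Arguments incT {K n}.
Arguments incT' {K n}.
Arguments prT {K n}.

Lemma conj_pairing (R : realType) n (u v : 'rV[R[i]]_(n + n)) :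
  pairing (conj_mx u) (conj_mx v) = (pairing u v)^*%C.
Proof.
rewrite !pairingE rmorphM fmorphV rmorph_nat; congr (_ * _).
have E : pairing_mx = conj_mx pairing_mx :> 'M[R[i]]_(n + n).
  by rewrite /conj_mx map_block_mx map_mx0 map_mx1.
by rewrite {1}E -conj_mx_tr -!conj_mxM [LHS]mxE.
Qed.

Lemma toC_pairing (R : realType) n (u v : 'rV[R]_(n + n)) :
  pairing (toC u) (toC v) = (pairing u v)%:C%C.
Proof.
rewrite !pairingE rmorphM fmorphV rmorph_nat; congr (_ * _).
have -> : pairing_mx = toC pairing_mx :> 'M[R[i]]_(n + n).
  by rewrite /toC map_block_mx map_mx0 map_mx1.
by rewrite -toC_tr -!toCM [LHS]mxE.
Qed.

Section MaximalIsotropic.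
Variables (K : numFieldType) (n : nat).
Implicit Types (u v : 'rV[K]_(n + n)) (S : set 'rV[K]_(n + n)).

Lemma pairing_incT' (xi : 'rV[K]_n) u :
  pairing (row_mx 0 xi) u = 2^-1 * (xi *m (lsubmx u)^T) 0 0.
Proof. by rewrite -{1}(hsubmxK u) pairing_row trmx0 mulmx0 [X in _ + X]mxE addr0. Qed.

Lemma pairing_incT'_eq0 (xi : 'rV[K]_n) u :
  pairing (row_mx 0 xi) u = 0 -> xi *m (lsubmx u)^T = 0.
Proof.
rewrite pairing_incT' => /eqP; rewrite mulf_eq0 invr_eq0 pnatr_eq0 /= => /eqP E.
by rewrite [LHS]mx11_scalar E raddf0.
Qed.

(** A covector that annihilates the projection of [S] is null and orthogonal to [S], so adjoining it
    keeps the space isotropic; maximality then puts it in [S]. *)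
Lemma maximal_isotropic_incT' S (xi : 'rV[K]_n) : maximal_isotropic S ->
  (forall u, S u -> xi *m (lsubmx u)^T = 0) -> S (row_mx 0 xi).
Proof.
move=> [[S0 Slin] iS maxS] xiS.
pose u := row_mx 0 xi : 'rV[K]_(n + n).
have uS v : S v -> pairing u v = 0.
  by move=> /xiS E; rewrite pairing_incT' E mxE mulr0.
have uu : pairing u u = 0.
  by rewrite pairing_incT' row_mxKl trmx0 mulmx0 mxE mulr0.
pose W : set 'rV[K]_(n + n) := [set w | exists a s, S s /\ w = a *: u + s].
have sub0 : is_subspace W.
  split; first by exists 0, 0; rewrite scale0r addr0.
  move=> c _ _ [a [s [Ss ->]]] [b [t [St ->]]]; exists (c * a + b), (c *: s + t); split.
    exact: Slin.
  by rewrite scalerDr scalerA scalerDl addrACA.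
apply: (maxS W) => //.
- move=> _ _ [a [s [Ss ->]]] [b [t [St ->]]].
  rewrite !(pairingDl, pairingDr, pairingZl, pairingZr) uu (pairingC s) !uS // iS //.
  by rewrite !mulr0 !addr0.
- by move=> s Ss; exists 0, s; rewrite scale0r add0r.
- by exists 1, 0; rewrite scale1r addr0.
Qed.

(* The kernel of the projection of S to T is the annihilator of its image. *)
Lemma maximal_isotropic_rank S k (F : 'M[K]_(k, n + n)) : maximal_isotropic S ->
  row_free F -> (forall u, S u <-> (u <= F)%MS) -> k = n.
Proof.
move=> mS fF SF; have [_ iS _] := mS.
have rF : \rank F = k by apply/eqP.
rewrite -[LHS]rF -(mxrank_mul_ker F prT).
set M := F *m prT; have ME : M = F *m prT by [].
clearbody M.
suff -> : \rank (F :&: kermx prT)%MS = \rank (kermx M^T).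
  by rewrite mxrank_ker mxrank_tr subnKC // rank_leq_col.
have rM : \rank (kermx M^T) = \rank (kermx M^T *m incT').
  rewrite mxrankMfree //; apply: inj_row_free => v; rewrite mul_rsub_incT' => E.
  by have := congr1 rsubmx E; rewrite row_mxKr linear0.
rewrite rM; apply/eqP; rewrite eqn_leq; apply/andP; split; apply: mxrankS; apply/rV_subP => u.
  rewrite sub_capmx => /andP[uF /sub_kermxP]; rewrite mul_prT => u0.
  apply/submxP; have Su : S u by apply/SF.
  have : (rsubmx u <= kermx M^T)%MS.
    apply/sub_kermxP; apply/rowP => j; rewrite [RHS]mxE.
    have Sj : S (row j F) by apply/SF; exact: row_sub.
    have := iS _ _ Su Sj; rewrite -{1}(hsubmxK u) u0 => /pairing_incT'_eq0.
    move=> /(congr1 (fun A : 'M[K]_1 => A 0 0)); rewrite [in RHS]mxE => <-.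
    by rewrite ME mul_prT !mxE; apply: eq_bigr => l _; rewrite !mxE.
  case/submxP => c cE; exists c.
  by rewrite mulmxA -cE mul_rsub_incT' -[LHS](hsubmxK u) u0.
case/submxP => c ->; rewrite mulmxA mul_rsub_incT' sub_capmx; apply/andP; split.
  apply/SF; apply: maximal_isotropic_incT' => // v /SF/submxP[d ->].
  rewrite -mul_prT -(mulmxA d F prT) -ME trmx_mul mulmxA -(mulmxA c).
  by rewrite mulmx_ker mulmx0 mul0mx.
by apply/sub_kermxP; rewrite mul_prT row_mxKl.
Qed.

End MaximalIsotropic.

(** * Real matrices with a prescribed i-eigenspace *)

Section EigenspaceI.
Context {R : realType}.

Definition eigi {m} (J : 'M[R]_m) : set 'rV[R[i]]_m :=
  [set u | u *m toC J = 'i%C *: u].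

Lemma eigi_realE m (J : 'M[R]_m) (u v : 'rV[R]_m) :
  eigi J (toC u + 'i%C *: toC v) <-> u *m J = - v /\ v *m J = u.
Proof.
rewrite /eigi /= mulmxDl -scalemxAl -!toCM scalerDr scalerA sqr_im scaleN1r addrC -toCN.
rewrite addrC [in X in _ = X]addrC; split; first exact: toC_im_inj.
by move=> [-> ->].
Qed.

Lemma eigi_real0 m (J : 'M[R]_m) (u : 'rV[R]_m) : eigi J (toC u) -> u = 0.
Proof.
rewrite -[toC u]addr0 -(scaler0 _ 'i%C) -(toC0 1 m) => /eigi_realE[_ <-].
by rewrite mul0mx.
Qed.

Lemma conj_eigi m (J : 'M[R]_m) (u : 'rV[R[i]]_m) :
  eigi J (conj_mx u) <-> u *m toC J = - 'i%C *: u.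
Proof.
rewrite /eigi /= -conj_im -[X in _ <-> X]/(u *m toC J = conjc 'i%C *: u); split => [E|E].
  by rewrite -[LHS]conj_mxK conj_mxM conj_toC E conj_mxZ conj_mxK.
by rewrite -{1}(conj_toC J) -conj_mxM E conj_mxZ conjcK.
Qed.

Lemma conj_set_eigi m (J : 'M[R]_m) : conj_set (eigi J) = eigi (- J).
Proof.
apply/seteqP; split => u; rewrite /conj_set /=.
  by move/conj_eigi; rewrite /eigi /= toCN mulmxN => ->; rewrite scaleNr opprK.
by move=> uJ; apply/conj_eigi; rewrite scaleNr -uJ toCN mulmxN opprK.
Qed.

Lemma eigi_disj m (J : 'M[R]_m) (u : 'rV[R[i]]_m) : eigi J u -> eigi J (conj_mx u) -> u = 0.
Proof.
move=> uJ /conj_eigi; rewrite uJ scaleNr => /eqP; rewrite eq_sym -subr_eq0 -opprD oppr_eq0.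
by rewrite -mulr2n -scaler_nat scaler_eq0 pnatr_eq0 /= scaler_eq0 (negPf im_neq0) => /eqP.
Qed.

(** For real [u] the vector [u - i uJ] lies in the eigenspace, and the real part of the pairing of
    two such vectors is [<u, v> - <uJ, vJ>]. *)
Lemma eigi_orth n (J : 'M[R]_(n + n)) : J *m J = - 1%:M -> isotropic (eigi J) ->
  forall u v, pairing (u *m J) (v *m J) = pairing u v.
Proof.
move=> JJ iJ u v.
have plus w : eigi J (toC w + 'i%C *: toC (- (w *m J))).
  by apply/eigi_realE; rewrite opprK mulNmx -mulmxA JJ mulmxN mulmx1 opprK.
have := iJ _ _ (plus u) (plus v).
rewrite !(pairingDl, pairingDr, pairingZl, pairingZr) !toC_pairing !pairingNl !pairingNr opprK.
move=> /(congr1 (@complex.Re R)) /= E; apply/esym/eqP; rewrite -subr_eq0; apply/eqP.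
by rewrite -[RHS]E; ring.
Qed.

Section ComplexStructureOf.
Context {n : nat}.
Implicit Types (F : 'M[R[i]]_(n, n + n)) (J : 'M[R]_(n + n)).

(* The matrix J with (Re F) J = - Im F and (Im F) J = Re F, which says that
   the rows of F are i-eigenvectors of J. *)
Definition cx_of F : 'M[R]_(n + n) :=
  invmx (col_mx (Remx F) (Immx F)) *m col_mx (- Immx F) (Remx F).

Lemma mul_imP F J : F *m toC J = 'i%C *: F <->
  col_mx (Remx F) (Immx F) *m J = col_mx (- Immx F) (Remx F).
Proof.
rewrite mul_col_mx {1 2}[F]Remx_Immx mulmxDl -scalemxAl -!toCM scalerDr scalerA sqr_im.
rewrite scaleN1r -toCN [X in _ = X]addrC.
by split=> [/toC_im_inj[-> ->]|/eq_col_mx[-> ->]].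
Qed.

Lemma cx_of_mul F : col_mx (Remx F) (Immx F) \in unitmx ->
  F *m toC (cx_of F) = 'i%C *: F.
Proof. by move=> Fu; apply/mul_imP; rewrite mulKVmx. Qed.

Lemma cx_of_uniq F J : col_mx (Remx F) (Immx F) \in unitmx ->
  F *m toC J = 'i%C *: F -> J = cx_of F.
Proof. by move=> Fu /mul_imP E; rewrite /cx_of -E mulKmx. Qed.

Lemma cx_of_sqr F : col_mx (Remx F) (Immx F) \in unitmx ->
  cx_of F *m cx_of F = - 1%:M.
Proof.
move=> Fu; have /mul_imP := cx_of_mul Fu; rewrite mul_col_mx => E; have [ER EI] := eq_col_mx E.
apply: (can_inj (mulKmx Fu)); rewrite mulmxA !mul_col_mx ER EI mulNmx EI ER.
by rewrite !mulmxN !mulmx1.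
Qed.

Lemma eigi_cx_of F u : col_mx (Remx F) (Immx F) \in unitmx ->
  eigi (cx_of F) u <-> (u <= F)%MS.
Proof.
move=> Fu; split; last first.
  by case/submxP => c ->; rewrite /eigi /= -mulmxA cx_of_mul // -scalemxAr.
have FuC : toC (col_mx (Remx F) (Immx F)) \in unitmx by rewrite toC_unit.
(* Write [u = p Re F + q Im F]. Comparing coefficients in the basis formed by the rows of [Re F] and
   [Im F], the eigenvalue equation forces [q = i p], so that [u = p F]. *)
rewrite /eigi /=; rewrite -(mulmxKV FuC u); set d := u *m _.
rewrite -mulmxA -toCM; have /mul_imP -> := cx_of_mul Fu.
rewrite -(hsubmxK d) !toC_col !mul_row_col; set p := lsubmx d; set q := rsubmx d.
move=> E; have : row_mx (q - 'i%C *: p) (- p - 'i%C *: q) *m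
    toC (col_mx (Remx F) (Immx F)) = 0.
  rewrite toC_col mul_row_col !mulmxBl !mulNmx -!scalemxAl addrACA -opprD.
  by apply/eqP; rewrite subr_eq0; apply/eqP; rewrite addrC -mulmxN -toCN E scalerDr.
move/(canRL (mulmxK FuC)); rewrite mul0mx -row_mx0 => /eq_row_mx[/eqP]; rewrite subr_eq0 => /eqP -> _.
apply/submxP; exists p; rewrite [in RHS](Remx_Immx F) mulmxDr -scalemxAr -scalemxAl.
by [].
Qed.

Lemma col_Re_Im_unit F : row_free F ->
  (forall u : 'rV[R[i]]_(n + n), (u <= F)%MS -> (conj_mx u <= F)%MS -> u = 0) ->
  col_mx (Remx F) (Immx F) \in unitmx.
Proof.
move=> fF disj; rewrite -row_free_unit; apply: inj_row_free => v.
rewrite -(hsubmxK v); set a := lsubmx v; set b := rsubmx v; rewrite mul_row_col => E.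
(* The relation [a Re F + b Im F = 0] says that the imaginary part of [(b + i a) F] vanishes. This
   real vector of the row space equals its own conjugate, so [disj] applies to it. *)
pose c := toC b + 'i%C *: toC a.
have cF : c *m F = toC (b *m Remx F - a *m Immx F).
  rewrite {1}[F]Remx_Immx /c mulmxDl !mulmxDr -!scalemxAl -!scalemxAr scalerA sqr_im.
  rewrite scaleN1r -!toCM toCD toCN [X in _ + X]addrC addrACA -scalerDr -toCD.
  rewrite [b *m Immx F + _]addrC E.
  by rewrite toC0 scaler0 addr0.
have c0 : c *m F = 0.
  by apply: disj; rewrite ?submxMl // cF conj_toC -cF submxMl.
have : c = 0 by apply: (row_free_inj fF); rewrite c0 mul0mx.
rewrite /c -[RHS]addr0 -{2}(scaler0 _ 'i%C) -(toC0 1 n) => /toC_im_inj[-> ->].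
by rewrite row_mx0.
Qed.

Lemma maximal_isotropic_eigi (S : set 'rV[R[i]]_(n + n)) k
    (F : 'M[R[i]]_(k, n + n)) :
  maximal_isotropic S -> row_free F -> (forall u, S u <-> (u <= F)%MS) ->
  (forall u, S u -> S (conj_mx u) -> u = 0) ->
  exists J : 'M[R]_(n + n), [/\ J *m J = - 1%:M,
    (forall u v, pairing (u *m J) (v *m J) = pairing u v) & S = eigi J].
Proof.
move=> mS fF SF dS; have kn := maximal_isotropic_rank mS fF SF.
subst k; have Fu : col_mx (Remx F) (Immx F) \in unitmx.
  by apply: col_Re_Im_unit => // u /SF ? /SF ?; exact: dS.
have SE : S = eigi (cx_of F).
  by apply/seteqP; split=> u; rewrite SF -(eigi_cx_of _ Fu).
exists (cx_of F); split=> //; first exact: cx_of_sqr.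
by apply: eigi_orth; [exact: cx_of_sqr|rewrite -SE; case: mS].
Qed.

End ComplexStructureOf.

End EigenspaceI.

(** * Half differences of subspaces *)

Section HalfDifference.
Context {R : realType} {n : nat}.
Implicit Types (S : set 'rV[R[i]]_(n + n)) (X z : 'rV[R[i]]_n).

Lemma two_im_neq0 : 2 * 'i%C != 0 :> R[i].
Proof. by rewrite mulf_neq0 ?im_neq0 // pnatr_eq0. Qed.

(** The covector part of the half difference is [z = (alpha - beta) / 2i]; solving for [beta] leaves
    a single existential. *)
Lemma half_diffP S S' X z : half_diff S S' (row_mx X z) <->
  exists2 alpha, S (row_mx X alpha) & S' (row_mx X (alpha - (2 * 'i%C) *: z)).
Proof.
split=> [[X0 [z0 [[X1 [al [be [Sa [X2 [b [S'b e2]]] e1]]]] e0]]]|].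
  have [-> ->] := eq_row_mx e0; have [-> ->] := eq_row_mx e1.
  have [XE ->] := eq_row_mx e2; exists al => //; rewrite XE.
  by rewrite scalerA divff ?two_im_neq0 // scale1r scaleN1r opprB addrC subrK.
case=> alpha Sa S'b; exists X, ((2 * 'i%C) *: z); split; last first.
  by rewrite scalerA mulVf ?two_im_neq0 // scale1r.
exists X, alpha, (- (alpha - (2 * 'i%C) *: z)); split=> //.
  by exists X, (alpha - (2 * 'i%C) *: z); rewrite scaleN1r.
by rewrite opprB addrC subrK.
Qed.

(** A vanishing covector part means that both summands carry the same covector. This turns (iii)
    into a statement about the projections of L1 :&: L2 and of L1 :&: conj L2. *)
Lemma capT_half_diffP S S' X : capT (half_diff S S') X <->
  exists2 alpha, S (row_mx X alpha) & S' (row_mx X alpha).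
Proof.
rewrite /capT /= half_diffP.
by split=> -[alpha Sa S'a]; exists alpha => //; move: S'a; rewrite scaler0 subr0.
Qed.

(* Real points of S would be covectors by (ii), and these annihilate
   everything by (i). *)
Lemma disjoint_conj S : is_subspace S -> isotropic S ->
  sum_full (projT S) (projT (conj_set S)) ->
  capT (real_set (half_diff S (conj_set S))) = [set 0] ->
  forall u, S u -> S (conj_mx u) -> u = 0.
Proof.
move=> [S0 Slin] iS full cap.
have real0 (w : 'rV[R]_(n + n)) : S (toC w) -> w = 0.
  rewrite -(hsubmxK w); set X := lsubmx w; set xi := rsubmx w => Sw.
  have X0 : X = 0.
    have : [set 0 : 'rV[R]_n] X; last by [].
    rewrite -cap /capT /= /real_set /= toC_row toC0; apply/half_diffP.
    exists (toC xi); first by rewrite -toC_row.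
    by rewrite scaler0 subr0 /conj_set /= conj_mx_row !conj_toC -toC_row.
  rewrite X0; suff -> : xi = 0 by rewrite row_mx0.
  move: Sw; rewrite X0 toC_row toC0 => Sxi.
  apply: (@toC_inj _ 1 n); rewrite toC0; apply/rowP => j.
  have [Y [Z [[beta SY] [gamma SZ] E]]] := full (delta_mx 0 j).
  have aY := pairing_incT'_eq0 (iS _ _ Sxi SY).
  have aZ := pairing_incT'_eq0 (iS _ _ Sxi SZ).
  rewrite row_mxKl in aY; rewrite conj_mx_row row_mxKl in aZ.
  have aZ' : toC xi *m Z^T = 0.
    by apply: conj_mx_eq0; rewrite conj_mxM conj_toC conj_mx_tr.
  have : toC xi *m (delta_mx 0 j : 'rV[R[i]]_n)^T = 0 by rewrite E raddfD mulmxDr aY aZ' addr0.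
  by rewrite trmx_delta -colE => /matrixP/(_ 0 0); rewrite !mxE.
have half (w : 'rV[R[i]]_(n + n)) : S w -> conj_mx w = w -> w = 0.
  by move=> Sw /conj_mx_fixed wE; rewrite wE (real0 (Remx w)) ?toC0 -?wE.
move=> u Su Scu.
(* [u + conj u] and [i (u - conj u)] are real elements of [S]; both vanish by [half], and with them
   [u]. *)
have re : u + conj_mx u = 0.
  apply: half; last by rewrite conj_mxD conj_mxK addrC.
  by rewrite -[u]scale1r; apply: Slin; rewrite ?scale1r.
have im : 'i%C *: u - 'i%C *: conj_mx u = 0.
  apply: half; last by rewrite conj_mxD conj_mxN !conj_mxZ conj_mxK conj_im !scaleNr opprK addrC.
  by apply: (Slin) => //; rewrite -scaleNr -[_ *: conj_mx u]addr0; apply: (Slin).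
move: im; rewrite -scalerBr => /eqP; rewrite scaler_eq0 (negPf im_neq0) /= subr_eq0 => /eqP im.
move: re; rewrite -im -mulr2n -scaler_nat => /eqP.
by rewrite scaler_eq0 pnatr_eq0 /= => /eqP.
Qed.

End HalfDifference.

(** * From the fibrewise conditions to a commuting positive pair *)

Section OrthogonalComplexStructure.
Context {R : realType} {n : nat}.
Implicit Types (J : 'M[R]_(n + n)).

Definition orth_cx J : Prop := J *m J = - 1%:M /\
  forall u v, pairing (u *m J) (v *m J) = pairing u v.

(** With [Q] the Gram matrix, orthogonality is [J Q J^T = Q]. Multiplying by [J] on the left and
    using [J^2 = -1] makes [J] skew for the pairing. *)
Lemma orth_cx_skew J : orth_cx J -> J *m pairing_mx = - (pairing_mx *m J^T).
Proof.
move=> [JJ oJ].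
have E : J *m pairing_mx *m J^T = pairing_mx.
  apply/matrixP => i j; have := oJ (delta_mx 0 i) (delta_mx 0 j).
  rewrite !pairingE => /mulfI; rewrite invr_eq0 pnatr_eq0 => /(_ isT).
  by rewrite trmx_mul !trmx_delta !mulmxA -!(mulmxA (delta_mx 0 i)) -!colE -!rowE !mxE.
by rewrite -{1}E !mulmxA JJ !mulNmx mul1mx.
Qed.

Lemma orth_cxN J : orth_cx J -> orth_cx (- J).
Proof.
move=> [JJ oJ]; split; first by rewrite mulmxN mulNmx opprK.
by move=> u v; rewrite !mulmxN pairingNl pairingNr opprK.
Qed.

(** By skewness, [i <u, v> = <uJ, v> = - <u, vJ> = - i <u, v>]. *)
Lemma eigi_isotropic J : orth_cx J -> isotropic (eigi J).
Proof.
move=> oJ u v uJ vJ; have sJ := congr1 toC (orth_cx_skew oJ).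
have : 'i%C * pairing u v = - ('i%C * pairing u v).
  rewrite -{1}pairingZl -uJ -pairingZr -vJ !pairingE trmx_mul.
  have E : toC (@pairing_mx R n) = pairing_mx.
    by rewrite /toC map_block_mx map_mx0 map_mx1.
  rewrite toCN !toCM toC_tr E in sJ.
  by rewrite -!mulmxA (mulmxA (toC J)) sJ mulNmx mulmxN [in LHS]mxE mulrN !mulmxA.
move/eqP; rewrite -addr_eq0 -mulr2n mulrn_eq0 /= mulf_eq0 (negPf im_neq0) /= => /eqP //.
Qed.

Lemma eigiE J u : eigi J u -> u *m toC J = 'i%C *: u. Proof. by []. Qed.

Lemma eigi_conjE J u : eigi J u -> conj_mx u *m toC J = - 'i%C *: conj_mx u.
Proof. by move=> uJ; apply/conj_eigi; rewrite conj_mxK. Qed.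

Variables J1 J2 : 'M[R]_(n + n).
Hypotheses (oJ1 : orth_cx J1) (oJ2 : orth_cx J2).
Let S1 := eigi J1.
Let S2 := eigi J2.
Hypothesis fullp :
  direct_sum_full (capT (half_diff S1 S2)) (capT (conj_set (half_diff S1 S2))).
Hypothesis fullm :
  direct_sum_full (capT (half_diff S1 (conj_set S2)))
                  (capT (conj_set (half_diff S1 (conj_set S2)))).
Hypothesis pos : forall u, S1 u -> S2 u -> u != 0 -> 0 < pairing u (conj_mx u).

(* A = L1 :&: L2 and B = L1 :&: conj L2; VP and VM are the sums with their
   conjugates, the eigenspaces of - J1 J2 for 1 and -1. *)
Variables A B VP VM : 'M[R[i]]_(n + n).
Hypothesis AP : forall u : 'rV_(n + n), (u <= A)%MS <-> S1 u /\ S2 u.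
Hypothesis BP : forall u : 'rV_(n + n), (u <= B)%MS <-> S1 u /\ eigi (- J2) u.
Hypothesis VPP : forall v : 'rV_(n + n), (v <= VP)%MS <->
  exists a b, [/\ (a <= A)%MS, (b <= A)%MS & v = a + conj_mx b].
Hypothesis VMP : forall v : 'rV_(n + n), (v <= VM)%MS <->
  exists a b, [/\ (a <= B)%MS, (b <= B)%MS & v = a + conj_mx b].

(** Condition (iii) splits a tangent vector as [X + Y], where [X] and the conjugate of [Y] both lift
    to [C]; so the vector is the projection of an element of [V]. In particular [V] has rank at
    least [n]. *)
Let full_rank (C V : 'M[R[i]]_(n + n)) (L : set 'rV[R[i]]_(n + n)) :
  (forall v : 'rV_(n + n), (v <= V)%MS <->
     exists a b, [/\ (a <= C)%MS, (b <= C)%MS & v = a + conj_mx b]) ->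
  (forall X, capT L X -> exists2 a, (a <= C)%MS & lsubmx a = X) ->
  direct_sum_full (capT L) (capT (conj_set L)) -> row_full (V *m prT).
Proof.
move=> VC LC full; rewrite -sub1mx; apply/row_subP => i; set Z := row i _.
have [[X Y] [[/= /LC[a aC aX] LY ->] _]] := full Z.
have /LC[b bC bY] : capT L (conj_mx Y).
  by move: LY; rewrite /capT /conj_set /= conj_mx_row conj_mx0.
have -> : X + Y = (a + conj_mx b) *m prT.
  rewrite mul_prT linearD /= aX; congr (_ + _).
  by rewrite -[Y]conj_mxK -bY; apply/rowP => j; rewrite !mxE.
by apply: submxMr; apply/VC; exists a, b.
Qed.

Let full_VP : row_full (VP *m prT).
Proof.
apply: (full_rank VPP _ fullp) => X /capT_half_diffP[al Sa S'a].
by exists (row_mx X al); [apply/AP|rewrite row_mxKl].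
Qed.

Let full_VM : row_full (VM *m prT).
Proof.
apply: (full_rank VMP _ fullm) => X /capT_half_diffP[al Sa S'a].
exists (row_mx X al); last by rewrite row_mxKl.
by apply/BP; rewrite -conj_set_eigi.
Qed.

Let posA a : (a <= A)%MS -> 0 <= pairing a (conj_mx a) /\ (pairing a (conj_mx a) = 0 -> a = 0).
Proof.
move=> /AP[a1 a2]; have [->|a0] := eqVneq a 0; first by rewrite pairing0l.
have := pos a1 a2 a0; rewrite lt0r => /andP[p0 p1]; split=> // E.
by move: p0; rewrite E eqxx.
Qed.

(** For [v = a + conj b] the cross terms are [<a, b>] and its conjugate, zero because [a] and [b]
    lie in the isotropic L1. What remains is [<a, conj a> + <b, conj b>]. *)
Let posVP v : (v <= VP)%MS -> 0 <= pairing v (conj_mx v) /\ (pairing v (conj_mx v) = 0 -> v = 0).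
Proof.
move=> /VPP[a [b [aA bA ->]]]; rewrite conj_mxD conj_mxK.
rewrite !pairingDl !pairingDr.
have [a1 _] := (AP a).1 aA; have [b1 _] := (AP b).1 bA.
rewrite conj_pairing (eigi_isotropic oJ1 a1 b1) (eigi_isotropic oJ1 b1 a1) conjc0 addr0 add0r.
rewrite (pairingC (conj_mx b)).
have [] := posA aA; have [] := posA bA.
move: (pairing a _) (pairing b _) => p q q0 bz p0 az; split; first by rewrite addr_ge0.
move/eqP; rewrite (paddr_eq0 p0 q0) => /andP[/eqP/az -> /eqP/bz ->].
by rewrite conj_mx0 addr0.
Qed.

(** Each of the four pairs of summands lies in a common isotropic space: L1, L2 or the conjugate of
    one of them. *)
Let orthVM v w : (v <= VP)%MS -> (w <= VM)%MS -> pairing v w = 0.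
Proof.
move=> /VPP[a [b [aA bA ->]]] /VMP[c [d [cB dB ->]]].
have [a1 a2] := (AP a).1 aA; have [b1 b2] := (AP b).1 bA.
have [c1 c2] := (BP c).1 cB; have [d1 d2] := (BP d).1 dB.
move: c2 d2; rewrite -conj_set_eigi => c2 d2.
rewrite !pairingDl !pairingDr conj_pairing (eigi_isotropic oJ1 a1 c1) (eigi_isotropic oJ1 b1 d1).
rewrite (eigi_isotropic oJ2 a2 d2) -[c]conj_mxK conj_pairing (eigi_isotropic oJ2 b2 c2).
by rewrite conjc0 !addr0.
Qed.

Let conjVP (v : 'rV_(n + n)) : (v <= VP)%MS -> (conj_mx v <= VP)%MS.
Proof.
move=> /VPP[a [b [aA bA ->]]]; apply/VPP; exists b, a.
by split=> //; rewrite conj_mxD conj_mxK addrC.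
Qed.

Let conjVM (v : 'rV_(n + n)) : (v <= VM)%MS -> (conj_mx v <= VM)%MS.
Proof.
move=> /VMP[a [b [aA bA ->]]]; apply/VMP; exists b, a.
by split=> //; rewrite conj_mxD conj_mxK addrC.
Qed.

Let decomp (u : 'rV[R[i]]_(n + n)) : exists v w, [/\ (v <= VP)%MS, (w <= VM)%MS & u = v + w].
Proof.
(* A [v] in both spaces is orthogonal to its own conjugate, so positivity on [VP] makes it zero.
   Both ranks are at least [n], hence the direct sum is everything. *)
have cap0 : (VP :&: VM)%MS = 0.
  apply/eqP; rewrite -submx0; apply/rV_subP => v; rewrite sub_capmx => /andP[vP vM].
  rewrite submx0; apply/eqP; apply: (posVP vP).2.
  by apply: orthVM vP _; exact: conjVM.
have full : row_full (VP + VM)%MS.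
  rewrite /row_full eqn_leq rank_leq_col /= mxrank_disjoint_sum //.
  by apply: leq_add; [have := mxrankM_maxl VP prT|have := mxrankM_maxl VM prT];
    rewrite ?(eqP full_VP) ?(eqP full_VM).
have /sub_addsmxP[[a b] /= uE] := submx_full u full.
by exists (a *m VP), (b *m VM); rewrite !submxMl.
Qed.

Let actVP (v : 'rV_(n + n)) : (v <= VP)%MS -> v *m toC J1 *m toC J2 = - v /\ v *m toC J2 *m toC J1 = - v.
Proof.
move=> /VPP[a [b [/AP[a1 a2] /AP[b1 b2] ->]]]; split.
  rewrite !mulmxDl (eigiE a1) (eigi_conjE b1) -!scalemxAl (eigiE a2) (eigi_conjE b2) !scalerA.
  by rewrite mulrNN sqr_im !scaleN1r opprD.
rewrite !mulmxDl (eigiE a2) (eigi_conjE b2) -!scalemxAl (eigiE a1) (eigi_conjE b1) !scalerA.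
by rewrite mulrNN sqr_im !scaleN1r opprD.
Qed.

Let actVM (w : 'rV_(n + n)) : (w <= VM)%MS -> w *m toC J1 *m toC J2 = w /\ w *m toC J2 *m toC J1 = w.
Proof.
move=> /VMP[a [b [/BP[a1 a2] /BP[b1 b2] ->]]].
move: a2 b2; rewrite -conj_set_eigi => /conj_eigi a2.
rewrite /conj_set /= => /eigiE b2; split.
  rewrite !mulmxDl (eigiE a1) (eigi_conjE b1) -!scalemxAl a2 b2 !scalerA.
  by rewrite mulrN mulNr sqr_im opprK !scale1r.
rewrite !mulmxDl a2 b2 -!scalemxAl (eigiE a1) (eigi_conjE b1) !scalerA.
by rewrite mulrN mulNr sqr_im opprK !scale1r.
Qed.

Lemma orth_cx_commute_aux : J1 *m J2 = J2 *m J1.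
Proof.
apply: toC_inj; rewrite !toCM; apply/row_matrixP => i; rewrite !rowE !mulmxA.
have [v [w [vP wM ->]]] := decomp (delta_mx 0 i).
have [v1 v2] := actVP vP; have [w1 w2] := actVM wM.
by rewrite !mulmxDl v1 v2 w1 w2.
Qed.

Lemma orth_cx_positive_aux (u : 'rV[R]_(n + n)) : u != 0 -> 0 < pairing (u *m - (J1 *m J2)) u.
Proof.
move=> u0; have [v [w [vP wM uE]]] := decomp (toC u).
have [v1 _] := actVP vP; have [w1 _] := actVM wM.
have [z zP zw] : exists2 z, (z <= VP)%MS & lsubmx z = lsubmx w.
  have := submx_full (lsubmx w) full_VP.
  case/submxP => c cE; exists (c *m VP); first exact: submxMl.
  by rewrite -mul_prT -mulmxA -cE.
have wE : pairing w (conj_mx w) = - pairing z (conj_mx z).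
  have : pairing (z - w) (conj_mx (z - w)) = 0.
    have zw0 : lsubmx (z - w) = 0 by rewrite linearB /= zw subrr.
    have czw0 : lsubmx (conj_mx (z - w)) = 0.
      by apply/rowP => j; move/rowP/(_ j): zw0; rewrite !mxE => ->; rewrite conjc0.
    by rewrite -{1}(hsubmxK (z - w)) zw0 pairing_incT' czw0 trmx0 mulmx0 mxE mulr0.
  rewrite conj_mxD conj_mxN !pairingDl !pairingDr !pairingNl !pairingNr opprK.
  rewrite (orthVM zP (conjVM wM)) (pairingC w) (orthVM (conjVP zP) wM) !oppr0 addr0 add0r.
  by move/eqP; rewrite addr_eq0 => /eqP ->; rewrite opprK.
(* If [z = 0], then [w] is a covector orthogonal to [VP], which projects onto the whole tangent
   space. *)
have w0 : z = 0 -> w = 0.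
  move=> z0; have xi0 : forall v', (v' <= VP)%MS -> pairing w v' = 0.
    by move=> v' v'P; rewrite pairingC; exact: orthVM.
  have lw : lsubmx w = 0 by rewrite -zw z0 linear0.
  rewrite -(hsubmxK w) lw; suff -> : rsubmx w = 0 by rewrite row_mx0.
  apply/rowP => j; have := submx_full (delta_mx 0 j : 'rV[R[i]]_n) full_VP; case/submxP => c cE.
  have E := xi0 _ (submxMl c VP); rewrite -(hsubmxK w) lw in E.
  move/pairing_incT'_eq0: E.
  rewrite -mul_prT -mulmxA -cE trmx_delta -colE => /matrixP/(_ 0 0).
  by rewrite !mxE.
have [v0 vz] := posVP vP; have [z0 zz] := posVP zP.
rewrite -ltcR -toC_pairing toCM uE toCN toCM mulmxN mulmxDl !mulmxA v1 w1 opprD opprK.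
(* As [u] is real, its second copy may be conjugated. The value becomes [<v, conj v> - <w, conj w>],
   that is, [<v, conj v> + <z, conj z>], a sum of two nonnegative terms. *)
have -> : v + w = conj_mx v + conj_mx w by rewrite -conj_mxD -uE conj_toC.
rewrite !(pairingDl, pairingDr, pairingNl) (orthVM vP (conjVM wM)) (pairingC w).
rewrite (orthVM (conjVP vP) wM) wE opprK oppr0 addr0 add0r.
move: (pairing v _) (pairing z _) v0 vz z0 zz => p q p0 pv q0 qz.
rewrite lt0r (paddr_eq0 p0 q0) (addr_ge0 p0 q0) andbT.
apply: contra u0 => /andP[/eqP/pv v00 /eqP/qz/w0 w00].
by apply/eqP/(@toC_inj _ 1 (n + n)); rewrite uE v00 w00 addr0 toC0.
Qed.

End OrthogonalComplexStructure.

Lemma sub_conj_sumP (R : realType) m (C : 'M[R[i]]_m) (v : 'rV[R[i]]_m) :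
  (v <= C + conj_mx C)%MS <->
  exists a b, [/\ (a <= C)%MS, (b <= C)%MS & v = a + conj_mx b].
Proof.
split=> [/sub_addsmxP[[a b] /= ->]|[a [b [/submxP[c ->] /submxP[d ->] ->]]]].
  exists (a *m C), (conj_mx b *m C); rewrite !submxMl conj_mxM conj_mxK; split=> //.
by rewrite addmx_sub_adds ?submxMl // conj_mxM submxMl.
Qed.

Lemma sub_cap_eigenspaceP (R : realType) m (J J' : 'M[R]_m) (u : 'rV[R[i]]_m) :
  (u <= eigenspace (toC J) 'i%C :&: eigenspace (toC J') 'i%C)%MS <-> eigi J u /\ eigi J' u.
Proof.
rewrite sub_capmx; split=> [/andP[/eigenspaceP uJ /eigenspaceP uJ'] //|[uJ uJ']].
by apply/andP; split; apply/eigenspaceP.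
Qed.

Lemma orth_cx_commute_positive (R : realType) n (J1 J2 : 'M[R]_(n + n)) :
  orth_cx J1 -> orth_cx J2 ->
  let S1 := eigi J1 in let S2 := eigi J2 in
  direct_sum_full (capT (half_diff S1 S2)) (capT (conj_set (half_diff S1 S2))) ->
  direct_sum_full (capT (half_diff S1 (conj_set S2)))
                  (capT (conj_set (half_diff S1 (conj_set S2)))) ->
  (forall u, S1 u -> S2 u -> u != 0 -> 0 < pairing u (conj_mx u)) ->
  J1 *m J2 = J2 *m J1 /\
  forall u, u != 0 -> 0 < pairing (u *m - (J1 *m J2)) u.
Proof.
move=> o1 o2 S1 S2 fp fm pos.
have AP := @sub_cap_eigenspaceP R _ J1 J2.
have BP := @sub_cap_eigenspaceP R _ J1 (- J2).
split.
  exact: (orth_cx_commute_aux o1 o2 fp fm pos AP BP (sub_conj_sumP _) (sub_conj_sumP _)).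
exact: (orth_cx_positive_aux o1 o2 fp fm pos AP BP (sub_conj_sumP _) (sub_conj_sumP _)).
Qed.

(** * Vectors and covectors by type *)

Section ComplexStructure.
Context {R : realType} {n : nat}.
Variable I : 'M[R]_n.
Hypothesis II : I *m I = - 1%:M.
Implicit Types X z : 'rV[R[i]]_n.

Let IIC : toC I *m toC I = - 1%:M.
Proof. by rewrite -toCM II toCN toC1. Qed.

(** T10 and T01 become the image and the kernel of one idempotent, an identity that can be
    differentiated when [I] varies with the point. *)
Definition proj10 : 'M[R[i]]_n := 2^-1 *: (1%:M - 'i%C *: toC I).

Lemma two_half m p (A : 'M[R[i]]_(m, p)) : 2^-1 *: (A + A) = A.
Proof.
by rewrite -mulr2n -[A *+ 2]scaler_nat scalerA mulVf ?scale1r // pnatr_eq0.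
Qed.

Lemma half_eq m p (A B : 'M[R[i]]_(m, p)) : 2^-1 *: B = A -> B = A + A.
Proof. by move=> <-; rewrite -scalerDr two_half. Qed.

Lemma T10_proj10 X : T10 I X <-> X *m proj10 = X.
Proof.
rewrite /T10 /= /proj10 -scalemxAr mulmxBr mulmx1 -scalemxAr; split=> [->|E].
  by rewrite scalerA sqr_im scaleN1r opprK two_half.
have /addrI XI := half_eq E; rewrite -{2}XI scalerN scalerA sqr_im scaleN1r opprK //.
Qed.

Lemma T01_proj10 X : T01 I X <-> X *m proj10 = 0.
Proof.
rewrite /T01 /= /proj10 -scalemxAr mulmxBr mulmx1 -scalemxAr; split=> [->|/eqP].
  by rewrite scalerA mulrN sqr_im opprK scale1r subrr scaler0.
rewrite scaler_eq0 invr_eq0 pnatr_eq0 /= subr_eq0 => /eqP {2}->.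
by rewrite scalerA mulNr sqr_im opprK scale1r.
Qed.

Lemma proj10_mul : proj10 *m toC I = 'i%C *: proj10.
Proof.
rewrite /proj10 -scalemxAl mulmxBl mul1mx -scalemxAl IIC scalerN opprK.
rewrite [RHS]scalerA mulrC -scalerA; congr (_ *: _).
by rewrite scalerBr scalerA sqr_im scaleN1r opprK addrC.
Qed.

Lemma proj10_idem : proj10 *m proj10 = proj10.
Proof.
rewrite {2}/proj10 -scalemxAr mulmxBr mulmx1 -scalemxAr proj10_mul scalerA sqr_im.
by rewrite scaleN1r opprK two_half.
Qed.

Lemma T10_mul_proj10 X : T10 I (X *m proj10).
Proof. by apply/T10_proj10; rewrite -mulmxA proj10_idem. Qed.

Lemma T01_sub_proj10 X : T01 I (X - X *m proj10).
Proof. by apply/T01_proj10; rewrite mulmxBl -mulmxA proj10_idem subrr. Qed.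

Lemma dualT10_proj10 z : dualT10 I z <-> z *m proj10^T = z.
Proof.
have E : proj10^T = 2^-1 *: (1%:M - 'i%C *: (toC I)^T).
  by rewrite /proj10 linearZ /= linearB /= linearZ /= trmx1.
rewrite /dualT10 /= E -scalemxAr mulmxBr mulmx1 -scalemxAr; split=> [->|E'].
  by rewrite scalerA sqr_im scaleN1r opprK two_half.
have /addrI XI := half_eq E'; rewrite -{2}XI scalerN scalerA sqr_im scaleN1r opprK //.
Qed.

Lemma T01_conj X : T01 I X <-> T10 I (conj_mx X).
Proof.
rewrite /T01 /T10 /= -conj_im; split=> E.
  by rewrite -(conj_toC I) -conj_mxM E conj_mxZ conjcK.
by rewrite -[LHS]conj_mxK conj_mxM conj_toC E conj_mxZ conj_mxK.
Qed.

Lemma dualT10_T01 z X : dualT10 I z -> T01 I X -> z *m X^T = 0.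
Proof. by move=> /dualT10_proj10 <- /T01_proj10 E; rewrite -mulmxA -trmx_mul E trmx0 mulmx0. Qed.

Lemma T01D X Y : T01 I X -> T01 I Y -> T01 I (X + Y).
Proof. by move=> /T01_proj10 X0 /T01_proj10 Y0; apply/T01_proj10; rewrite mulmxDl X0 Y0 addr0. Qed.

Lemma T01N X : T01 I X -> T01 I (- X).
Proof. by move=> /T01_proj10 X0; apply/T01_proj10; rewrite mulNmx X0 oppr0. Qed.

Lemma T01_0 : T01 I 0.
Proof. by apply/T01_proj10; rewrite mul0mx. Qed.

Lemma T10_T01_0 X : T10 I X -> T01 I X -> X = 0.
Proof. by move=> /T10_proj10 {2}<- /T01_proj10 ->. Qed.

Lemma capT_L_sigma (S : 'M[R[i]]_n) : capT (L_sigma I S) = T01 I.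
Proof.
apply/seteqP; split=> X /=.
  by case=> Y [z [YI _ /eq_row_mx[-> <-]]]; rewrite mul0mx addr0.
move=> XI; exists X, 0; split=> //; last by rewrite mul0mx addr0.
by rewrite /dualT10 /= mul0mx scaler0.
Qed.

Lemma direct_sum_L_sigma (S : 'M[R[i]]_n) :
  direct_sum_full (capT (L_sigma I S)) (capT (conj_set (L_sigma I S))).
Proof.
have -> : capT (conj_set (L_sigma I S)) = T10 I.
  apply/seteqP; split=> X; rewrite /capT /conj_set /= conj_mx_row conj_mx0 => XS.
    by rewrite -[X]conj_mxK; apply/T01_conj; rewrite -(capT_L_sigma S).
  have : capT (L_sigma I S) (conj_mx X); last by [].
  by rewrite capT_L_sigma; apply/T01_conj; rewrite conj_mxK.
rewrite capT_L_sigma => Z; exists (Z - Z *m proj10, Z *m proj10); split=> /=.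
  split; [exact: T01_sub_proj10|exact: T10_mul_proj10|by rewrite subrK].
case=> X Y /= [/T01_proj10 X0 /T10_proj10 Y0 ->].
by rewrite mulmxDl X0 Y0 add0r addrK.
Qed.

End ComplexStructure.

(** The projection to vectors is adjoint to the inclusion of covectors. Hence an operator that is
    skew or self-adjoint for the pairing has a skew or symmetric block [biv]. *)
Lemma prT_pairing (K : fieldType) n : prT = pairing_mx *m incT'^T :> 'M[K]_(n + n, n).
Proof.
rewrite /incT' tr_row_mx trmx0 trmx1 /pairing_mx mul_block_col !mulmx0 !mulmx1.
by rewrite add0r addr0.
Qed.

Lemma pairing_mx_tr (K : fieldType) n : pairing_mx^T = pairing_mx :> 'M[K]_(n + n).
Proof. by rewrite /pairing_mx tr_block_mx !trmx0 !trmx1. Qed.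

Lemma toC_prT (R : realType) n : toC prT = prT :> 'M[R[i]]_(n + n, n).
Proof. by rewrite toC_col toC1 toC0. Qed.

Lemma toC_incT' (R : realType) n : toC incT' = incT' :> 'M[R[i]]_(n, n + n).
Proof. by rewrite toC_row toC1 toC0. Qed.

Lemma incT'_prT (K : fieldType) n : incT' *m prT = 0 :> 'M[K]_n.
Proof. by rewrite mul_prT row_mxKl. Qed.

(** * Linear algebra of a commuting pair *)

Section CommutingPair.
Context {R : realType} {n : nat}.
Variables K1 K2 : 'M[R]_(n + n).
Hypotheses (o1 : orth_cx K1) (o2 : orth_cx K2) (K12 : K1 *m K2 = K2 *m K1).

(* The block of K from T* to T. *)
Definition biv (K : 'M[R]_(n + n)) : 'M[R]_n := incT' *m K *m prT.

Lemma biv_skew K : orth_cx K -> (biv K)^T = - biv K.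
Proof.
move=> oK; have sK := orth_cx_skew oK.
have pE := prT_pairing R n; have pQ := pairing_mx_tr R n.
rewrite /biv pE !trmx_mul trmxK pQ [in RHS]mulmxA -(mulmxA incT') sK.
by rewrite mulmxN mulNmx opprK !mulmxA.
Qed.

Let G := - (K1 *m K2).
Let g := biv G.

Let GG : G *m G = 1%:M.
Proof.
have [E1 _] := o1; have [E2 _] := o2.
by rewrite /G mulmxN mulNmx opprK {2}K12 mulmxA -(mulmxA K1) E2 mulmxN mulmx1 mulNmx E1 opprK.
Qed.

(** A product of two commuting skew operators is self-adjoint. When [G] is positive, [g] is an
    inverse Riemannian metric. *)
Lemma biv_sym : g^T = g.
Proof.
have pE := prT_pairing R n; have pQ := pairing_mx_tr R n.
have sG : G *m pairing_mx = pairing_mx *m G^T.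
  rewrite /G mulNmx -mulmxA (orth_cx_skew o2) mulmxN mulmxA (orth_cx_skew o1) opprK.
  by rewrite mulNmx -mulmxA -trmx_mul -K12 linearN mulmxN.
by rewrite /g /biv pE !trmx_mul trmxK pQ [in RHS]mulmxA -(mulmxA incT') sG !mulmxA.
Qed.

Hypothesis gu : g \in unitmx.

(* liftT inverts the projection to T of the eigenspace of G for 1, on which
   K1 = K2; under this identification cxI is - K1. *)
Definition liftT : 'M[R]_(n, n + n) := invmx g *m incT' *m (1%:M + G).
Definition cxI : 'M[R]_n := - (invmx g *m (biv K1 + biv K2)).

Let l := liftT.
Let I := cxI.

(** The lift of [X] is [xi + xi G] for the covector [xi = X g^-1]: it is fixed by [G] because
    [G^2 = 1], and its projection is [xi g = X]. *)
Lemma liftT_prT : l *m prT = 1%:M.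
Proof.
rewrite /l /liftT -[LHS]mulmxA mulmxDl mul1mx mulmxDr -!mulmxA incT'_prT mulmx0 add0r.
by rewrite (mulmxA incT') mulVmx.
Qed.

Lemma liftT_G : l *m G = l.
Proof. by rewrite /l /liftT -[LHS]mulmxA mulmxDl mul1mx GG addrC. Qed.

Lemma eigG_K m (v : 'M[R]_(m, n + n)) : v *m G = v -> v *m K2 = v *m K1.
Proof.
move=> vG; have [E2 _] := o2.
by rewrite -{1}vG /G !mulmxN mulNmx -!mulmxA E2 !mulmxN mulmx1 opprK.
Qed.

Lemma eigGC_K m (v : 'M[R[i]]_(m, n + n)) : v *m toC G = v -> v *m toC K2 = v *m toC K1.
Proof.
move=> vG; have [E2 _] := o2.
by rewrite -{1}vG /G toCN toCM !mulmxN mulNmx -!mulmxA -toCM E2 toCN toC1 !mulmxN mulmx1 opprK.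
Qed.

Lemma liftT_K : l *m K2 = l *m K1.
Proof. exact/eigG_K/liftT_G. Qed.

Lemma GK1 : G *m K1 = K1 *m G.
Proof. by rewrite /G mulNmx mulmxN -mulmxA -K12. Qed.

(** The projection to vectors is injective on the eigenspace of [G] for 1: a covector [xi] fixed by
    [G] satisfies [xi g = 0], since [xi g] is the projection of [xi G], and [g] is invertible. *)
Lemma liftT_uniqC m (v : 'M[R[i]]_(m, n + n)) : v *m toC G = v -> v = v *m prT *m toC l.
Proof.
move=> vG; apply/eqP; rewrite -subr_eq0; set w := v - _.
have wp : lsubmx w = 0.
  have -> : lsubmx w = w *m prT by rewrite mul_prT.
  by rewrite mulmxBl -[X in _ - X]mulmxA -{3}toC_prT -toCM liftT_prT toC1 mulmx1 subrr.
have wG : w *m toC G = w by rewrite mulmxBl vG -[X in _ - X]mulmxA -toCM liftT_G.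
have wE : w = rsubmx w *m toC incT'.
  by rewrite toC_incT' mul_rsub_incT' -{1}(hsubmxK w) wp.
have : rsubmx w *m toC g = 0.
  by rewrite /g /biv !toCM !mulmxA -wE wG toC_prT mul_prT wp.
move/(canRL (mulmxK _)); rewrite toC_unit => /(_ gu); rewrite mul0mx => w0.
by rewrite wE w0 mul0mx.
Qed.

Lemma liftT_uniq m (v : 'M[R]_(m, n + n)) : v *m G = v -> v = v *m prT *m l.
Proof.
move=> vG; apply: toC_inj; have := @liftT_uniqC _ (toC v).
by rewrite -toCM vG => /(_ erefl) ->; rewrite -toC_prT -!toCM.
Qed.

(** Since [G K1 = K2], one has [(1 + G) K1 = K1 + K2]; this is where the sum of the two bivectors in
    [cxI] comes from. *)
Lemma cxIE : I = - (l *m K1 *m prT).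
Proof.
rewrite /I /cxI /l /liftT /biv; congr (- _); rewrite -!mulmxA; congr (_ *m _).
rewrite -mulmxDr -mulmxDl [(1%:M + G) *m _]mulmxA; congr (_ *m (_ *m _)).
have [E1 _] := o1.
by rewrite mulmxDl mul1mx /G mulNmx K12 -mulmxA E1 mulmxN mulmx1 opprK.
Qed.

Lemma cxI_liftT : I *m l = - (l *m K1).
Proof.
rewrite cxIE mulNmx; congr (- _); apply/esym/liftT_uniq.
by rewrite -mulmxA -GK1 mulmxA liftT_G.
Qed.

Lemma cxI_sqr : I *m I = - 1%:M.
Proof.
have [E1 _] := o1.
rewrite [X in _ *m X = _]cxIE mulmxN (mulmxA I) (mulmxA I) cxI_liftT !mulNmx opprK -(mulmxA l) E1 mulmxN mulmx1.
by rewrite mulNmx liftT_prT.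
Qed.

Lemma g_cxI : g *m I = - (biv K1 + biv K2).
Proof. by rewrite /I /cxI mulmxN mulKVmx. Qed.

(** [g I] is minus a sum of two bivectors, hence skew: [g] is Hermitian for [I]. *)
Lemma cxI_tr_g : I^T *m g = - (g *m I).
Proof.
by rewrite -{1}biv_sym -trmx_mul g_cxI linearN linearD /= !biv_skew // -opprD.
Qed.



Let toC_K m (A : 'M[R]_(m, n + n)) (K : 'M[R]_(n + n)) (u : 'rV[R[i]]_m) : u *m toC A *m toC K = u *m toC (A *m K).
Proof. by rewrite toCM mulmxA. Qed.

(** The sign in [cxI] matters here: eigenvalue [i] of [K1] becomes [- i] for [I], as the (0,1)
    vectors in [L_sigma] require. *)
Lemma T01_liftT (X : 'rV[R[i]]_n) : T01 I X <-> eigi K1 (X *m toC l).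
Proof.
have lK : l *m K1 = - (I *m l) by rewrite cxI_liftT opprK.
rewrite /T01 /eigi /= toC_K lK (toCN (I *m l)) mulmxN (toCM I l) (mulmxA X); split=> [->|E].
  by rewrite scaleNr mulNmx opprK scalemxAl.
have := congr1 (mulmx^~ prT) E; rewrite mulNmx -scalemxAl -toC_prT -!mulmxA -!toCM.
by rewrite liftT_prT toC1 !mulmx1 scaleNr => <-; rewrite opprK.
Qed.

Lemma T01_liftT2 (X : 'rV[R[i]]_n) : T01 I X -> eigi K2 (X *m toC l).
Proof. by move/T01_liftT; rewrite /eigi /= !toC_K liftT_K. Qed.

(** [biv K1 + biv K2 = I^T g], and a Hermitian [g] identifies the covectors of type (1,0) with the
    vectors of type (0,1). *)
Lemma dualT10_biv (z : 'rV[R[i]]_n) :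
  dualT10 I z <-> T01 I (z *m toC (biv K1 + biv K2)).
Proof.
have PE : biv K1 + biv K2 = I^T *m g by rewrite cxI_tr_g g_cxI opprK.
have gC : toC g \in unitmx by rewrite toC_unit.
have gI : g *m I = - (I^T *m g) by rewrite cxI_tr_g opprK.
have II : I^T *m I^T = - 1%:M by rewrite -trmx_mul cxI_sqr linearN /= trmx1.
have RE : z *m toC (biv K1 + biv K2) *m toC I = z *m toC g.
  by rewrite -mulmxA -toCM PE -mulmxA gI mulmxN mulmxA II mulNmx mul1mx opprK.
have LE : z *m toC (biv K1 + biv K2) = z *m (toC I)^T *m toC g.
  by rewrite PE (toCM I^T g) toC_tr mulmxA.
rewrite /dualT10 /T01 /= RE LE; split=> [->|E].
  by rewrite -scalemxAl scalerA mulNr sqr_im opprK scale1r.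
apply: (can_inj (mulmxK gC)); rewrite -scalemxAl E scalerA mulrN sqr_im opprK scale1r //.
Qed.

(* Elements of the two eigenspaces with the same vector part Y, whose
   covector parts differ by 2 i z. *)
Definition lift1 (Y z : 'rV[R[i]]_n) : 'rV[R[i]]_(n + n) :=
  'i%C *: (z *m incT') + z *m toC (incT' *m K1) + (Y - z *m toC (biv K1)) *m toC l.

Definition lift2 (Y z : 'rV[R[i]]_n) := lift1 Y z - (2 * 'i%C) *: (z *m incT').

Lemma lift1_prT Y z : lift1 Y z *m prT = Y.
Proof.
rewrite /lift1 2!mulmxDl -scalemxAl -(mulmxA z incT' prT) incT'_prT mulmx0 scaler0 add0r.
rewrite -{1}toC_prT -[X in X + _]mulmxA -toCM -/(biv K1).
by rewrite -toC_prT -[X in _ + X]mulmxA -toCM liftT_prT toC1 mulmx1 addrC subrK.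
Qed.

Lemma lift2_prT Y z : lift2 Y z *m prT = Y.
Proof. by rewrite mulmxBl lift1_prT -scalemxAl -(mulmxA z incT' prT) incT'_prT mulmx0 scaler0 subr0. Qed.

(** Because [K^2 = -1], the operator [K + i] maps everything into the i-eigenspace; here it is
    applied to a covector. *)
Lemma eigi_incT' K (z : 'rV[R[i]]_n) : orth_cx K ->
  eigi K ('i%C *: (z *m incT') + z *m toC (incT' *m K)).
Proof.
move=> [KK _]; rewrite /eigi /= mulmxDl -scalemxAl toC_K -(mulmxA incT' K K) KK mulmxN mulmx1.
rewrite toCN toC_incT' mulmxN -(mulmxA z incT') -{1}toC_incT' -toCM.
by rewrite scalerDr scalerA sqr_im scaleN1r addrC.
Qed.

Lemma eigiD (K : 'M[R]_(n + n)) u v : eigi K u -> eigi K v -> eigi K (u + v).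
Proof. by rewrite /eigi /= => uK vK; rewrite mulmxDl uK vK scalerDr. Qed.

Lemma eigiN (K : 'M[R]_(n + n)) u : eigi K u -> eigi K (- u).
Proof. by rewrite /eigi /= => uK; rewrite mulNmx uK scalerN. Qed.

Lemma lift1_eigi Y z : T01 I (Y - z *m toC (biv K1)) -> eigi K1 (lift1 Y z).
Proof. by move=> YI; apply: eigiD; [exact: eigi_incT'|exact/T01_liftT]. Qed.

(** [K1 + K2] takes values in the eigenspace of [G] for 1, so its value on a covector is the lift of
    its own projection. This links the standard eigenvectors of [K1] to those of [K2]. *)
Let incT'_K12 : incT' *m (K1 + K2) = (biv K1 + biv K2) *m l.
Proof.
rewrite /biv -mulmxDl -mulmxDr; apply: liftT_uniq; have [E1 _] := o1; have [E2 _] := o2.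
rewrite -mulmxA; congr (_ *m _); rewrite /G mulmxN mulmxDl mulmxA E1 mulNmx mul1mx.
by rewrite K12 mulmxA E2 mulNmx mul1mx -opprD opprK addrC.
Qed.

Lemma lift2_eigi Y z : dualT10 I z -> T01 I (Y - z *m toC (biv K1)) -> eigi K2 (lift2 Y z).
Proof.
move=> zI YI.
have -> : lift2 Y z = - ('i%C *: (z *m incT') + z *m toC (incT' *m K2))
    + (z *m toC (biv K1 + biv K2) + (Y - z *m toC (biv K1))) *m toC l.
  rewrite mulmxDl -(mulmxA z) -toCM -incT'_K12 mulmxDr toCD mulmxDr /lift2 /lift1.
  rewrite mulr_natl mulr2n scalerDl.
  move: ('i%C *: (z *m incT')) (z *m toC (incT' *m K1)) (z *m toC (incT' *m K2)) ((Y - _) *m toC l) => a b c w.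
  by apply/rowP => j; rewrite !mxE; ring.
apply: eigiD; first exact/eigiN/eigi_incT'.
apply: T01_liftT2; apply: T01D => //; exact/dualT10_biv.
Qed.

Lemma half_diff_eigiP Y z : half_diff (eigi K1) (eigi K2) (row_mx Y z) <->
  dualT10 I z /\ T01 I (Y - z *m toC (biv K1)).
Proof.
have rowE (w : 'rV[R[i]]_(n + n)) X : w *m prT = X -> w = row_mx X (rsubmx w).
  by rewrite mul_prT => <-; rewrite hsubmxK.
split=> [/half_diffP[al]|[zI YI]]; last first.
  apply/half_diffP; exists (rsubmx (lift1 Y z)).
    by rewrite -(rowE _ _ (lift1_prT Y z)); exact: lift1_eigi.
  have -> : row_mx Y (rsubmx (lift1 Y z) - (2 * 'i%C) *: z) = lift2 Y z.
    rewrite [RHS](rowE _ _ (lift2_prT Y z)); congr (row_mx _ _).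
    rewrite /lift2; move: (lift1 Y z) => w; rewrite mul_rsub_incT' scale_row_mx.
    by rewrite -{2}(hsubmxK w) opp_row_mx add_row_mx row_mxKr.
  exact: lift2_eigi.
set a := row_mx Y al; set b := row_mx Y _ => a1 b2.
have abE : b = a - (2 * 'i%C) *: (z *m incT').
  by rewrite mul_rsub_incT' scale_row_mx scaler0 opp_row_mx add_row_mx oppr0 addr0.
(* Removing the standard eigenvectors attached to [z] leaves [c] and [b'] in the two eigenspaces,
   with a difference [y] fixed by [G]. It remains to see that [c] itself is fixed by [G]. *)
pose c := a - ('i%C *: (z *m incT') + z *m toC (incT' *m K1)).
pose b' := b + ('i%C *: (z *m incT') + z *m toC (incT' *m K2)).
pose y := z *m toC (biv K1 + biv K2) *m toC l.
have c1 : eigi K1 c by apply: eigiD a1 _; exact/eigiN/eigi_incT'.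
have b'2 : eigi K2 b' by apply: eigiD b2 _; exact: eigi_incT'.
have cb' : b' = c + y.
  rewrite /y -(mulmxA z) -toCM -incT'_K12 mulmxDr toCD mulmxDr /b' /c abE.
  rewrite mulr_natl mulr2n scalerDl; move: (_ *: _) => e.
  move: (z *m toC (_ *m K1)) (z *m toC (_ *m K2)) => p q.
  by apply/rowP => j; rewrite !mxE; ring.
have y12 : y *m toC K2 = y *m toC K1 by rewrite /y !toC_K liftT_K.
have yG : y *m toC G = y by rewrite /y toC_K liftT_G.
have cp : c *m prT = Y - z *m toC (biv K1).
  rewrite mulmxBl mulmxDl mul_prT row_mxKl.
  rewrite -scalemxAl -(mulmxA z incT' prT) incT'_prT mulmx0 scaler0 add0r.
  by rewrite -{1}toC_prT -[X in _ - X]mulmxA -toCM.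
have yE : z *m toC (biv K1 + biv K2) *m toC l = y by [].
clearbody c b' y.
have yK1 : y *m toC K1 *m toC G = y *m toC K1.
  by rewrite -mulmxA -toCM -GK1 toCM mulmxA yG.
have [E2 _] := o2.
(* The defect [d = c K2 - i c] is expressed through [y] alone, so [G] fixes it. It is also an
   eigenvector of [K1] for [i] and of [K2] for [- i], where [G] acts as [-1]; hence [d = 0]. *)
have c2 : c *m toC K2 = 'i%C *: c.
  apply/eqP; rewrite -subr_eq0; set d := _ - _.
  have dE : d = 'i%C *: y - y *m toC K1.
    apply/eqP; rewrite subr_eq addrAC eq_sym subr_eq -scalerDr.
    by rewrite [y + c]addrC -cb' -b'2 cb' mulmxDl y12.
  have dG : d *m toC G = d by rewrite dE mulmxBl -scalemxAl yG yK1.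
  have d1 : d *m toC K1 = 'i%C *: d.
    rewrite /d mulmxBl -scalemxAl -mulmxA -toCM -K12 toCM mulmxA c1 -scalemxAl.
    exact/esym/scalerBr.
  have d2 : d *m toC K2 = - 'i%C *: d.
    rewrite /d mulmxBl -scalemxAl -mulmxA -toCM E2 toCN toC1 mulmxN mulmx1.
    by rewrite scalerBr scalerA mulNr sqr_im opprK scale1r scaleNr addrC.
  move: dG; rewrite /G toCN mulmxN toCM mulmxA d1 -scalemxAl d2 scalerA mulrN sqr_im opprK scale1r.
  by move/eqP; rewrite eq_sym -addr_eq0 -mulr2n -scaler_nat scaler_eq0 pnatr_eq0.
have cG : c *m toC G = c by rewrite /G toCN mulmxN toCM mulmxA c1 -scalemxAl c2 scalerA sqr_im scaleN1r opprK.
have cE : c = (Y - z *m toC (biv K1)) *m toC l.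
  by rewrite {1}(liftT_uniqC cG) cp.
split; last by apply/T01_liftT; rewrite -cE.
have b'G : b' *m toC G = b' by rewrite cb' mulmxDl cG yG.
apply/dualT10_biv/T01_liftT; rewrite yE.
have -> : y = b' + - c by rewrite cb' addrAC subrr add0r.
by apply: eigiD; [rewrite /eigi /= -(eigGC_K b'G)|exact: eigiN].
Qed.

End CommutingPair.

(** * The (2,0)-part of a bivector *)

Section HolomorphicBivector.
Context {R : realType} {n : nat}.
Variables (I P : 'M[R]_n).
Hypotheses (II : I *m I = - 1%:M) (skewP : P^T = - P).

(* The (2,0)-part of the bivector P. *)
Definition cxS : 'M[R[i]]_n := (proj10 I)^T *m toC P *m proj10 I.

Lemma cxS_skew : cxS^T = - cxS.
Proof. by rewrite /cxS !trmx_mul trmxK -toC_tr skewP toCN !mulNmx mulmxN mulmxA. Qed.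

Lemma cxS_proj10 : cxS *m proj10 I = cxS.
Proof. by rewrite /cxS -mulmxA proj10_idem. Qed.

Lemma proj10_cxS : (proj10 I)^T *m cxS = cxS.
Proof. by rewrite /cxS !mulmxA -trmx_mul proj10_idem. Qed.

Lemma T10_cxS (z : 'rV[R[i]]_n) : T10 I (z *m cxS).
Proof. by rewrite -cxS_proj10 mulmxA; exact: T10_mul_proj10. Qed.

Lemma cxS_T01 (z : 'rV[R[i]]_n) : dualT10 I z -> T01 I (z *m toC P - z *m cxS).
Proof.
move=> /dualT10_proj10 zI; rewrite /cxS !mulmxA zI; exact: T01_sub_proj10.
Qed.

(** On covectors of type (1,0), [P] and its (2,0)-part differ by a vector of type (0,1), which
    [L_sigma] absorbs. *)
Lemma L_sigmaP (L : set 'rV[R[i]]_(n + n)) :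
  (forall Y z, L (row_mx Y z) <-> dualT10 I z /\ T01 I (Y - z *m toC P)) ->
  L = L_sigma I cxS.
Proof.
move=> LP; apply/seteqP; split=> u.
  rewrite -(hsubmxK u) => /LP[zI YI].
  exists (lsubmx u - rsubmx u *m cxS), (rsubmx u).
  split; [|exact: zI|by rewrite subrK hsubmxK].
  by have := T01D YI (cxS_T01 zI); rewrite addrA subrK.
case=> X [z [XI zI ->]]; apply/LP; split=> //.
rewrite -addrA; apply: T01D => //; rewrite -opprB; apply: T01N; exact: cxS_T01.
Qed.

End HolomorphicBivector.

(** * Fibrewise consequences of a generalized Kaehler pair *)

Section Fibre.
Context {R : realType} {n : nat}.
Implicit Types J : 'M[R]_(n + n).

(** [zJ + i z] and [zJ - i z] lie in the eigenspaces for [i] and [- i], have the same projection,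
    and differ by [2 i z]. Any other such pair differs from this one by a single vector common to
    both eigenspaces, which is zero. *)
Lemma half_diff_conjP J (Y z : 'rV[R[i]]_n) : orth_cx J ->
  half_diff (eigi J) (conj_set (eigi J)) (row_mx Y z) <-> Y = z *m toC (biv J).
Proof.
move=> oJ; have [JJ _] := oJ.
have E1 := eigi_incT' z oJ.
have E2 : eigi (- J) (z *m toC (incT' *m J) - 'i%C *: (z *m incT')).
  have := eigiN (eigi_incT' z (orth_cxN oJ)).
  by rewrite opprD mulmxN toCN mulmxN opprK addrC.
have pE : (z *m toC (incT' *m J)) *m prT = z *m toC (biv J).
  by rewrite -toC_prT -mulmxA -toCM.
have oE : (z *m incT') *m prT = 0 by rewrite -mulmxA incT'_prT mulmx0.
rewrite conj_set_eigi; split=> [/half_diffP[al a1 a2]|->]; last first.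
  set w := 'i%C *: (z *m incT') + z *m toC (incT' *m J).
  have wE : row_mx (z *m toC (biv J)) (rsubmx w) = w.
    by rewrite -pE -[RHS]hsubmxK -[lsubmx w]mul_prT /w mulmxDl -scalemxAl oE scaler0 add0r.
  apply/half_diffP; exists (rsubmx w); first by rewrite wE.
  have -> : row_mx (z *m toC (biv J)) (rsubmx w - (2 * 'i%C) *: z) = w - (2 * 'i%C) *: (z *m incT').
    by rewrite -{2}wE mul_rsub_incT' scale_row_mx opp_row_mx add_row_mx scaler0 oppr0 addr0.
  move: E2; congr (eigi _ _); rewrite /w mulr_natl mulr2n scalerDl.
  move: ('i%C *: (z *m incT')) (z *m toC (incT' *m J)) => c e.
  by apply/rowP => j; rewrite !mxE; ring.
pose v := row_mx Y al - ('i%C *: (z *m incT') + z *m toC (incT' *m J)).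
have v1 : eigi J v by apply: eigiD a1 (eigiN E1).
have v2 : eigi (- J) v.
  have -> : v = row_mx Y (al - (2 * 'i%C) *: z) + - (z *m toC (incT' *m J) - 'i%C *: (z *m incT')).
    have -> : row_mx Y (al - (2 * 'i%C) *: z) = row_mx Y al - (2 * 'i%C) *: (z *m incT').
      by rewrite mul_rsub_incT' scale_row_mx scaler0 opp_row_mx add_row_mx oppr0 addr0.
    rewrite /v mulr_natl mulr2n scalerDl.
    move: ('i%C *: (z *m incT')) (z *m toC (incT' *m J)) => a b.
    by apply/rowP => j; rewrite !mxE; ring.
  exact: eigiD a2 (eigiN E2).
have v0 : v = 0 by apply: (eigi_disj v1); have : conj_set (eigi J) v by rewrite conj_set_eigi.
have : v *m prT = 0 by rewrite v0 mul0mx.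
rewrite mulmxBl mulmxDl -scalemxAl oE scaler0 add0r pE mul_prT row_mxKl => /eqP.
by rewrite subr_eq0 => /eqP.
Qed.

Lemma real_half_diff J : orth_cx J ->
  real_set (half_diff (eigi J) (conj_set (eigi J))) = graph (biv J).
Proof.
move=> oJ; apply/seteqP; split=> u; rewrite /real_set /=.
  rewrite -{1}(hsubmxK u) toC_row => /(half_diff_conjP _ _ oJ); rewrite -toCM => /toC_inj E.
  by exists (rsubmx u); rewrite -E hsubmxK.
by case=> xi ->; rewrite toC_row; apply/(half_diff_conjP _ _ oJ); rewrite toCM.
Qed.

Lemma capT_graph (P : 'M[R]_n) : capT (graph P) = [set 0].
Proof.
apply/seteqP; split=> X /=; first by case=> xi /eq_row_mx[-> <-]; rewrite mul0mx.
by move=> ->; exists 0; rewrite mul0mx.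
Qed.

Lemma sum_full_projT J : orth_cx J ->
  sum_full (projT (eigi J)) (projT (conj_set (eigi J))).
Proof.
move=> [JJ _] Z; pose u := Z *m incT; pose v := u *m toC J.
have vJ : v *m toC J = - u by rewrite /v -mulmxA -toCM JJ toCN toC1 mulmxN mulmx1.
pose a := 2^-1 *: (u - 'i%C *: v); pose b := 2^-1 *: (u + 'i%C *: v).
have aJ : eigi J a.
  rewrite /eigi /= /a -scalemxAl mulmxBl -scalemxAl vJ -/v scalerN opprK.
  by rewrite [RHS]scalerA mulrC -scalerA scalerBr scalerA sqr_im scaleN1r opprK addrC.
have bJ : eigi (- J) b.
  rewrite /eigi /= toCN mulmxN /b -scalemxAl mulmxDl -scalemxAl vJ -/v scalerN.
  rewrite [RHS]scalerA mulrC -scalerA -[LHS]scalerN; congr (_ *: _).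
  by rewrite opprB scalerDr scalerA sqr_im scaleN1r.
exists (lsubmx a), (lsubmx b); split.
- by exists (rsubmx a); rewrite hsubmxK.
- by exists (rsubmx b); rewrite hsubmxK conj_set_eigi.
rewrite -linearD /= /a /b -scalerDr addrACA addNr addr0 two_half.
by rewrite /u mul_lsub_incT row_mxKl.
Qed.

Section Positive.
Variables J1 J2 : 'M[R]_(n + n).
Hypotheses (o1 : orth_cx J1) (o2 : orth_cx J2).
Let G := - (J1 *m J2).
Hypothesis pos : forall u, u != 0 -> 0 < pairing (u *m G) u.

(** A covector [v] with [v g = 0] is sent by [G] to a covector, so [<vG, v> = 0], against
    positivity. *)
Lemma biv_unit : biv G \in unitmx.
Proof.
rewrite -row_free_unit; apply: inj_row_free => v vg; apply/eqP; apply/negPn/negP => v0.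
have : v *m incT' != 0.
  by apply: contra v0 => /eqP/(congr1 rsubmx); rewrite mul_rsub_incT' row_mxKr linear0 => ->.
move/pos; rewrite pairingC mul_rsub_incT' pairing_incT' -mul_rsub_incT' -mul_prT.
by move: vg; rewrite /biv !mulmxA => ->; rewrite trmx0 mulmx0 mxE mulr0 ltxx.
Qed.

(** Here [G] fixes [u] and, being real, also its real and imaginary parts [a] and [b]; thus
    [<u, conj u> = <aG, a> + <bG, b>]. *)
Lemma pairing_conj_pos (u : 'rV[R[i]]_(n + n)) : eigi J1 u -> eigi J2 u -> u != 0 ->
  0 < pairing u (conj_mx u).
Proof.
move=> u1 u2 u0.
have uG : u *m toC G = u.
  by rewrite /G toCN mulmxN toCM mulmxA u1 -scalemxAl u2 scalerA sqr_im scaleN1r opprK.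
move: uG u0; rewrite conj_Remx_Immx {1 2 3 4}[u]Remx_Immx.
set a := Remx u; set b := Immx u; rewrite mulmxDl -scalemxAl -!toCM => /toC_im_inj[aG bG] u0.
rewrite !(pairingDl, pairingZl) -scalerN !(pairingDr, pairingZr) -toCN !toC_pairing pairingNr.
have pos0 w : w *m G = w -> 0 <= pairing w w.
  move=> wG; have [->|w0] := eqVneq w 0; first by rewrite pairing0l.
  by rewrite -{1}wG ltW // pos.
have pos1 w : w *m G = w -> w != 0 -> 0 < pairing w w.
  by move=> wG w0; rewrite -{1}wG pos.
rewrite pairingNr (pairingC b a); set p := pairing a a; set q := pairing b b; set r := pairing a b.
have -> : (p%:C + 'i%C * (- r)%:C + 'i%C * ((r)%:C + 'i%C * (- q)%:C) = (p + q)%:C)%C.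
  by apply/eqP; rewrite eq_complex /=; apply/andP; split; apply/eqP; ring.
rewrite ltcR; have [a0|a0] := eqVneq a 0; last by rewrite ltr_wpDr ?pos0 // pos1.
rewrite ltr_wpDl ?pos0 // pos1 //; apply: contra u0 => /eqP b0.
by rewrite a0 b0 toC0 scaler0 addr0.
Qed.

End Positive.

End Fibre.

(** * The Courant bracket and the Jacobiator in one chart *)

Section LocalCourant.
Context {R : realType} {n : nat}.
Variable V : set 'rV[R]_n.
Hypothesis oV : open V.
Variable x : 'rV[R]_n.
Hypothesis Vx : V x.
Variable H : 'rV[R]_n -> 'I_n -> 'I_n -> 'I_n -> R.

Lemma jacmx_eq p (X Y : 'rV[R]_n -> 'rV[R[i]]_p) : {in V, X =1 Y} -> jacmx X x = jacmx Y x.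
Proof.
move=> XY; apply/matrixP => i j; rewrite !mxE; apply: (cpd_eq oV Vx) => y Vy.
by rewrite XY.
Qed.

Lemma jacmx_rows p (A B : 'M[R[i]]_(n, p)) :
  (forall v : 'rV_n, v *m A = v *m B) -> A = B.
Proof. by move=> AB; apply/row_matrixP => i; rewrite !rowE. Qed.

Lemma jacmx_cst p (a : 'rV[R[i]]_p) : jacmx (fun=> a) x = 0.
Proof. by apply: jacmx_rows => v; rewrite mul_jacmx dmx_cst mulmx0. Qed.

Lemma dmxD m p v (F G : 'rV[R]_n -> 'M[R[i]]_(m, p)) :
  cmx_smooth_on V F -> cmx_smooth_on V G ->
  dmx v (fun y => F y + G y) x = dmx v F x + dmx v G x.
Proof.
move=> sF sG; apply/matrixP => i j; rewrite !mxE -big_split /=; apply: eq_bigr => k _.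
rewrite -mulrDr -(cpdD Vx); [|exact: sF|exact: sG].
by congr (_ * _); apply: (cpd_eq oV Vx) => y _; rewrite mxE.
Qed.

Lemma jacmxD p (X Y : 'rV[R]_n -> 'rV[R[i]]_p) :
  cmx_smooth_on V X -> cmx_smooth_on V Y ->
  jacmx (fun y => X y + Y y) x = jacmx X x + jacmx Y x.
Proof.
by move=> sX sY; apply: jacmx_rows => v; rewrite mulmxDr !mul_jacmx dmxD.
Qed.

Lemma dmxZ m p v a (F : 'rV[R]_n -> 'M[R[i]]_(m, p)) : cmx_smooth_on V F ->
  dmx v (fun y => a *: F y) x = a *: dmx v F x.
Proof.
move=> sF; have -> : (fun y => a *: F y) = (fun y => a%:M *m F y).
  by apply/funext => y; rewrite mul_scalar_mx.
rewrite (dmxM oV Vx) //; last exact: cmx_smooth_on_cst.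
by rewrite dmx_cst mul0mx add0r mul_scalar_mx.
Qed.

Lemma jacmxZ p a (X : 'rV[R]_n -> 'rV[R[i]]_p) : cmx_smooth_on V X ->
  jacmx (fun y => a *: X y) x = a *: jacmx X x.
Proof. by move=> sX; apply: jacmx_rows => v; rewrite -scalemxAr !mul_jacmx dmxZ. Qed.

Lemma jacmx_conj p (X : 'rV[R]_n -> 'rV[R[i]]_p) : cmx_smooth_on V X ->
  jacmx (fun y => conj_mx (X y)) x = conj_mx (jacmx X x).
Proof.
move=> sX; apply: jacmx_rows => v; rewrite mul_jacmx -{1}(conj_mxK v).
by rewrite (dmx_conj oV Vx) // -mul_jacmx conj_mxM conj_mxK.
Qed.

Definition contract_H (X Y : 'rV[R[i]]_n) : 'rV[R[i]]_n :=
  \row_k \sum_i \sum_j (H x i j k)%:C%C * X 0 i * Y 0 j.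

Lemma conj_contract_H X Y : contract_H (conj_mx X) (conj_mx Y) = conj_mx (contract_H X Y).
Proof.
apply/rowP => k; rewrite !mxE rmorph_sum; apply: eq_bigr => i _.
rewrite rmorph_sum; apply: eq_bigr => j _.
by rewrite !mxE !rmorphM; congr (_ * _ * _); rewrite -[RHS]/(conjc _) conjc_real.
Qed.

Lemma courantE (s t : 'rV[R]_n -> 'rV[R[i]]_(n + n)) :
  let X := fun y => lsubmx (s y) in let xi := fun y => rsubmx (s y) in
  let Y := fun y => lsubmx (t y) in let eta := fun y => rsubmx (t y) in
  courant H s t x = row_mx (X x *m jacmx Y x - Y x *m jacmx X x)
    (X x *m jacmx eta x + eta x *m (jacmx X x)^T
     - (Y x *m jacmx xi x - Y x *m (jacmx xi x)^T) + contract_H (X x) (Y x)).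
Proof. by rewrite /courant lie_bracketE lie_formE contract_dE. Qed.

Lemma courant_row (s t : 'rV[R]_n -> 'rV[R[i]]_(n + n)) (X xi Y eta : 'rV[R]_n -> 'rV[R[i]]_n) :
  {in V, forall y, s y = row_mx (X y) (xi y)} -> {in V, forall y, t y = row_mx (Y y) (eta y)} ->
  courant H s t x = row_mx (X x *m jacmx Y x - Y x *m jacmx X x)
    (X x *m jacmx eta x + eta x *m (jacmx X x)^T
     - (Y x *m jacmx xi x - Y x *m (jacmx xi x)^T) + contract_H (X x) (Y x)).
Proof.
move=> sE tE; have inV : x \in V by rewrite inE.
rewrite courantE (sE _ inV) (tE _ inV) !row_mxKl !row_mxKr.
have -> : jacmx (fun y => lsubmx (s y)) x = jacmx X x.
  by apply: jacmx_eq => y /sE ->; rewrite row_mxKl.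
have -> : jacmx (fun y => rsubmx (s y)) x = jacmx xi x.
  by apply: jacmx_eq => y /sE ->; rewrite row_mxKr.
have -> : jacmx (fun y => lsubmx (t y)) x = jacmx Y x.
  by apply: jacmx_eq => y /tE ->; rewrite row_mxKl.
have -> // : jacmx (fun y => rsubmx (t y)) x = jacmx eta x.
by apply: jacmx_eq => y /tE ->; rewrite row_mxKr.
Qed.

(** The coefficients of [H] are real. Through this the conjugate of an involutive bundle is
    involutive. *)
Lemma courant_conj (s t : 'rV[R]_n -> 'rV[R[i]]_(n + n)) :
  cmx_smooth_on V s -> cmx_smooth_on V t ->
  courant H (fun y => conj_mx (s y)) (fun y => conj_mx (t y)) x = conj_mx (courant H s t x).
Proof.
move=> ss st; rewrite !courantE.
have lE (u : 'rV[R]_n -> 'rV[R[i]]_(n + n)) :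
    (fun y => lsubmx (conj_mx (u y))) = (fun y => conj_mx (lsubmx (u y))).
  by apply/funext => y; apply/rowP => j; rewrite !mxE.
have rE (u : 'rV[R]_n -> 'rV[R[i]]_(n + n)) :
    (fun y => rsubmx (conj_mx (u y))) = (fun y => conj_mx (rsubmx (u y))).
  by apply/funext => y; apply/rowP => j; rewrite !mxE.
have lx (u : 'rV[R]_n -> 'rV[R[i]]_(n + n)) : lsubmx (conj_mx (u x)) = conj_mx (lsubmx (u x)).
  by have /(congr1 (fun f => f x)) := lE u.
have rx (u : 'rV[R]_n -> 'rV[R[i]]_(n + n)) : rsubmx (conj_mx (u x)) = conj_mx (rsubmx (u x)).
  by have /(congr1 (fun f => f x)) := rE u.
rewrite !lE !rE !lx !rx !jacmx_conj; try solve [exact: cmx_smooth_on_lsub|exact: cmx_smooth_on_rsub].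
by rewrite conj_contract_H conj_mx_row !(conj_mxD, conj_mxN, conj_mxM, conj_mx_tr).
Qed.

(* Twisting by H cancels in the difference of the two covector parts. *)
Lemma half_diff_courant (D1 D2 : set 'rV[R[i]]_(n + n))
    (s t : 'rV[R]_n -> 'rV[R[i]]_(n + n)) (X Y z w : 'rV[R]_n -> 'rV[R[i]]_n) :
  cmx_smooth_on V s -> cmx_smooth_on V t -> cmx_smooth_on V z -> cmx_smooth_on V w ->
  {in V, forall y, lsubmx (s y) = X y} -> {in V, forall y, lsubmx (t y) = Y y} ->
  D1 (courant H s t x) ->
  D2 (courant H (fun y => s y - (2 * 'i%C) *: (z y *m incT'))
                (fun y => t y - (2 * 'i%C) *: (w y *m incT')) x) ->
  half_diff D1 D2 (row_mx (X x *m jacmx Y x - Y x *m jacmx X x)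
    (X x *m jacmx w x + w x *m (jacmx X x)^T - (Y x *m jacmx z x - Y x *m (jacmx z x)^T))).
Proof.
move=> ss st sz sw sX tY d1 d2; apply/half_diffP.
have rowE (u : 'rV[R]_n -> 'rV[R[i]]_(n + n)) (U : 'rV[R]_n -> 'rV[R[i]]_n) :
    {in V, forall y, lsubmx (u y) = U y} -> {in V, forall y, u y = row_mx (U y) (rsubmx (u y))}.
  by move=> uU y /uU <-; rewrite hsubmxK.
have rowE2 (u : 'rV[R]_n -> 'rV[R[i]]_(n + n)) (U v : 'rV[R]_n -> 'rV[R[i]]_n) :
    {in V, forall y, lsubmx (u y) = U y} -> {in V, forall y,
      u y - (2 * 'i%C) *: (v y *m incT') = row_mx (U y) (rsubmx (u y) + (- (2 * 'i%C)) *: v y)}.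
  move=> uU y yV; rewrite {1}(rowE u U uU y yV) mul_rsub_incT' scale_row_mx opp_row_mx.
  by rewrite add_row_mx scaler0 oppr0 addr0 scaleNr.
have sr (u : 'rV[R]_n -> 'rV[R[i]]_(n + n)) : cmx_smooth_on V u ->
    cmx_smooth_on V (fun y => rsubmx (u y)) by move=> su; exact: cmx_smooth_on_rsub.
rewrite (courant_row (rowE s X sX) (rowE t Y tY)) in d1.
rewrite (courant_row (rowE2 s X z sX) (rowE2 t Y w tY)) in d2.
have jD (u : 'rV[R]_n -> 'rV[R[i]]_(n + n)) (v : 'rV[R]_n -> 'rV[R[i]]_n) :
    cmx_smooth_on V u -> cmx_smooth_on V v ->
    jacmx (fun y => rsubmx (u y) + (- (2 * 'i%C)) *: v y) x =
    jacmx (fun y => rsubmx (u y)) x + (- (2 * 'i%C)) *: jacmx v x.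
  by move=> su sv; rewrite (jacmxD (sr _ su)) ?jacmxZ //; exact: cmx_smooth_onZ.
rewrite (jD s z ss sz) (jD t w st sw) in d2; eexists; first exact: d1.
move: d2; congr (D2 (row_mx _ _)).
rewrite [(_ + _)^T]linearD /= [((- _) *: _)^T]linearZ /= !mulmxDr mulmxDl -!scalemxAr -!scalemxAl.
move: (X x *m jacmx w x) (w x *m _) (Y x *m jacmx z x) (Y x *m (jacmx z x)^T) => a1 a2 a3 a4.
move: (X x *m _) (rsubmx (t x) *m _) (Y x *m jacmx _ x) (Y x *m (jacmx _ x)^T) => b1 b2 b3 b4.
by move: (contract_H _ _) => h; apply/rowP => k; rewrite !mxE; ring.
Qed.

(* The Jacobiator of P contracted with three constant covectors. *)
Definition jac3 (P : 'rV[R]_n -> 'M[R[i]]_n) (a b c : 'rV[R[i]]_n) : 'M[R[i]]_1 :=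
  b *m dmx (a *m P x) P x *m c^T + c *m dmx (b *m P x) P x *m a^T
  + a *m dmx (c *m P x) P x *m b^T.

Lemma jacobi_jac3 P : (forall a b c, jac3 P a b c = 0) -> jacobi cpd P x.
Proof.
move=> P0 i j k.
have E (F : 'M[R[i]]_n) p q : ((delta_mx 0 p : 'rV_n) *m F *m (delta_mx 0 q : 'rV_n)^T) 0 0 = F p q.
  by rewrite trmx_delta -colE -rowE !mxE.
transitivity (jac3 P (delta_mx 0 i) (delta_mx 0 j) (delta_mx 0 k) 0 0); last first.
  by rewrite P0 mxE.
rewrite /jac3 2!(mxE _ (fun i j => _ + _)) !E !big_split /= -!rowE; congr (_ + _ + _);
  by rewrite mxE; apply: eq_bigr => l _; rewrite !mxE.
Qed.

(** The Jacobiator as the failure of [[P a, P b] = P d(P(a, b))], evaluated on [c]: for constant [a]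
    and [b], the row [b *m (jacmx X x)^T] is the differential of the function [P(a, b)]. *)
Lemma jac3E P (a b c : 'rV[R[i]]_n) : cmx_smooth_on V P -> {in V, forall y, (P y)^T = - P y} ->
  let X := fun y => a *m P y in let Y := fun y => b *m P y in
  jac3 P a b c = (X x *m jacmx Y x - Y x *m jacmx X x) *m c^T - b *m (jacmx X x)^T *m P x *m c^T.
Proof.
move=> sP skP X Y; have inV : x \in V by rewrite inE.
have dX v (d : 'rV[R[i]]_n) : v *m jacmx (fun y => d *m P y) x = d *m dmx v P x.
  rewrite mul_jacmx (dmxM oV Vx) //; last exact: cmx_smooth_on_cst.
  by rewrite dmx_cst mul0mx add0r.
have dsk v : (dmx v P x)^T = - dmx v P x.
  by rewrite -(dmxN oV Vx) // -(dmx_tr oV Vx); apply: (dmx_eq oV Vx) => y Vy; rewrite skP.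
have tr1 (A : 'M[R[i]]_1) : A^T = A by rewrite [A]mx11_scalar tr_scalar_mx.
rewrite mulmxBl /jac3 -[LHS]addrA -[RHS]addrA; congr (_ + _); first by rewrite dX.
congr (_ + _).
  by rewrite -[LHS]tr1 !trmx_mul trmxK dsk mulNmx mulmxN dX mulmxA.
by rewrite -[RHS]tr1 linearN /= !trmx_mul !trmxK (skP _ inV) mulNmx mulmxN opprK !mulmxA dX.
Qed.

End LocalCourant.

(** * Involutivity of the half differences in one chart *)

Section LocalPair.
Context {R : realType} {n : nat}.
Variable V : set 'rV[R]_n.
Hypothesis oV : open V.
Variable H : 'rV[R]_n -> 'I_n -> 'I_n -> 'I_n -> R.

Definition involutive_on (D : 'rV[R]_n -> set 'rV[R[i]]_(n + n)) : Prop :=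
  forall s t, local_section D V s -> local_section D V t ->
  forall x, V x -> D x (courant H s t x).

Lemma mx_smooth_on_biv (K : 'rV[R]_n -> 'M[R]_(n + n)) : mx_smooth_on V K ->
  mx_smooth_on V (fun y => biv (K y)).
Proof.
by move=> sK; do 2?[apply: mx_smooth_onM => //]; exact: mx_smooth_on_cst.
Qed.

Lemma cmx_smooth_on_proj10 (I : 'rV[R]_n -> 'M[R]_n) : mx_smooth_on V I ->
  cmx_smooth_on V (fun y => proj10 (I y)).
Proof.
move=> sI; apply: cmx_smooth_onZ => //; apply: cmx_smooth_onD => //.
  exact: cmx_smooth_on_cst.
by apply: cmx_smooth_onN => //; apply: cmx_smooth_onZ => //; exact: cmx_smooth_on_toC.
Qed.

Section RealPoisson.
Variable J : 'rV[R]_n -> 'M[R]_(n + n).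
Hypothesis sJ : mx_smooth_on V J.
Hypothesis oJ : forall y, V y -> orth_cx (J y).
Hypothesis iJ : involutive_on (fun y => eigi (J y)).
Hypothesis iNJ : involutive_on (fun y => eigi (- J y)).

(** A constant covector [a] gives the section [(aP, a)] of the graph of [P]. Involutivity identifies
    the Lie bracket of [aP] and [bP] with the image under [P] of [d(P(a, b))], so the expression in
    [jac3E] vanishes. *)
Lemma biv_jacobi x : V x -> jacobi pd (fun y => biv (J y)) x.
Proof.
move=> Vx.
have sP : cmx_smooth_on V (fun y => toC (biv (J y))).
  by apply: cmx_smooth_on_toC => //; exact: mx_smooth_on_biv.
suff jC : jacobi cpd (fun y => toC (biv (J y))) x.
  move=> i j k; apply: (@complexI R); rewrite rmorph_sum -[RHS](jC i j k).
  apply: eq_bigr => l _; rewrite !rmorphD !rmorphM /=.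
  have F p q : toC (biv (J x)) p q = (biv (J x) p q)%:C%C by rewrite [LHS]mxE.
  have E p q : (pd l (fun y => biv (J y) p q) x)%:C%C = cpd l (fun y => toC (biv (J y)) p q) x.
    by rewrite -cpd_real; apply: (cpd_eq oV Vx) => y _; rewrite [RHS]mxE.
  by rewrite !E !F.
apply: jacobi_jac3 => a b c.
rewrite (jac3E oV Vx) //; last first.
  move=> y; rewrite inE => Vy; rewrite -toC_tr biv_skew ?toCN //; exact: oJ.
set X := fun y => a *m _; set Y := fun y => b *m _.
have cst m p (A : 'M[R[i]]_(m, p)) := @cmx_smooth_on_cst R n V oV m p A.
pose sec (d : 'rV[R[i]]_n) y := 'i%C *: (d *m incT') + d *m toC (incT' *m J y).
have ssec d : cmx_smooth_on V (sec d).
  apply: cmx_smooth_onD => //; apply: cmx_smooth_onM => //.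
  by apply: cmx_smooth_on_toC => //; apply: mx_smooth_onM => //; exact: mx_smooth_on_cst.
have psec d : {in V, forall y, lsubmx (sec d y) = d *m toC (biv (J y))}.
  move=> y _; rewrite -mul_prT mulmxDl -scalemxAl -(mulmxA d incT') incT'_prT mulmx0 scaler0 add0r.
  by rewrite -{1}toC_prT -mulmxA -toCM.
have sec1 d : local_section (fun y => eigi (J y)) V (sec d).
  by split=> // y /oJ ?; exact: eigi_incT'.
have sec2 d : local_section (fun y => eigi (- J y)) V
    (fun y => sec d y - (2 * 'i%C) *: (d *m incT')).
  split=> [|y /oJ/orth_cxN oN]; first by apply: cmx_smooth_onD => //; exact: cst.
  have := eigiN (eigi_incT' d oN); congr (eigi _ _).
  rewrite /sec mulmxN toCN mulmxN mulr_natl mulr2n scalerDl.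
  move: ('i%C *: (d *m incT')) (d *m toC (incT' *m J y)) => e f.
  by apply/rowP => j; rewrite !mxE; ring.
have := half_diff_courant oV Vx (ssec a) (ssec b) (cst _ _ a) (cst _ _ b) (psec a) (psec b)
  (iJ (sec1 a) (sec1 b) Vx) (iNJ (sec2 a) (sec2 b) Vx).
rewrite -conj_set_eigi => /(half_diff_conjP _ _ (oJ Vx)).
rewrite !jacmx_cst !mulmx0 trmx0 mulmx0 subr0 subr0 add0r => ->.
by rewrite subrr.
Qed.

End RealPoisson.

Variables K1 K2 : 'rV[R]_n -> 'M[R]_(n + n).
Hypotheses (sK1 : mx_smooth_on V K1) (sK2 : mx_smooth_on V K2).
Hypothesis oK1 : forall y, V y -> orth_cx (K1 y).
Hypothesis oK2 : forall y, V y -> orth_cx (K2 y).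
Hypothesis K12 : forall y, V y -> K1 y *m K2 y = K2 y *m K1 y.
Hypothesis gu : forall y, V y -> biv (- (K1 y *m K2 y)) \in unitmx.
Hypothesis inv1 : involutive_on (fun y => eigi (K1 y)).
Hypothesis inv2 : involutive_on (fun y => eigi (K2 y)).

Let I y := cxI (K1 y) (K2 y).
Let S y := cxS (I y) (biv (K1 y)).

Lemma mx_smooth_on_cxI : mx_smooth_on V I.
Proof.
apply: mx_smooth_onN => //; apply: mx_smooth_onM => //; last first.
  by apply: mx_smooth_onD => //; exact: mx_smooth_on_biv.
apply: mx_smooth_on_inv => //; apply: mx_smooth_on_biv.
by apply: mx_smooth_onN => //; exact: mx_smooth_onM.
Qed.

Lemma mx_smooth_on_liftT : mx_smooth_on V (fun y => liftT (K1 y) (K2 y)).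
Proof.
have sG : mx_smooth_on V (fun y => - (K1 y *m K2 y)).
  by apply: mx_smooth_onN => //; exact: mx_smooth_onM.
apply: mx_smooth_onM => //; last by apply: mx_smooth_onD => //; exact: mx_smooth_on_cst.
apply: mx_smooth_onM => //; last exact: mx_smooth_on_cst.
by apply: mx_smooth_on_inv => //; exact: mx_smooth_on_biv.
Qed.

Lemma cmx_smooth_on_cxS : cmx_smooth_on V S.
Proof.
have sP := cmx_smooth_on_proj10 mx_smooth_on_cxI.
apply: cmx_smooth_onM => //; apply: cmx_smooth_onM => //; first exact: cmx_smooth_on_tr.
by apply: cmx_smooth_on_toC => //; exact: mx_smooth_on_biv.
Qed.

Let II y : V y -> I y *m I y = - 1%:M.
Proof. by move=> Vy; exact: (cxI_sqr (oK1 Vy) (oK2 Vy) (K12 Vy) (gu Vy)). Qed.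

Section AtPoint.
Variable x : 'rV[R]_n.
Hypothesis Vx : V x.

Let sl : cmx_smooth_on V (fun y => toC (liftT (K1 y) (K2 y))).
Proof. by apply: cmx_smooth_on_toC => //; exact: mx_smooth_on_liftT. Qed.

(** Fields of type (0,1) lift to sections of both eigenbundles. The Courant bracket of two lifts
    lies in both again, hence is the lift of its tangent part, which is the Lie bracket. *)
Lemma T01_involutive (X Y : 'rV[R]_n -> 'rV[R[i]]_n) :
  local_section (fun y => T01 (I y)) V X -> local_section (fun y => T01 (I y)) V Y ->
  T01 (I x) (X x *m jacmx Y x - Y x *m jacmx X x).
Proof.
move=> [sX XI] [sY YI].
pose lf (Z : 'rV[R]_n -> 'rV[R[i]]_n) y := Z y *m toC (liftT (K1 y) (K2 y)).
have slf Z : cmx_smooth_on V Z -> cmx_smooth_on V (lf Z) by move=> sZ; exact: cmx_smooth_onM.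
have lf1 Z : (forall y, V y -> T01 (I y) (Z y)) -> forall y, V y -> eigi (K1 y) (lf Z y).
  by move=> ZI y Vy; apply/(T01_liftT (oK1 Vy) (oK2 Vy) (K12 Vy) (gu Vy)); exact: ZI.
have lf2 Z : (forall y, V y -> T01 (I y) (Z y)) -> forall y, V y -> eigi (K2 y) (lf Z y).
  by move=> ZI y Vy; apply: (T01_liftT2 (oK1 Vy) (oK2 Vy) (K12 Vy) (gu Vy)); exact: ZI.
have lfp Z : {in V, (fun y => lsubmx (lf Z y)) =1 Z}.
  move=> y; rewrite inE => Vy; rewrite -mul_prT /lf -mulmxA -toC_prT -toCM.
  by rewrite (liftT_prT (gu Vy)) toC1 mulmx1.
have c1 := inv1 (conj (slf _ sX) (lf1 _ XI)) (conj (slf _ sY) (lf1 _ YI)) Vx.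
have c2 := inv2 (conj (slf _ sX) (lf2 _ XI)) (conj (slf _ sY) (lf2 _ YI)) Vx.
move: c1 c2; set w := courant _ _ _ _ => c1 c2.
have wG : w *m toC (- (K1 x *m K2 x)) = w.
  by rewrite toCN mulmxN toCM mulmxA c1 -scalemxAl c2 scalerA sqr_im scaleN1r opprK.
have inV : x \in V by rewrite inE.
have <- : w *m prT = X x *m jacmx Y x - Y x *m jacmx X x.
  rewrite /w courantE mul_prT row_mxKl.
  by rewrite (jacmx_eq oV Vx (lfp X)) (jacmx_eq oV Vx (lfp Y)) (lfp X _ inV) (lfp Y _ inV).
apply/(T01_liftT (oK1 Vx) (oK2 Vx) (K12 Vx) (gu Vx)).
by rewrite -(liftT_uniqC (oK1 Vx) (oK2 Vx) (K12 Vx) (gu Vx) wG).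
Qed.

(* The sections (Y, z) are those of the half difference of the eigenbundles. *)
Lemma half_diff_involutive (Y z Y' z' : 'rV[R]_n -> 'rV[R[i]]_n) :
  cmx_smooth_on V Y -> cmx_smooth_on V z -> cmx_smooth_on V Y' -> cmx_smooth_on V z' ->
  (forall y, V y -> dualT10 (I y) (z y) /\ T01 (I y) (Y y - z y *m S y)) ->
  (forall y, V y -> dualT10 (I y) (z' y) /\ T01 (I y) (Y' y - z' y *m S y)) ->
  let theta := Y x *m jacmx z' x + z' x *m (jacmx Y x)^T
               - (Y' x *m jacmx z x - Y' x *m (jacmx z x)^T) in
  dualT10 (I x) theta /\ T01 (I x) (Y x *m jacmx Y' x - Y' x *m jacmx Y x - theta *m S x).
Proof.
move=> sY sz sY' sz' YzS YzS' theta.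
(* On covectors of type (1,0), [S] and [biv (K1 y)] agree up to type (0,1), so the two membership
   conditions are interchangeable. *)
have conv (A b : 'rV[R]_n -> 'rV[R[i]]_n) :
    (forall y, V y -> dualT10 (I y) (b y) /\ T01 (I y) (A y - b y *m S y)) ->
    forall y, V y -> dualT10 (I y) (b y) /\ T01 (I y) (A y - b y *m toC (biv (K1 y))).
  move=> Ab y Vy; have [b10 A01] := Ab y Vy; split; first exact: b10.
  have := T01D A01 (T01N (cxS_T01 (biv (K1 y)) (II Vy) b10)); rewrite -/(S y).
  by move: (b y *m S y) (b y *m toC _) => e f; rewrite opprB addrA subrK.
have Yz := conv _ _ YzS; have Yz' := conv _ _ YzS'.
pose s1 (Y z : 'rV[R]_n -> 'rV[R[i]]_n) y := lift1 (K1 y) (K2 y) (Y y) (z y).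
have ss1 A b : cmx_smooth_on V A -> cmx_smooth_on V b -> cmx_smooth_on V (s1 A b).
  move=> sA sb; apply: cmx_smooth_onD => //; first apply: cmx_smooth_onD => //.
  - by apply: cmx_smooth_onZ => //; apply: cmx_smooth_onM => //; exact: cmx_smooth_on_cst.
  - apply: cmx_smooth_onM => //; apply: cmx_smooth_on_toC => //.
    by apply: mx_smooth_onM => //; exact: mx_smooth_on_cst.
  - apply: cmx_smooth_onM => //; apply: cmx_smooth_onD => //; apply: cmx_smooth_onN => //.
    apply: cmx_smooth_onM => //; apply: cmx_smooth_on_toC => //; exact: mx_smooth_on_biv.
have sec1 A b : cmx_smooth_on V A -> cmx_smooth_on V b ->
    (forall y, V y -> dualT10 (I y) (b y) /\ T01 (I y) (A y - b y *m toC (biv (K1 y)))) ->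
    local_section (fun y => eigi (K1 y)) V (s1 A b).
  move=> sA sb Ab; split; first exact: ss1.
  by move=> y Vy; apply: (lift1_eigi (oK1 Vy) (oK2 Vy) (K12 Vy) (gu Vy)); exact: (Ab y Vy).2.
have sec2 A b : cmx_smooth_on V A -> cmx_smooth_on V b ->
    (forall y, V y -> dualT10 (I y) (b y) /\ T01 (I y) (A y - b y *m toC (biv (K1 y)))) ->
    local_section (fun y => eigi (K2 y)) V (fun y => s1 A b y - (2 * 'i%C) *: (b y *m incT')).
  move=> sA sb Ab; split.
    apply: cmx_smooth_onD => //; first exact: ss1.
    apply: cmx_smooth_onN => //; apply: cmx_smooth_onZ => //; apply: cmx_smooth_onM => //.
    exact: cmx_smooth_on_cst.
  move=> y Vy; have [b10 A01] := Ab y Vy.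
  exact: (lift2_eigi (oK1 Vy) (oK2 Vy) (K12 Vy) (gu Vy) b10 A01).
have ps1 A b : {in V, forall y, lsubmx (s1 A b y) = A y}.
  by move=> y; rewrite inE => Vy; rewrite -mul_prT; exact: (lift1_prT (gu Vy)).
have := half_diff_courant oV Vx (ss1 _ _ sY sz) (ss1 _ _ sY' sz') sz sz' (ps1 _ _) (ps1 _ _)
  (inv1 (sec1 _ _ sY sz Yz) (sec1 _ _ sY' sz' Yz') Vx)
  (inv2 (sec2 _ _ sY sz Yz) (sec2 _ _ sY' sz' Yz') Vx).
move/(half_diff_eigiP (oK1 Vx) (oK2 Vx) (K12 Vx) (gu Vx)); rewrite -/theta => -[th YY].
split; first exact: th.
have := T01D YY (cxS_T01 (biv (K1 x)) (II Vx) th); rewrite -/(S x).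
move: (theta *m toC _) (theta *m S x) => e f.
by rewrite addrA subrK.
Qed.

End AtPoint.

End LocalPair.

(** * Holomorphy and Jacobi identity of the (2,0)-part *)

Section LocalHolomorphicPoisson.
Context {R : realType} {n : nat}.
Variable V : set 'rV[R]_n.
Hypothesis oV : open V.
Variables (I P : 'rV[R]_n -> 'M[R]_n) (S p10 : 'rV[R]_n -> 'M[R[i]]_n).
Hypotheses (sI : mx_smooth_on V I) (sP : mx_smooth_on V P).
Hypothesis II : forall y, V y -> I y *m I y = - 1%:M.
Hypothesis skP : forall y, V y -> (P y)^T = - P y.
Hypothesis pE : forall y, p10 y = proj10 (I y).
Hypothesis SE : forall y, S y = cxS (I y) (P y).
Variable x : 'rV[R]_n.
Hypothesis Vx : V x.
Hypothesis inv01 : forall X Y : 'rV[R]_n -> 'rV[R[i]]_n,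
  local_section (fun y => T01 (I y)) V X -> local_section (fun y => T01 (I y)) V Y ->
  T01 (I x) (X x *m jacmx Y x - Y x *m jacmx X x).
Hypothesis invL : forall Y z Y' z' : 'rV[R]_n -> 'rV[R[i]]_n,
  cmx_smooth_on V Y -> cmx_smooth_on V z -> cmx_smooth_on V Y' -> cmx_smooth_on V z' ->
  (forall y, V y -> dualT10 (I y) (z y) /\ T01 (I y) (Y y - z y *m S y)) ->
  (forall y, V y -> dualT10 (I y) (z' y) /\ T01 (I y) (Y' y - z' y *m S y)) ->
  let theta := Y x *m jacmx z' x + z' x *m (jacmx Y x)^T
               - (Y' x *m jacmx z x - Y' x *m (jacmx z x)^T) in
  dualT10 (I x) theta /\ T01 (I x) (Y x *m jacmx Y' x - Y' x *m jacmx Y x - theta *m S x).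

Let sp10 : cmx_smooth_on V p10.
Proof.
by apply: (cmx_smooth_on_eq oV) (cmx_smooth_on_proj10 oV sI) => y _; rewrite pE.
Qed.

Let sS : cmx_smooth_on V S.
Proof.
have h : cmx_smooth_on V (fun y => (p10 y)^T *m toC (P y) *m p10 y).
  apply: cmx_smooth_onM => //; apply: cmx_smooth_onM => //; first exact: cmx_smooth_on_tr.
  exact: cmx_smooth_on_toC.
by apply: (cmx_smooth_on_eq oV) h => y _; rewrite SE pE.
Qed.

Let T10p y (X : 'rV[R[i]]_n) : V y -> T10 (I y) X <-> X *m p10 y = X.
Proof. by move=> Vy; rewrite pE; exact: T10_proj10. Qed.

Let T01p y (X : 'rV[R[i]]_n) : V y -> T01 (I y) X <-> X *m p10 y = 0.
Proof. by move=> Vy; rewrite pE; exact: T01_proj10. Qed.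

Let dualp y (X : 'rV[R[i]]_n) : V y -> dualT10 (I y) X <-> X *m (p10 y)^T = X.
Proof. by move=> Vy; rewrite pE; exact: dualT10_proj10. Qed.

Let pp y : V y -> p10 y *m p10 y = p10 y.
Proof. by move=> Vy; rewrite pE proj10_idem //; exact: II. Qed.

Let pS y : V y -> (p10 y)^T *m S y = S y.
Proof. by move=> Vy; rewrite pE SE proj10_cxS //; exact: II. Qed.

Let Sp y : V y -> S y *m p10 y = S y.
Proof. by move=> Vy; rewrite pE SE cxS_proj10 //; exact: II. Qed.

Let skS y : V y -> (S y)^T = - S y.
Proof. by move=> Vy; rewrite SE cxS_skew //; exact: skP. Qed.

Let T10S y (d : 'rV[R[i]]_n) : V y -> T10 (I y) (d *m S y).
Proof. by move=> Vy; apply/(T10p _ Vy); rewrite -mulmxA Sp. Qed.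

Let Sc (c : 'rV[R[i]]_n) : S x *m c^T = - (c *m S x)^T.
Proof. by rewrite trmx_mul skS // mulNmx opprK. Qed.

Let cst (d : 'rV[R[i]]_n) : cmx_smooth_on V (fun=> d).
Proof. exact: cmx_smooth_on_cst. Qed.

Let dmx_cstM v (F : 'rV[R]_n -> 'M[R[i]]_n) (d : 'rV[R[i]]_n) : cmx_smooth_on V F ->
  dmx v (fun y => d *m F y) x = d *m dmx v F x.
Proof.
by move=> sF; rewrite (dmxM oV Vx v (cst d) sF) dmx_cst mul0mx add0r.
Qed.

Let dmx_cstMp v (d : 'rV[R[i]]_n) :
  dmx v (fun y => d *m (p10 y)^T) x = d *m (dmx v p10 x)^T.
Proof.
have spT : cmx_smooth_on V (fun y => (p10 y)^T) by exact: cmx_smooth_on_tr.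
by rewrite (dmx_cstM v d spT) (dmx_tr oV Vx).
Qed.

(* Differentiating p10 p10 = p10 shows that the derivative of p10 maps T10 to
   T01. *)
Lemma dualT10_dproj10 v (a Y : 'rV[R[i]]_n) : dualT10 (I x) a -> T10 (I x) Y ->
  a *m (dmx v p10 x)^T *m Y^T = 0.
Proof.
move=> a10 /(T10p _ Vx) Y10; rewrite -mulmxA -trmx_mul; apply: dualT10_T01 a10 _.
apply/(T01p _ Vx).
have /(congr1 (mulmx Y)) : dmx v p10 x = dmx v p10 x *m p10 x + p10 x *m dmx v p10 x.
  rewrite -(dmxM oV Vx) //; apply: (dmx_eq oV Vx) => y; rewrite inE => Vy.
  by rewrite pp.
rewrite mulmxDr !mulmxA Y10 => /eqP; rewrite -subr_eq subrr eq_sym => /eqP //.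
Qed.

(** Test sections of [L_sigma]: a constant covector need not be of type (1,0) at nearby points, so
    it is projected pointwise. The tangent part is still [a S], since [S] absorbs the projection. *)
Let sec_cxS (a : 'rV[R[i]]_n) : let z := fun y => a *m (p10 y)^T in let Y := fun y => a *m S y in
  [/\ cmx_smooth_on V Y, cmx_smooth_on V z &
    forall y, V y -> dualT10 (I y) (z y) /\ T01 (I y) (Y y - z y *m S y)].
Proof.
split; [exact: cmx_smooth_onM| |].
  by apply: cmx_smooth_onM => //; exact: cmx_smooth_on_tr.
move=> y Vy; split; first by apply/(dualp _ Vy); rewrite -mulmxA -trmx_mul pp.
by rewrite -[X in T01 _ (_ - X)]mulmxA (pS Vy) subrr; exact: T01_0.
Qed.

(** The bracket of [(Z, 0)] with [(ze S, ze p10^T)] has a tangent part that equals the image under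
    [S] of its covector part up to type (0,1). Paired with [eta], this is the claim plus a
    derivative of [p10], which [dualT10_dproj10] kills. *)
Lemma cxS_holomorphic (Z : 'rV[R]_n -> 'rV[R[i]]_n) (ze eta : 'rV[R[i]]_n) :
  local_section (fun y => T01 (I y)) V Z -> dualT10 (I x) ze -> dualT10 (I x) eta ->
  ze *m lie_bivector Z S x *m eta^T = 0.
Proof.
move=> [sZ ZI] ze10 eta10; have [sY sz Yz] := sec_cxS ze.
have Z0 y : V y -> dualT10 (I y) 0 /\ T01 (I y) (Z y - 0 *m S y).
  move=> Vy; rewrite mul0mx subr0; split; last exact: ZI.
  by rewrite /dualT10 /= mul0mx scaler0.
have [_] := invL sZ (cst 0) sY sz Z0 Yz.
rewrite jacmx_cst trmx0 !mulmx0 subrr subr0.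
have zeE := (dualp _ Vx).1 ze10; rewrite zeE.
rewrite !(mul_jacmx (Z x)) (dmx_cstM _ _ sS) dmx_cstMp mulmxDl.
move/(dualT10_T01 eta10)/(congr1 trmx); rewrite trmx_mul trmxK trmx0.
have E := dualT10_dproj10 (Z x) ze10 (T10S eta Vx).
have -> : lie_bivector Z S x = dmx (Z x) S x - (jacmx Z x)^T *m S x - S x *m jacmx Z x.
  apply/matrixP => i j; rewrite [LHS]mxE 2!sumrB.
  have mB (A B : 'M[R[i]]_n) : (A - B) i j = A i j - B i j by rewrite !mxE.
  rewrite !mB; congr (_ - _ - _).
  - by rewrite mxE.
  - by rewrite mxE; apply: eq_bigr => k _; rewrite !mxE mulrC.
  - by rewrite mxE; apply: eq_bigr => k _; rewrite !mxE.
have E' : ze *m (dmx (Z x) p10 x)^T *m S x *m eta^T = 0.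
  by rewrite -mulmxA Sc mulmxN E oppr0.
move=> F; rewrite !mulmxBl mulmxDl E' add0r in F.
by rewrite !mulmxBr !mulmxBl !mulmxA addrAC.
Qed.

(** The conjugates of the fields [a S] and [b S] are of type (0,1), where involutivity is available;
    conjugating back gives type (1,0). *)
Lemma cxS_lie_T10 (a b : 'rV[R[i]]_n) : let X := fun y => a *m S y in let Y := fun y => b *m S y in
  T10 (I x) (X x *m jacmx Y x - Y x *m jacmx X x).
Proof.
move=> X Y; have [sX _ _] := sec_cxS a; have [sY _ _] := sec_cxS b.
have sec d : local_section (fun y => T01 (I y)) V (fun y => conj_mx (d *m S y)).
  have [sd _ _] := sec_cxS d; split; first exact: cmx_smooth_on_conj.
  by move=> y Vy; apply/T01_conj; rewrite conj_mxK; exact: T10S.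
have := inv01 (sec a) (sec b).
rewrite (jacmx_conj oV Vx sX) (jacmx_conj oV Vx sY) -!conj_mxM -conj_mxN -conj_mxD => /T01_conj.
by rewrite conj_mxK.
Qed.

(* A covector of type (0,1) annihilates S and the brackets of the T10-valued
   fields a S and b S; for covectors of type (1,0) the Jacobiator is read off
   the bracket of the sections (a S, a p10^T) and (b S, b p10^T). *)
Lemma cxS_jacobi : jacobi cpd S x.
Proof.
apply: jacobi_jac3.
have skSV : {in V, forall y, (S y)^T = - S y} by move=> y; rewrite inE; exact: skS.
have cyc a b c : jac3 x S a b c = jac3 x S b c a.
  by rewrite /jac3 [RHS]addrC addrA.
have lin a b c d : jac3 x S a b (c + d) = jac3 x S a b c + jac3 x S a b d.
  rewrite !(jac3E oV Vx) // linearD /= !mulmxDr; set e := _ *m c^T; set f := _ *m d^T.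
  by rewrite opprD addrACA.
have red a b c : jac3 x S a b c = jac3 x S a b (c *m (p10 x)^T).
  suff c0 : jac3 x S a b (c - c *m (p10 x)^T) = 0.
    by rewrite -{1}(subrK (c *m (p10 x)^T) c) lin c0 add0r.
  have /(T10p _ Vx) W10 := cxS_lie_T10 a b.
  have cS0 : (c - c *m (p10 x)^T) *m S x = 0.
    by rewrite mulmxBl -[X in _ - X]mulmxA (pS Vx) subrr.
  rewrite (jac3E oV Vx) // -[_ *m (jacmx _ x)^T *m S x *m _]mulmxA Sc cS0.
  rewrite trmx0 oppr0 mulmx0 subr0 linearB /= trmx_mul trmxK mulmxBr mulmxA W10.
  by rewrite subrr.
(* [red] projects the third covector only; a cyclic rotation after each use reaches all three. *)
move=> a b c; rewrite red cyc red cyc red cyc.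
have mulp10 d : dualT10 (I x) (d *m (p10 x)^T).
  by apply/(dualp _ Vx); rewrite -mulmxA -trmx_mul pp.
move: (a *m _) (b *m _) (c *m _) (mulp10 a) (mulp10 b) (mulp10 c) => {a b c} a b c a10 b10 c10.
have [sX sz Xz] := sec_cxS a; have [sY sw Yw] := sec_cxS b.
have bE := (dualp _ Vx).1 b10.
pose jX := jacmx (fun y => a *m S y) x; pose jY := jacmx (fun y => b *m S y) x.
pose jz := jacmx (fun y => a *m (p10 y)^T) x; pose jw := jacmx (fun y => b *m (p10 y)^T) x.
pose th := a *m S x *m jw + b *m jX^T - (b *m S x *m jz - b *m S x *m jz^T).
have th01 : T01 (I x) (a *m S x *m jY - b *m S x *m jX - th *m S x).
  by have [_] := invL sX sz sY sw Xz Yw; rewrite bE.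
have jac0 (v d W : 'rV[R[i]]_n) : dualT10 (I x) d -> T10 (I x) W ->
    v *m jacmx (fun y => d *m (p10 y)^T) x *m W^T = 0.
  by move=> d10 WI; rewrite mul_jacmx dmx_cstMp dualT10_dproj10.
have jac0' (v W : 'rV[R[i]]_n) : T10 (I x) v -> v *m jz^T *m W^T = 0.
  by move=> vI; apply: trmx_inj; rewrite !trmx_mul !trmxK mulmxA jac0 ?trmx0.
have e1 : a *m S x *m jw *m (c *m S x)^T = 0 := jac0 _ _ _ b10 (T10S c Vx).
have e2 : b *m S x *m jz *m (c *m S x)^T = 0 := jac0 _ _ _ a10 (T10S c Vx).
have e3 : b *m S x *m jz^T *m (c *m S x)^T = 0 := jac0' _ _ (T10S b Vx).
have lie10 : T10 (I x) (a *m S x *m jY - b *m S x *m jX) := cxS_lie_T10 a b.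
rewrite (jac3E oV Vx) // -/jX -/jY.
clearbody jX jY jz jw.
(* Both sides are of type (1,0), and involutivity of [L_sigma] makes their difference of type (0,1);
   hence it is zero. *)
have thE : a *m S x *m jY - b *m S x *m jX = th *m S x.
  apply: subr0_eq; apply: (T10_T01_0 _ th01).
  by apply/(T10p _ Vx); rewrite mulmxBl ((T10p _ Vx).1 lie10) -[X in _ - X]mulmxA (Sp Vx).
rewrite thE -[th *m S x *m _]mulmxA -[b *m jX^T *m S x *m _]mulmxA Sc !mulmxN.
by rewrite /th mulmxBl mulmxDl [(_ - _) *m _]mulmxBl e1 e2 e3 add0r !subr0 subrr.
Qed.

End LocalHolomorphicPoisson.

(** * Change of charts and passage to the manifold *)

Lemma biv_transition (R : realType) n (A B : 'M[R]_(n + n)) (j : 'M[R]_n) :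
  j \in unitmx ->
  A *m block_mx j 0 0 (invmx j)^T = block_mx j 0 0 (invmx j)^T *m B ->
  biv B = j^T *m biv A *m j.
Proof.
move=> ju AB; set T := block_mx _ _ _ _ in AB.
have Tp : T *m prT = prT *m j.
  by rewrite /T mul_block_col mul_col_mx !mulmx0 !mul0mx mul1mx !mulmx1 !addr0.
have oT : incT' *m T = (invmx j)^T *m incT'.
  by rewrite /T mul_row_block mul_mx_row !mulmx0 !mul0mx mul1mx !mulmx1 !add0r.
have jj : j^T *m (invmx j)^T = 1%:M by rewrite -trmx_mul mulVmx // trmx1.
rewrite /biv -(mulmxA _ _ j) -(mulmxA _ prT) -Tp !mulmxA -(mulmxA _ A) AB !mulmxA.
by rewrite -(mulmxA j^T) oT !mulmxA jj mul1mx.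
Qed.

Lemma cxS_transition (R : realType) n (I I' P P' j : 'M[R]_n) :
  I *m j = j *m I' -> P' = j^T *m P *m j ->
  cxS I' P' = (toC j)^T *m cxS I P *m toC j.
Proof.
move=> Ij ->; have E : toC j *m proj10 I' = proj10 I *m toC j.
  rewrite /proj10 -scalemxAr -scalemxAl; congr (_ *: _).
  by rewrite mulmxBr mulmxBl mulmx1 mul1mx -scalemxAr -scalemxAl -!toCM Ij.
have ET : (proj10 I')^T *m (toC j)^T = (toC j)^T *m (proj10 I)^T.
  by rewrite -trmx_mul E trmx_mul.
rewrite /cxS (toCM (j^T *m P) j) (toCM j^T P) toC_tr.
move: (proj10 I) (proj10 I') (toC P) (toC j) E ET => p p' Q J E ET.
by rewrite !mulmxA ET -!mulmxA E.
Qed.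

Section Manifold.
Context {R : realType} {n : nat} {M : smoothManifold R n}.
Variable H : chartwise M ('I_n -> 'I_n -> 'I_n -> R).
Implicit Types (L : cbundle M) (c d : charts M).

Lemma coord_chart_range c (p : M) : dom c p -> chart_range c (Defs.coord c p).
Proof. by move=> cp; exists p. Qed.

Lemma open_chart_range c : open (chart_range c).
Proof. exact: range_open. Qed.

Lemma chart_open_range c : chart_open c (chart_range c).
Proof. by split=> //; exact: open_chart_range. Qed.

Lemma complex_dirac_eq L L' : eq_bundle L L' -> complex_dirac H L -> complex_dirac H L'.
Proof.
move=> LL [[trL frL] mL iL]; split.
- split.
    move=> c d p cp dp u; have := trL c d p cp dp u.
    by rewrite (LL c _ (coord_chart_range cp)) (LL d _ (coord_chart_range dp)).
  move=> c x0 cx0; have [V [k [F [oV Vx0 sF FL]]]] := frL c x0 cx0.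
  exists V, k, F; split=> // x Vx; have [fF Fx] := FL x Vx; split=> // u.
  by have := Fx u; rewrite (LL c _ (oV.2 _ Vx)).
- by move=> c x cx; have := mL c x cx; rewrite (LL c _ cx).
- move=> c V s t oV [ss sL] [st tL] x Vx; rewrite -(LL c _ (oV.2 _ Vx)).
  have sec u : cmx_smooth_on V u -> (forall y, V y -> L' c y (u y)) -> local_section (L c) V u.
    by move=> su uL; split=> // y Vy; rewrite (LL c _ (oV.2 _ Vy)); exact: uL.
  exact: (iL c V s t oV (sec s ss sL) (sec t st tL) x Vx).
Qed.

(** The transformation law is an equivalence. If the Jacobian kills [v], then [row_mx v 0] is
    carried to 0, which lies in the bundle; so [row_mx v 0] is a real element of the bundle and
    vanishes. *)
Lemma subbundle_jac_unit L c d (p : M) : subbundle L -> dom c p -> dom d p ->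
  (forall w : 'rV[R]_(n + n), L c (Defs.coord c p) (toC w) -> w = 0) -> jac c d p \in unitmx.
Proof.
move=> [trL frL] cp dp L0; rewrite -row_free_unit; apply: inj_row_free => v vj.
have Lc0 : L c (Defs.coord c p) 0.
  have [V [k [F [oV Vx sF FL]]]] := frL c _ (coord_chart_range cp).
  by apply/(FL _ Vx).2; exact: sub0mx.
have : L c (Defs.coord c p) (toC (row_mx v 0)).
  apply/(trL c d p cp dp); rewrite -toCM mul_row_block vj !mulmx0 !mul0mx !addr0 row_mx0 toC0.
  by move/(trL c d p cp dp): Lc0; rewrite mul0mx.
by move/L0/(congr1 lsubmx); rewrite row_mxKl linear0.
Qed.

(** The law carries the eigenvector [u - i uJ], with [u] real, to an eigenvector in the other chart;
    its real and imaginary parts give the identity on [u]. *)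
Lemma eigi_transition L (J : chartwise M 'M[R]_(n + n)) c d (p : M) :
  subbundle L -> eq_bundle L (fun c x => eigi (J c x)) ->
  (forall c x, chart_range c x -> orth_cx (J c x)) -> dom c p -> dom d p ->
  J c (Defs.coord c p) *m transition c d p = transition c d p *m J d (Defs.coord d p).
Proof.
move=> [trL _] LJ oJ cp dp; have [cx dx] := (coord_chart_range cp, coord_chart_range dp).
have [JJ _] := oJ _ _ cx.
apply/row_matrixP => i; rewrite !rowE !mulmxA; set u := delta_mx 0 i.
have : eigi (J c (Defs.coord c p)) (toC u + 'i%C *: toC (- (u *m J c (Defs.coord c p)))).
  by apply/eigi_realE; rewrite opprK mulNmx -mulmxA JJ mulmxN mulmx1 opprK.
have := trL c d p cp dp (toC u + 'i%C *: toC (- (u *m J c (Defs.coord c p)))).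
rewrite (LJ c _ cx) (LJ d _ dx) => -[E _] /E; rewrite mulmxDl -scalemxAl -!toCM.
by move=> /eigi_realE[-> _]; rewrite mulNmx opprK.
Qed.

Lemma eigi_smooth L (J : chartwise M 'M[R]_(n + n)) c :
  subbundle L -> eq_bundle L (fun c x => eigi (J c x)) ->
  (forall c x, chart_range c x -> maximal_isotropic (L c x)) ->
  mx_smooth_on (chart_range c) (J c).
Proof.
move=> [_ frL] LJ mL i j; apply: smooth_on_local => x cx.
have [V [k [F [[oV Vc] Vx sF FL]]]] := frL c x cx.
have [fF Fx] := FL x Vx.
have kn := maximal_isotropic_rank (mL c x cx) fF Fx; subst k.
exists V => //.
have uF y : V y -> col_mx (Remx (F y)) (Immx (F y)) \in unitmx.
  move=> Vy; have [fFy Fy] := FL y Vy; apply: col_Re_Im_unit => // u.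
  by move=> /Fy + /Fy; rewrite (LJ c _ (Vc _ Vy)); exact: eigi_disj.
have sR : mx_smooth_on V (fun y => Remx (F y)).
  by move=> a b; have [sre _] := sF a b; apply: (smooth_on_eq oV) sre => y _; rewrite [RHS]mxE.
have sIm : mx_smooth_on V (fun y => Immx (F y)).
  by move=> a b; have [_ sim] := sF a b; apply: (smooth_on_eq oV) sim => y _; rewrite [RHS]mxE.
have : mx_smooth_on V (fun y => cx_of (F y)).
  apply: mx_smooth_onM => //; last by apply: mx_smooth_on_col => //; exact: mx_smooth_onN.
  by apply: mx_smooth_on_inv => //; exact: mx_smooth_on_col.
move=> /(_ i j); apply: (smooth_on_eq oV) => y; rewrite inE => Vy.
have [fFy Fy] := FL y Vy; rewrite (cx_of_uniq (J := J c y) (uF y Vy)) //.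
apply/row_matrixP => a; rewrite row_mul.
have : L c y (row a (F y)) by apply/Fy; exact: row_sub.
by rewrite (LJ c _ (Vc _ Vy)) => /eigiE ->; apply/rowP => b; rewrite !mxE.
Qed.

Definition involutive_eigi (J : chartwise M 'M[R]_(n + n)) : Prop :=
  forall c V, chart_open c V -> involutive_on V (H c) (fun y => eigi (J c y)).

Lemma involutive_eigiN J : involutive_eigi J -> involutive_eigi (fun c x => - J c x).
Proof.
move=> iJ c V oV s t [ss sJ] [st tJ] x Vx.
have sec u : cmx_smooth_on V u -> (forall y, V y -> eigi (- J c y) (u y)) ->
    local_section (fun y => eigi (J c y)) V (fun y => conj_mx (u y)).
  move=> su uJ; split; first by apply: cmx_smooth_on_conj => //; exact: oV.1.
  by move=> y /uJ; rewrite -conj_set_eigi.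
rewrite -conj_set_eigi /conj_set /= -(courant_conj oV.1 Vx) //.
exact: (iJ c V oV) (sec _ ss sJ) (sec _ st tJ) x Vx.
Qed.

Lemma generalized_complex_biv_poisson (J : chartwise M 'M[R]_(n + n)) :
  (forall c d p, dom c p -> dom d p -> jac c d p \in unitmx) ->
  generalized_complex H J -> poisson (fun c x => biv (J c x)).
Proof.
move=> ju [[sJ trJ] JJ oJ [_ _ iJ]].
have oxJ c x : chart_range c x -> orth_cx (J c x) by move=> cx; split; [exact: JJ|exact: oJ].
have inv : involutive_eigi J by move=> c V oV s t sS tS x Vx; exact: (iJ c V s t oV sS tS x Vx).
split.
- by move=> c; apply: mx_smooth_on_biv; [exact: open_chart_range|exact: sJ].
- by move=> c d p cp dp; apply: biv_transition; [exact: ju|exact: trJ].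
- by move=> c x /oxJ; exact: biv_skew.
- move=> c x cx; apply: (biv_jacobi (open_chart_range (c := c)) (H := H c) (sJ c)) => //.
  + exact: oxJ.
  + exact: inv (chart_open_range c).
  + exact: (involutive_eigiN inv) (chart_open_range c).
Qed.

(** Assuming an invertible block of [G] rather than positivity lets this cover [(J1, J2)] and
    [(J1, - J2)] alike; between the two the block changes sign. *)
Lemma commuting_holomorphic_poisson (K1 K2 : chartwise M 'M[R]_(n + n)) :
  (forall c d p, dom c p -> dom d p -> jac c d p \in unitmx) ->
  (forall c, mx_smooth_on (chart_range c) (K1 c)) ->
  (forall c, mx_smooth_on (chart_range c) (K2 c)) ->
  (forall c d p, dom c p -> dom d p ->
    K1 c (Defs.coord c p) *m transition c d p = transition c d p *m K1 d (Defs.coord d p)) ->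
  (forall c d p, dom c p -> dom d p ->
    K2 c (Defs.coord c p) *m transition c d p = transition c d p *m K2 d (Defs.coord d p)) ->
  (forall c x, chart_range c x -> orth_cx (K1 c x)) ->
  (forall c x, chart_range c x -> orth_cx (K2 c x)) ->
  (forall c x, chart_range c x -> K1 c x *m K2 c x = K2 c x *m K1 c x) ->
  (forall c x, chart_range c x -> biv (- (K1 c x *m K2 c x)) \in unitmx) ->
  involutive_eigi K1 -> involutive_eigi K2 ->
  defines_holomorphic_poisson (fun c x => half_diff (eigi (K1 c x)) (eigi (K2 c x))).
Proof.
move=> ju sK1 sK2 tr1 tr2 o1 o2 K12 gu i1 i2.
pose I c x := cxI (K1 c x) (K2 c x); pose S c x := cxS (I c x) (biv (K1 c x)).
have II c x : chart_range c x -> I c x *m I c x = - 1%:M.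
  by move=> cx; exact: (cxI_sqr (o1 _ _ cx) (o2 _ _ cx) (K12 _ _ cx) (gu _ _ cx)).
have skP c x : chart_range c x -> (biv (K1 c x))^T = - biv (K1 c x).
  by move=> /o1; exact: biv_skew.
have trP1 c d p (cp : dom c p) (dp : dom d p) := biv_transition (ju c d p cp dp) (tr1 c d p cp dp).
have trP2 c d p (cp : dom c p) (dp : dom d p) := biv_transition (ju c d p cp dp) (tr2 c d p cp dp).
have trg c d p : dom c p -> dom d p ->
    biv (- (K1 d (Defs.coord d p) *m K2 d (Defs.coord d p))) =
    (jac c d p)^T *m biv (- (K1 c (Defs.coord c p) *m K2 c (Defs.coord c p))) *m jac c d p.
  move=> cp dp; apply: biv_transition; first exact: ju.
  by rewrite mulNmx mulmxN -mulmxA (tr2 c d p) // mulmxA (tr1 c d p) // mulmxA.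
have trI c d p : dom c p -> dom d p ->
    I c (Defs.coord c p) *m jac c d p = jac c d p *m I d (Defs.coord d p).
  move=> cp dp; have [cx dx] := (coord_chart_range cp, coord_chart_range dp).
  set j := jac c d p; have juu : j \in unitmx by exact: ju.
  have jTu : j^T \in unitmx by rewrite unitmx_tr.
  (* Multiplying by the invertible [g] and [j^T] reduces the law for [I] to the laws for [g] and for
     [g I], which is minus the sum of the two bivectors. *)
  apply: (can_inj (mulKmx (gu _ _ cx))); apply: (can_inj (mulKmx jTu)).
  set gc := biv _.
  have -> : j^T *m (gc *m (j *m I d (Defs.coord d p))) =
      biv (- (K1 d (Defs.coord d p) *m K2 d (Defs.coord d p))) *m I d (Defs.coord d p).
    by rewrite (trg c d p cp dp) !mulmxA.
  rewrite (g_cxI (gu _ _ dx)) (mulmxA gc) (g_cxI (gu _ _ cx)).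
  rewrite (trP1 c d p cp dp) (trP2 c d p cp dp) -/j.
  by rewrite mulNmx mulmxN mulmxDl mulmxDr !mulmxA.
have local c V : chart_open c V ->
  [/\ open V, mx_smooth_on V (K1 c) & mx_smooth_on V (K2 c)].
  by move=> [oV Vc]; split=> //; exact: mx_smooth_on_subset Vc _.
exists I, S; split; last first.
  move=> c x cx; apply: L_sigmaP; first exact: II.
  by move=> Y z; exact: (half_diff_eigiP (o1 _ _ cx) (o2 _ _ cx) (K12 _ _ cx) (gu _ _ cx)).
split.
- split=> //.
  + by move=> c; apply: mx_smooth_on_cxI => //; [exact: open_chart_range|move=> y; exact: gu].
  + move=> c V X Y cV XI YI x Vx; have [oV s1 s2] := local c V cV; have Vc := cV.2.
    rewrite lie_bracketE; apply: (T01_involutive oV s1 s2 _ _ _ _ (i1 c V cV) (i2 c V cV) Vx XI YI).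
    * by move=> y /Vc; exact: o1.
    * by move=> y /Vc; exact: o2.
    * by move=> y /Vc; exact: K12.
    * by move=> y /Vc; exact: gu.
- split.
    by move=> c; apply: cmx_smooth_on_cxS => //; [exact: open_chart_range|move=> y; exact: gu].
  move=> c d p cp dp; exact: cxS_transition (trI c d p cp dp) (trP1 c d p cp dp).
- move=> c x cx; split; first by apply: cxS_skew; exact: skP.
  by move=> ze; apply: T10_cxS; exact: II.
- move=> c V Z cV ZI x Vx ze eta ze10 eta10; have [oV s1 s2] := local c V cV.
  have oV1 y : V y -> orth_cx (K1 c y) by move/cV.2; exact: o1.
  have oV2 y : V y -> orth_cx (K2 c y) by move/cV.2; exact: o2.
  have cV12 y : V y -> K1 c y *m K2 c y = K2 c y *m K1 c y by move/cV.2; exact: K12.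
  have gV y : V y -> biv (- (K1 c y *m K2 c y)) \in unitmx by move/cV.2; exact: gu.
  have IV y : V y -> I c y *m I c y = - 1%:M by move/cV.2; exact: II.
  have skV y : V y -> (biv (K1 c y))^T = - biv (K1 c y) by move/cV.2; exact: skP.
  have invL := @half_diff_involutive _ _ _ oV (H c) _ _ s1 s2 oV1 oV2 cV12 gV
    (i1 c V cV) (i2 c V cV) x Vx.
  exact: (cxS_holomorphic oV (mx_smooth_on_cxI oV s1 s2 gV) (mx_smooth_on_biv oV s1) IV skV
    (fun _ => erefl) (fun _ => erefl) Vx invL ZI ze10 eta10).
- move=> c x cx; have oV := @open_chart_range c; have cV := chart_open_range c.
  have gV : forall y, chart_range c y -> biv (- (K1 c y *m K2 c y)) \in unitmx by exact: gu.
  have inv01 := @T01_involutive _ _ _ oV (H c) _ _ (sK1 c) (sK2 c) (o1 c) (o2 c) (K12 c) gV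
    (i1 c _ cV) (i2 c _ cV) x cx.
  have invL := @half_diff_involutive _ _ _ oV (H c) _ _ (sK1 c) (sK2 c) (o1 c) (o2 c) (K12 c) gV
    (i1 c _ cV) (i2 c _ cV) x cx.
  exact: (cxS_jacobi oV (mx_smooth_on_cxI oV (sK1 c) (sK2 c) gV) (mx_smooth_on_biv oV (sK1 c))
    (II c) (skP c) (fun _ => erefl) (fun _ => erefl) cx inv01 invL).
Qed.

End Manifold.

(** * The two directions of the equivalence *)

Section GeneralizedKahler.
Context {R : realType} {n : nat} {M : smoothManifold R n}.
Variable H : chartwise M ('I_n -> 'I_n -> 'I_n -> R).
Implicit Types L : cbundle M.

Lemma defines_holomorphic_poisson_eq L L' : eq_bundle L L' ->
  defines_holomorphic_poisson L -> defines_holomorphic_poisson L'.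
Proof.
move=> LL [I [S [hp LS]]]; exists I, S; split=> // c x cx.
by rewrite -(LL c x cx); exact: LS.
Qed.

Lemma generalized_complex_eigi L (J : chartwise M 'M[R]_(n + n)) :
  complex_dirac H L -> eq_bundle L (fun c x => eigi (J c x)) ->
  (forall c x, chart_range c x -> orth_cx (J c x)) -> generalized_complex H J.
Proof.
move=> dL LJ oJ; have [sL mL iL] := dL; split.
- split=> [c|c d p cp dp]; first exact: eigi_smooth sL LJ mL.
  exact: eigi_transition sL LJ oJ cp dp.
- by move=> c x /oJ[].
- by move=> c x /oJ[].
- exact: complex_dirac_eq LJ dL.
Qed.

(** [J] is chosen point by point, with value 0 where no choice exists. Since it is determined by its
    eigenspace, its smoothness and transformation law are recovered afterwards from those of [L]. *)
Lemma disjoint_conj_eigi L : complex_dirac H L ->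
  (forall c x, chart_range c x -> sum_full (projT (L c x)) (projT (conj_set (L c x)))) ->
  (forall c x, chart_range c x ->
    capT (real_set (half_diff (L c x) (conj_set (L c x)))) = [set 0]) ->
  exists2 J : chartwise M 'M[R]_(n + n), forall c x, chart_range c x -> orth_cx (J c x) &
    eq_bundle L (fun c x => eigi (J c x)).
Proof.
move=> [[_ frL] mL _] full cap.
pose Q c x : set 'M[R]_(n + n) := [set J | orth_cx J /\ L c x = eigi J].
have QP c x : chart_range c x -> Q c x (xget 0 (Q c x)).
  move=> cx; apply: xgetPex; have [V [k [F [_ Vx _ FL]]]] := frL c x cx.
  have [fF Fx] := FL x Vx; have [sub iso _] := mL c x cx.
  have [J [JJ oJ LJ]] := maximal_isotropic_eigi (mL c x cx) fF Fx
    (disjoint_conj sub iso (full c x cx) (cap c x cx)).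
  by exists J.
by exists (fun c x => xget 0 (Q c x)) => c x /QP[].
Qed.

Variables L1 L2 : cbundle M.

Let condition_i := forall c x, chart_range c x ->
  sum_full (projT (L1 c x)) (projT (conj_set (L1 c x))) /\
  sum_full (projT (L2 c x)) (projT (conj_set (L2 c x))).

Let condition_ii := forall c x, chart_range c x ->
  capT (real_set (half_diff (L1 c x) (conj_set (L1 c x)))) = [set 0] /\
  capT (real_set (half_diff (L2 c x) (conj_set (L2 c x)))) = [set 0].

Let condition_iii := forall c x, chart_range c x ->
  (let Lp := half_diff (L1 c x) (L2 c x) in
   direct_sum_full (capT Lp) (capT (conj_set Lp))) /\
  (let Lm := half_diff (L1 c x) (conj_set (L2 c x)) in
   direct_sum_full (capT Lm) (capT (conj_set Lm))).

Let condition_iv := forall c x, chart_range c x -> forall u, L1 c x u -> L2 c x u ->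
  u != 0 -> 0 < pairing u (conj_mx u).

Let poisson_ii :=
  @defines_poisson R n M (fun c x => real_set (half_diff (L1 c x) (conj_set (L1 c x)))) /\
  @defines_poisson R n M (fun c x => real_set (half_diff (L2 c x) (conj_set (L2 c x)))).

Let poisson_iii :=
  @defines_holomorphic_poisson R n M (fun c x => half_diff (L1 c x) (L2 c x)) /\
  @defines_holomorphic_poisson R n M (fun c x => half_diff (L1 c x) (conj_set (L2 c x))).

Lemma poisson_ii_fibre : poisson_ii -> condition_ii.
Proof.
move=> [[P1 _ G1] [P2 _ G2]] c x cx; rewrite (G1 c x cx) (G2 c x cx).
by split; exact: capT_graph.
Qed.

Lemma poisson_iii_fibre : poisson_iii -> condition_iii.
Proof.
move=> [[Ip [Sp [[[_ _ IIp _] _ _ _ _] Ep]]] [Im [Sm [[[_ _ IIm _] _ _ _ _] Em]]]] c x cx.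
rewrite (Ep c x cx) (Em c x cx) /=.
by split; apply: direct_sum_L_sigma; [exact: IIp|exact: IIm].
Qed.

Lemma generalized_kahler_conditions : defines_generalized_kahler H L1 L2 ->
  [/\ condition_i, poisson_ii, poisson_iii & condition_iv].
Proof.
move=> [J1 [J2 [[g1 g2 J12] E1 E2]]].
have [[sJ1 tr1] JJ1 oo1 [sb1 _ iv1]] := g1; have [[sJ2 tr2] JJ2 oo2 [_ _ iv2]] := g2.
have o1 c x : chart_range c x -> orth_cx (J1 c x) by move=> cx; split; [exact: JJ1|exact: oo1].
have o2 c x : chart_range c x -> orth_cx (J2 c x) by move=> cx; split; [exact: JJ2|exact: oo2].
have i1 : involutive_eigi H J1 by move=> c V oV s t sS tS x Vx; exact: (iv1 c V s t oV sS tS x Vx).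
have i2 : involutive_eigi H J2 by move=> c V oV s t sS tS x Vx; exact: (iv2 c V s t oV sS tS x Vx).
have LE1 c x : chart_range c x -> L1 c x = eigi (J1 c x) by exact: E1.
have LE2 c x : chart_range c x -> L2 c x = eigi (J2 c x) by exact: E2.
have ju (c d : charts M) (p : M) : dom c p -> dom d p -> jac c d p \in unitmx.
  move=> cp dp; have := subbundle_jac_unit sb1 cp dp; apply=> w; exact: eigi_real0.
have gu c x : chart_range c x -> biv (- (J1 c x *m J2 c x)) \in unitmx.
  by move=> cx; apply: biv_unit; exact: (J12 c x cx).2.
have K12 c x : chart_range c x -> J1 c x *m J2 c x = J2 c x *m J1 c x.
  by move=> cx; exact: (J12 c x cx).1.
split.
- move=> c x cx; rewrite (LE1 c x cx) (LE2 c x cx).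
  by split; apply: sum_full_projT; [exact: o1|exact: o2].
- split.
    exists (fun c x => biv (J1 c x)); first exact: generalized_complex_biv_poisson ju g1.
    by move=> c x cx; rewrite (LE1 c x cx); apply: real_half_diff; exact: o1.
  exists (fun c x => biv (J2 c x)); first exact: generalized_complex_biv_poisson ju g2.
  by move=> c x cx; rewrite (LE2 c x cx); apply: real_half_diff; exact: o2.
- split.
    apply: defines_holomorphic_poisson_eq
      (commuting_holomorphic_poisson ju sJ1 sJ2 tr1 tr2 o1 o2 K12 gu i1 i2) => c x cx.
    by rewrite (LE1 c x cx) (LE2 c x cx).
  (* The conjugate of L2 is the i-eigenbundle of [- J2], so the second holomorphic Poisson structure
     comes from the pair [(J1, - J2)]. *)
  have sN c : mx_smooth_on (chart_range c) (fun x => - J2 c x).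
    by apply: mx_smooth_onN; [exact: open_chart_range|exact: sJ2].
  have trN c d p : dom c p -> dom d p ->
      - J2 c (Defs.coord c p) *m transition c d p = transition c d p *m - J2 d (Defs.coord d p).
    by move=> cp dp; rewrite mulNmx mulmxN (tr2 c d p cp dp).
  have oN c x : chart_range c x -> orth_cx (- J2 c x) by move/o2; exact: orth_cxN.
  have KN c x : chart_range c x -> J1 c x *m - J2 c x = - J2 c x *m J1 c x.
    by move=> cx; rewrite mulmxN mulNmx (K12 c x cx).
  have gN c x : chart_range c x -> biv (- (J1 c x *m - J2 c x)) \in unitmx.
    move=> cx; have -> : biv (- (J1 c x *m - J2 c x)) = - biv (- (J1 c x *m J2 c x)).
      by rewrite /biv !mulmxN !mulNmx.
    by rewrite -scaleN1r unitmxZ ?unitrN1 //; exact: gu.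
  apply: defines_holomorphic_poisson_eq (commuting_holomorphic_poisson ju sJ1 sN tr1 trN o1 oN
    KN gN i1 (involutive_eigiN i2)) => c x cx.
  by rewrite (LE1 c x cx) (LE2 c x cx) conj_set_eigi.
- move=> c x cx u; rewrite (LE1 c x cx) (LE2 c x cx).
  by apply: pairing_conj_pos; exact: (J12 c x cx).2.
Qed.

Lemma conditions_generalized_kahler : complex_dirac H L1 -> complex_dirac H L2 ->
  condition_i -> condition_ii -> condition_iii -> condition_iv ->
  defines_generalized_kahler H L1 L2.
Proof.
move=> dL1 dL2 ci cii ciii civ.
have [J1 o1 E1] := disjoint_conj_eigi dL1 (fun c x cx => (ci c x cx).1)
  (fun c x cx => (cii c x cx).1).
have [J2 o2 E2] := disjoint_conj_eigi dL2 (fun c x cx => (ci c x cx).2)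
  (fun c x cx => (cii c x cx).2).
exists J1, J2; split=> //; split.
- exact: generalized_complex_eigi dL1 E1 o1.
- exact: generalized_complex_eigi dL2 E2 o2.
- move=> c x cx; have := ciii c x cx; have := civ c x cx.
  rewrite (E1 c x cx) (E2 c x cx) => pos [fp fm].
  exact: (orth_cx_commute_positive (o1 c x cx) (o2 c x cx) fp fm pos).
Qed.

End GeneralizedKahler.

(* The conclusion states the equivalence for both sides of each "i.e." in
   conditions (ii) and (iii): first with the fibrewise conditions, then with
   actual Poisson and holomorphic Poisson structures. *)
Theorem proposition4p3 (R : realType) (n : nat) (M : smoothManifold R n)
    (H : chartwise M ('I_n -> 'I_n -> 'I_n -> R)) (L1 L2 : cbundle M)
    (hH : closed_3form H)
    (hL1 : complex_dirac H L1) (hL2 : complex_dirac H L2) :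
  (defines_generalized_kahler H L1 L2 <->
   [/\ (* (i) *)
       forall c x, chart_range c x ->
         sum_full (projT (L1 c x)) (projT (conj_set (L1 c x))) /\
         sum_full (projT (L2 c x)) (projT (conj_set (L2 c x))),
       (* (ii) *)
       forall c x, chart_range c x ->
         capT (real_set (half_diff (L1 c x) (conj_set (L1 c x)))) = [set 0] /\
         capT (real_set (half_diff (L2 c x) (conj_set (L2 c x)))) = [set 0],
       (* (iii) *)
       forall c x, chart_range c x ->
         (let Lp := half_diff (L1 c x) (L2 c x) in
          direct_sum_full (capT Lp) (capT (conj_set Lp))) /\
         (let Lm := half_diff (L1 c x) (conj_set (L2 c x)) in
          direct_sum_full (capT Lm) (capT (conj_set Lm)))
     & (* (iv) *)
       forall c x, chart_range c x -> forall u, L1 c x u -> L2 c x u ->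
         u != 0 -> 0 < pairing u (conj_mx u)])
  /\
  (defines_generalized_kahler H L1 L2 <->
   [/\ (* (i) *)
       forall c x, chart_range c x ->
         sum_full (projT (L1 c x)) (projT (conj_set (L1 c x))) /\
         sum_full (projT (L2 c x)) (projT (conj_set (L2 c x))),
       (* (ii) *)
       @defines_poisson R n M
         (fun c x => real_set (half_diff (L1 c x) (conj_set (L1 c x)))) /\
       @defines_poisson R n M
         (fun c x => real_set (half_diff (L2 c x) (conj_set (L2 c x)))),
       (* (iii) *)
       @defines_holomorphic_poisson R n M
         (fun c x => half_diff (L1 c x) (L2 c x)) /\
       @defines_holomorphic_poisson R n M
         (fun c x => half_diff (L1 c x) (conj_set (L2 c x)))
     & (* (iv) *)
       forall c x, chart_range c x -> forall u, L1 c x u -> L2 c x u ->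
         u != 0 -> 0 < pairing u (conj_mx u)]).
Proof.
(* One cycle proves both equivalences: a generalized Kaehler structure yields actual Poisson
   structures, these yield the fibrewise conditions, and those yield the generalized Kaehler
   structure. *)
have gk ci cii ciii civ := conditions_generalized_kahler hL1 hL2 ci cii ciii civ.
split; split.
- by move=> /generalized_kahler_conditions[ci /poisson_ii_fibre cii /poisson_iii_fibre ciii civ].
- by case=> ci cii ciii civ; exact: gk.
- exact: generalized_kahler_conditions.
- by case=> ci /poisson_ii_fibre cii /poisson_iii_fibre ciii civ; exact: gk.
Qed.
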